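(* Let $\mathcal{W}\subset L^1(\mathbb{C})$ be the family of weights on $\mathbb{C}$ of the form $$W(z)=\frac{1}{2\pi}|z|^n\exp(-\alpha|z|^{2m}),$$ where $n\in(-2,\infty)$ is real, $\alpha,m>0$ are real, and $m\notin\mathbb{Z}$. Then every $W\in\mathcal{W}$ is admissible, and for each nonzero $w\in\mathbb{C}$ the function $K_{\mathbb{C},W}(\,\cdot\,,w)$ has infinitely many zeroes in $\mathbb{C}$.
   Context: A weight on a domain $D\subset\mathbb{C}^N$ is a positive measurable function $\mu$ on $D$ (not required to be integrable; values on a null set, such as at the origin here, are immaterial). $L^2(D,\mu)$ is the Hilbert space of measurable functions on $D$ with inner product $\langle f,g\rangle_\mu=\int_D f(\zeta)\overline{g(\zeta)}\mu(\zeta)\,dA(\zeta)$, where $dA$ is Lebesgue measure, and $L^2_H(D,\mu)$ is the subspace of those functions in $L^2(D,\mu)$ that are holomorphic on $D$. A weight $\mu$ is admissible if for each $z\in D$ the evaluation functional $E_z:f\mapsto f(z)$ is continuous on $L^2_H(D,\mu)$, and $L^2_H(D,\mu)$ is a closed subspace of $L^2(D,\mu)$. For an admissible weight $\mu$ and $z\in D$, $B_z^{D,\mu}\in L^2_H(D,\mu)$ denotes the unique element (Riesz representation) with $f(z)=\langle f,B_z^{D,\mu}\rangle_\mu$ for all $f\in L^2_H(D,\mu)$; the weighted Bergman kernel is $K_{D,\mu}(z,\zeta)=B_z^{D,\mu}(\zeta)$ on $D\times D$. It satisfies $\overline{K_{D,\mu}(z,\zeta)}=K_{D,\mu}(\zeta,z)$.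 *)

(* Defs.v *)
From HB Require Import structures.
From mathcomp Require Import all_boot all_order all_algebra.
From mathcomp Require Import complex.
From mathcomp Require Import all_classical all_reals all_analysis.

Set Implicit Arguments.
Unset Strict Implicit.
Unset Printing Implicit Defensive.

Import Order.TTheory GRing.Theory Num.Theory.
Import numFieldNormedType.Exports.

Local Open Scope classical_set_scope.
Local Open Scope ring_scope.
Local Open Scope complex_scope.

(* The order on R[i] is partial and `|z| : R[i]; absC is the modulus in R. *)
Definition absC (R : realType) (z : R[i]) : R := complex.Re `|z|.

(* The plane R * R carries the product sigma-algebra and measure; R[i] is
   identified with it through planeC. *)
Definition planeC (R : realType) (p : R * R) : R[i] := p.1 +i* p.2.

Notation area R :=
  (@lebesgue_measure R \x @lebesgue_measure R)%E (only parsing).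

Definition measurableC (R : realType) (f : R[i] -> R[i]) : Prop :=
  measurable_fun [set: measurableTypeR R * measurableTypeR R]
    (fun p => complex.Re (f (planeC p))) /\
  measurable_fun [set: measurableTypeR R * measurableTypeR R]
    (fun p => complex.Im (f (planeC p))).

Definition integralC (R : realType) (f : R[i] -> R[i]) : R[i] :=
  (\int[area R]_p complex.Re (f (planeC p)))%R +i*
  (\int[area R]_p complex.Im (f (planeC p)))%R.

(* Complex differentiability everywhere: the increment in [derivable] ranges
   over the base field R[i]. *)
Definition entire (R : realType) (f : R[i] -> R[i]) : Prop :=
  forall z : R[i], derivable (f : R[i]^o -> R[i]^o) z 1.

(* Positivity is only required almost everywhere, values on null sets being
   immaterial. *)
Definition is_weight (R : realType) (mu : R[i] -> R) : Prop :=
  measurable_fun [set: measurableTypeR R * measurableTypeR R]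
    (fun p => mu (planeC p)) /\
  {ae area R, forall p, 0 < mu (planeC p)}.

Definition L2 (R : realType) (mu : R[i] -> R) : set (R[i] -> R[i]) :=
  [set f | measurableC f /\
    (\int[area R]_p (absC (f (planeC p)) ^+ 2 * mu (planeC p))%:E < +oo)%E].

Definition inner (R : realType) (mu : R[i] -> R) (f g : R[i] -> R[i]) : R[i] :=
  integralC (fun z => f z * (g z)^* * (mu z)%:C).

Definition L2norm (R : realType) (mu : R[i] -> R) (f : R[i] -> R[i]) : R :=
  Num.sqrt (complex.Re (inner mu f f)).

Definition L2H (R : realType) (mu : R[i] -> R) : set (R[i] -> R[i]) :=
  [set f | L2 mu f /\ entire f].

Definition eval_continuous (R : realType) (mu : R[i] -> R) (z : R[i]) : Prop :=
  forall f : R[i] -> R[i], L2H mu f ->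
  forall eps : R, 0 < eps -> exists2 delta : R, 0 < delta &
    forall g : R[i] -> R[i], L2H mu g ->
      L2norm mu (g \- f) < delta -> absC (g z - f z) < eps.

(* Elements of L2 are functions, not classes: membership of a limit in L2H is
   up to equality almost everywhere. *)
Definition L2H_closed (R : realType) (mu : R[i] -> R) : Prop :=
  forall f : R[i] -> R[i], L2 mu f ->
  (forall eps : R, 0 < eps ->
     exists2 g : R[i] -> R[i], L2H mu g & L2norm mu (f \- g) < eps) ->
  exists2 h : R[i] -> R[i], L2H mu h &
    {ae area R, forall p, f (planeC p) = h (planeC p)}.

Definition admissible (R : realType) (mu : R[i] -> R) : Prop :=
  [/\ is_weight mu, forall z : R[i], eval_continuous mu z & L2H_closed mu].

Definition represents (R : realType) (mu : R[i] -> R) (z : R[i])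
    (B : R[i] -> R[i]) : Prop :=
  L2H mu B /\ forall f : R[i] -> R[i], L2H mu f -> f z = inner mu f B.

(* When no representing function exists (never for an admissible mu) the value
   is the zero-free constant 1. *)
Definition bergman_kernel (R : realType) (mu : R[i] -> R) (z zeta : R[i]) :
    R[i] :=
  xget (fun=> 1) [set B | represents mu z B] zeta.

(* 0 `^ n = 0 for n != 0, which only affects the value at the origin. *)
Definition W (R : realType) (n alpha m : R) (z : R[i]) : R :=
  (2 * pi)^-1 * absC z `^ n * expR (- (alpha * absC z `^ (2 * m))).

(* Main.v *)
Require Import Defs.
From mathcomp Require Import all_boot all_order all_algebra.
From mathcomp Require Import separable cyclic cyclotomic complex.
From mathcomp Require Import all_classical all_reals all_analysis.
From mathcomp Require Import measurable_realfun.
From mathcomp Require Import ring lra.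

Set Implicit Arguments.
Unset Strict Implicit.
Unset Printing Implicit Defensive.

Import Order.TTheory GRing.Theory Num.Theory.
Import numFieldNormedType.Exports.

Local Open Scope classical_set_scope.
Local Open Scope ring_scope.
Local Open Scope complex_scope.

(* For a rotation invariant weight the monomials are orthogonal, so
   K(z, w) = F(z^* w) with F(u) = sum_k u^k / c_k, c_k being the squared norm of
   the k-th monomial.  A lower bound for c_k shows |F(u)| <= C exp(A |u|^m) and
   the upper bound c_k <= (K k)^(k/m) / D shows that F does not grow more slowly.
   If F had finitely many zeros then F = P exp(Q), and by Borel-Caratheodory Q
   would be a polynomial of degree at most m, hence at most some d < m because
   m is not an integer; Cauchy's estimates would then contradict the upper bound
   for c_k.
   The k-th coefficient of a holomorphic f in L^2 is <f, zeta^k> / c_k, so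
   <f, K(z, .)> is its Taylor series; for arbitrary f in L^2 the series still
   converges, to an entire function, which gives closedness. *)

(** The moments c_k are never evaluated: two-sided bounds suffice, and orthogonality comes from
    rotation invariance of the integral. Coefficients are extracted by finite averages over roots of
    unity, exact on partial sums, so contour integrals serve only to show that entire functions have
    a Taylor series. No complex logarithm is needed in F = P exp(Q), since Borel-Caratheodory asks
    only for Re Q. The obstacle in the Hilbert space part is domination. Partial sums of the kernel
    are bounded by C exp(A |z|^m), which is square integrable because the weight decays like
    exp(-alpha |z|^(2m)); so the kernel series can be integrated term by term against any f in L^2.
    For the Taylor sums of a general f no such majorant is at hand, so integrals are first cut off
    to a disc, where these sums converge uniformly. The final contradiction sets |a_k| <= k^(-k/d)
    against |a_k| >= k^(-k/m), up to factors exp(O(k)), for some d < m. *)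

Section Modulus.
Context {R : realType}.
Implicit Types z w : R[i].

Lemma absCE z : `|z| = (absC z)%:C.
Proof. by case: z. Qed.

Lemma absC_sqrt z : absC z = Num.sqrt (complex.Re z ^+ 2 + complex.Im z ^+ 2).
Proof. by case: z. Qed.

Lemma absC_ge0 z : 0 <= absC z.
Proof. by rewrite absC_sqrt sqrtr_ge0. Qed.

Lemma absC_sqr z : absC z ^+ 2 = complex.Re z ^+ 2 + complex.Im z ^+ 2.
Proof. by rewrite absC_sqrt sqr_sqrtr // addr_ge0 // sqr_ge0. Qed.

Lemma absCM z w : absC (z * w) = absC z * absC w.
Proof. by apply: complexI; rewrite -absCE normrM !absCE -rmorphM. Qed.

Lemma absC0 : absC (0 : R[i]) = 0.
Proof. by apply: complexI; rewrite -absCE normr0. Qed.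

Lemma absC1 : absC (1 : R[i]) = 1.
Proof. by apply: complexI; rewrite -absCE normr1. Qed.

Lemma absCX z k : absC (z ^+ k) = absC z ^+ k.
Proof. by apply: complexI; rewrite -absCE normrX absCE -rmorphXn. Qed.

Lemma absCV z : absC z^-1 = (absC z)^-1.
Proof. by apply: complexI; rewrite -absCE normfV absCE -fmorphV. Qed.

Lemma absCN z : absC (- z) = absC z.
Proof. by apply: complexI; rewrite -!absCE normrN. Qed.

Lemma absCB z w : absC (z - w) = absC (w - z).
Proof. by rewrite -absCN opprB. Qed.

Lemma absCD z w : absC (z + w) <= absC z + absC w.
Proof. by rewrite -lecR rmorphD /= -!absCE ler_normD. Qed.

Lemma absC_eq0 z : (absC z == 0) = (z == 0).
Proof. by rewrite -[LHS](inj_eq (@complexI R)) -absCE normr_eq0. Qed.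

Lemma absC_gt0 z : (0 < absC z) = (z != 0).
Proof. by rewrite lt_def absC_ge0 andbT absC_eq0. Qed.

Lemma absC_real (x : R) : absC x%:C = `|x|.
Proof. by rewrite absC_sqrt /= expr0n addr0 sqrtr_sqr. Qed.

Lemma absC_conj z : absC z^* = absC z.
Proof. by case: z => a b; rewrite !absC_sqrt /= sqrrN. Qed.

Lemma absC_Re z : `|complex.Re z| <= absC z.
Proof. by rewrite absC_sqrt -sqrtr_sqr ler_wsqrtr // lerDl sqr_ge0. Qed.

Lemma absC_Im z : `|complex.Im z| <= absC z.
Proof. by rewrite absC_sqrt -sqrtr_sqr ler_wsqrtr // lerDr sqr_ge0. Qed.

Lemma absC_le_ReIm z : absC z <= `|complex.Re z| + `|complex.Im z|.
Proof.
case: z => a b; have -> : a +i* b = a%:C + 'i * b%:C by simpc.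
apply: (le_trans (absCD _ _)).
by rewrite absCM !absC_real (_ : absC 'i = 1) ?mul1r /=; simpc => //;
  rewrite absC_sqrt /= expr0n add0r expr1n sqrtr1.
Qed.

Lemma absC_dist z w : absC z - absC w <= absC (z - w).
Proof. by rewrite lerBlDr; apply: le_trans (absCD _ _); rewrite subrK. Qed.

Lemma absC_sum (I : Type) (r : seq I) (P : pred I) (F : I -> R[i]) :
  absC (\sum_(i <- r | P i) F i) <= \sum_(i <- r | P i) absC (F i).
Proof.
elim/big_ind2: _ => [|x1 x2 y1 y2 h1 h2|//]; first by rewrite absC0.
by apply: le_trans (absCD _ _) _; exact: lerD.
Qed.

Lemma mulC_conj z : z * z^* = (absC z ^+ 2)%:C.
Proof. by rewrite -sqr_normc absCE -rmorphXn. Qed.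

Lemma complexP z w : complex.Re z = complex.Re w ->
  complex.Im z = complex.Im w -> z = w.
Proof. by case: z w => [a b] [c d] /= -> ->. Qed.

Lemma ReD z w : complex.Re (z + w) = complex.Re z + complex.Re w.
Proof. by case: z w => [a b] [c d]. Qed.
Lemma ImD z w : complex.Im (z + w) = complex.Im z + complex.Im w.
Proof. by case: z w => [a b] [c d]. Qed.
Lemma ReN z : complex.Re (- z) = - complex.Re z. Proof. by case: z. Qed.
Lemma ImN z : complex.Im (- z) = - complex.Im z. Proof. by case: z. Qed.
Lemma ReM z w : complex.Re (z * w) =
  complex.Re z * complex.Re w - complex.Im z * complex.Im w.
Proof. by case: z w => [a b] [c d]. Qed.
Lemma ImM z w : complex.Im (z * w) =
  complex.Re z * complex.Im w + complex.Im z * complex.Re w.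
Proof. by case: z w => [a b] [c d]. Qed.
Lemma ReZ (k : R) z : complex.Re (k%:C * z) = k * complex.Re z.
Proof. by rewrite ReM /= mul0r subr0. Qed.
Lemma ImZ (k : R) z : complex.Im (k%:C * z) = k * complex.Im z.
Proof. by rewrite ImM /= mul0r addr0. Qed.

Lemma Re_sum (I : Type) (r : seq I) (P : pred I) (F : I -> R[i]) :
  complex.Re (\sum_(i <- r | P i) F i) = \sum_(i <- r | P i) complex.Re (F i).
Proof. exact: (big_morph _ ReD). Qed.

End Modulus.

(** * Complex derivatives through real error estimates *)

Section CDiff.
Context {R : realType}.
Implicit Types (f g : R[i] -> R[i]) (z l : R[i]).

(** Written without a quotient, so that h = 0 needs no exclusion, and with real [eps] and [absC],
    because the norm of R[i] is itself R[i]-valued and its order only partial. *)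
Definition cdiff f z l := forall eps : R, 0 < eps -> exists2 delta : R,
  0 < delta & forall h, absC h < delta ->
    absC (f (z + h) - f z - l * h) <= eps * absC h.

(** A positive element of the partial order on R[i] has zero imaginary part, so the balls of R[i]
    are the discs of [absC]. *)
Lemma ltc_absC (h e : R[i]) : 0 < e -> (`|h| < e) = (absC h < complex.Re e).
Proof.
move=> e0; have /ger0_Im ie := ltW e0.
by rewrite absCE; case: e e0 ie => a b /= e0 ->; rewrite ltcR.
Qed.

Lemma derivable_cdiff f z : derivable (f : R[i]^o -> R[i]^o) z 1 ->
  exists l, cdiff f z l.
Proof.
move=> /cvg_ex[/= l] /cvgrPdist_le H.
exists l => eps e0.
have := H eps%:C; rewrite ltcR => /(_ e0).
move=> -[/= d d0 Hd].
exists (complex.Re d); first by move: d0; rewrite ltcE /= => /andP[].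
move=> h hd.
have [->|h0] := eqVneq h 0.
  by rewrite addr0 subrr mulr0 subrr absC0 mulr0.
have := Hd h; rewrite /ball_ /= sub0r normrN ltc_absC // => /(_ hd h0).
rewrite absCE lecR => Hh.
rewrite -absCN opprB.
have -> : l * h - (f (z + h) - f z) =
  (l - h^-1 *: (f (h *: (1 : R[i]^o) + z) - f z)) * h.
  rewrite mulrBl; congr (_ - _); rewrite -[_ *: (_ - _)]/(h^-1 * _).
  by rewrite -[h *: _]/(h * 1) mulr1 [h + z]addrC mulrC mulrA mulfV // mul1r.
by rewrite absCM ler_wpM2r ?absC_ge0.
Qed.

Lemma cdiff_derivable f z l : cdiff f z l ->
  derivable (f : R[i]^o -> R[i]^o) z 1.
Proof.
move=> H; apply/cvg_ex; exists (l : R[i]^o); apply/cvgrPdist_le => /= e e0.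
have er : e = (complex.Re e)%:C.
  by move: (ltW e0) => /ger0_Im; case: e e0 => a b _ /= ->.
have re0 : 0 < complex.Re e by move: e0; rewrite er ltcR.
have [d d0 Hd] := H _ re0.
exists d%:C; first by rewrite /= ltcR.
move=> h; rewrite /ball_ /= sub0r normrN ltc_absC ?ltcR //= => hd h0.
have -> : l - h^-1 *: (f (h *: (1 : R[i]^o) + z) - f z) =
  - ((f (z + h) - f z - l * h) / h).
  rewrite mulrBl mulfK // opprB; congr (_ - _).
  rewrite -[_ *: (_ - _)]/(h^-1 * _).
  by rewrite -[h *: _]/(h * 1) mulr1 [h + z]addrC mulrC.
rewrite normrN absCE absCM absCV er lecR ler_pdivrMr ?absC_gt0 //.
exact: Hd.
Qed.

Lemma entire_cdiff f : entire f -> forall z, exists l, cdiff f z l.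
Proof. by move=> H z; exact: derivable_cdiff. Qed.

Lemma cdiff_entire f (f' : R[i] -> R[i]) :
  (forall z, cdiff f z (f' z)) -> entire f.
Proof. by move=> H z; exact: cdiff_derivable (H z). Qed.

Lemma cdiff_cts f z l : cdiff f z l -> forall eps : R, 0 < eps ->
  exists2 delta : R, 0 < delta &
    forall h, absC h < delta -> absC (f (z + h) - f z) <= eps.
Proof.
move=> H eps e0; have [d d0 Hd] := H _ ltr01.
have L0 : 0 < absC l + 1 by rewrite ltr_pwDr // absC_ge0.
exists (Num.min d (eps / (absC l + 1))); first by rewrite lt_min d0 divr_gt0.
move=> h; rewrite lt_min => /andP[/Hd h1 h2].
have -> : f (z + h) - f z = (f (z + h) - f z - l * h) + l * h.
  by rewrite subrK.
apply: (le_trans (absCD _ _)); rewrite absCM mul1r in h1 *.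
apply: le_trans (lerD h1 (lexx _)) _.
rewrite -{1}[absC h]mul1r -mulrDl addrC mulrC -ler_pdivlMr //.
exact: ltW.
Qed.

Lemma cdiff_ext f g z l : f =1 g -> cdiff f z l -> cdiff g z l.
Proof. by move=> /funext ->. Qed.

Lemma cdiff_cst (c : R[i]) z : cdiff (fun=> c) z 0.
Proof.
move=> e e0; exists 1 => // h _.
by rewrite subrr mul0r subrr absC0 mulr_ge0 ?absC_ge0 // ltW.
Qed.

Lemma cdiff_id z : cdiff id z 1.
Proof.
move=> e e0; exists 1 => // h _.
by rewrite mul1r /= [z + h]addrC addrK subrr absC0 mulr_ge0 ?absC_ge0 // ltW.
Qed.

Lemma cdiffD f g z l l' : cdiff f z l -> cdiff g z l' ->
  cdiff (fun x => f x + g x) z (l + l').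
Proof.
move=> hf hg e e0.
have e2 : 0 < e / 2 by rewrite divr_gt0.
have [d d0 Hd] := hf _ e2; have [d' d'0 Hd'] := hg _ e2.
exists (Num.min d d'); first by rewrite lt_min d0.
move=> h; rewrite lt_min => /andP[/Hd h1 /Hd' h2].
have -> : f (z + h) + g (z + h) - (f z + g z) - (l + l') * h =
  (f (z + h) - f z - l * h) + (g (z + h) - g z - l' * h) by ring.
apply: (le_trans (absCD _ _)); apply: le_trans (lerD h1 h2) _.
by rewrite -mulrDl -splitr.
Qed.

Lemma cdiffM f g z l l' : cdiff f z l -> cdiff g z l' ->
  cdiff (fun x => f x * g x) z (l * g z + f z * l').
Proof.
move=> hf hg e e0.
(* [K] dominates |g| near z, |f z| and |l|, the factors of the three error terms below; each term
   then receives a third of the allowed error. *)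
set K := absC (g z) + 1 + absC (f z) + absC l.
have gK : absC (g z) + 1 <= K by rewrite /K -addrA lerDl addr_ge0 ?absC_ge0.
have fK : absC (f z) <= K.
  by rewrite /K [_ + absC (f z)]addrC -addrA lerDl !addr_ge0 ?absC_ge0.
have lK : absC l <= K by rewrite /K lerDr !addr_ge0 ?absC_ge0.
have K0 : 0 < K by apply: lt_le_trans gK; rewrite ltr_pwDr // absC_ge0.
have e3 : 0 < e / (3 * K) by rewrite divr_gt0 // mulr_gt0.
have [d1 d10 H1] := hf _ e3; have [d2 d20 H2] := hg _ e3.
have [d3 d30 H3] := cdiff_cts hg e3; have [d4 d40 H4] := cdiff_cts hg ltr01.
exists (Num.min (Num.min d1 d2) (Num.min d3 d4)).
  by rewrite !lt_min d10 d20 d30 d40.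
move=> h; rewrite !lt_min => /andP[/andP[/H1 h1 /H2 h2] /andP[/H3 h3 /H4 h4]].
have -> : f (z + h) * g (z + h) - f z * g z - (l * g z + f z * l') * h =
  g (z + h) * (f (z + h) - f z - l * h) + f z * (g (z + h) - g z - l' * h) +
  l * h * (g (z + h) - g z) by ring.
have gz : absC (g (z + h)) <= K.
  apply: le_trans gK; rewrite -lerBlDl; apply: le_trans h4.
  exact: absC_dist.
apply: (le_trans (absCD _ _)); apply: (le_trans (lerD (absCD _ _) (lexx _))).
rewrite !absCM.
have -> : e * absC h = K * (e / (3 * K) * absC h) +
   K * (e / (3 * K) * absC h) + K * absC h * (e / (3 * K)).
  by field; rewrite gt_eqF.
by rewrite !lerD // ler_pM ?mulr_ge0 ?absC_ge0 // ler_wpM2r ?absC_ge0.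
Qed.

Lemma cdiffV g z l : g z != 0 -> cdiff g z l ->
  cdiff (fun x => (g x)^-1) z (- l / g z ^+ 2).
Proof.
move=> g0 hg e e0; set m := absC (g z).
have m0 : 0 < m by rewrite absC_gt0.
set K := absC l + 1.
have K0 : 0 < K by rewrite ltr_pwDr // absC_ge0.
have m2 : 0 < m / 2 by rewrite divr_gt0.
have [d3 d30 H3] := cdiff_cts hg m2.
(* The remainder has denominator g(z) g(z + h), of modulus at least m^2 / 2; each of the two terms
   of its numerator is allowed half of e |h| m^2 / 2. *)
have e1 : 0 < e * m ^+ 2 / 4 by rewrite divr_gt0 // mulr_gt0 // exprn_gt0.
have [d1 d10 H1] := hg _ e1.
have e2 : 0 < e * m ^+ 3 / (4 * K).
  by rewrite divr_gt0 ?mulr_gt0 // exprn_gt0.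
have [d2 d20 H2] := cdiff_cts hg e2.
exists (Num.min d1 (Num.min d2 d3)); first by rewrite !lt_min d10 d20 d30.
move=> h; rewrite !lt_min => /andP[/H1 h1 /andP[/H2 h2 /H3 h3]].
have gm : m / 2 <= absC (g (z + h)).
  move: h3; rewrite absCB => h3.
  by move: (le_trans (absC_dist _ _) h3); rewrite -/m; lra.
have gh0 : g (z + h) != 0 by rewrite -absC_gt0 (lt_le_trans m2).
have -> : (g (z + h))^-1 - (g z)^-1 - - l / g z ^+ 2 * h =
  (- (g (z + h) - g z - l * h) + l * h * (g (z + h) - g z) / g z)
   / (g z * g (z + h)) .
  by field; rewrite g0 gh0.
rewrite absCM absCV absCM ler_pdivrMr; last first.
  by rewrite mulr_gt0 ?absC_gt0.
apply: (le_trans (absCD _ _)); rewrite absCN !absCM absCV -/m.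
apply: (@le_trans _ _ (e * absC h * (m * (m / 2)))); last first.
  by rewrite ler_wpM2l ?mulr_ge0 ?absC_ge0 ?(ltW e0) // ler_pM2l.
have -> : e * absC h * (m * (m / 2)) = e * m ^+ 2 / 4 * absC h +
   K * absC h * (e * m ^+ 3 / (4 * K)) / m by field; rewrite !gt_eqF.
apply: lerD => //; rewrite ler_wpM2r ?invr_ge0 ?(ltW m0) //.
rewrite ler_pM ?mulr_ge0 ?absC_ge0 // ler_wpM2r ?absC_ge0 //.
by rewrite /K lerDl.
Qed.

Lemma cdiff_shift f (c : R[i]) z l : cdiff f (z + c) l ->
  cdiff (fun x => f (x + c)) z l.
Proof.
by move=> H e /H[d d0 Hd]; exists d => // h /Hd; rewrite /= [z + h + c]addrAC.
Qed.

End CDiff.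

(** * Entire power series *)

Section PowerSeries.
Context {R : realType}.
Implicit Types (a b : nat -> R[i]) (z : R[i]) (rho M : R).

Definition psum a N z : R[i] := \sum_(k < N) a k * z ^+ k.

(* The power series with coefficients [a] has infinite radius of convergence. *)
Definition ESeq a := forall rho, 0 <= rho -> exists M, forall k,
  absC (a k) * rho ^+ k <= M.

(** Real and imaginary limits are taken separately, so the value is defined for every sequence;
    under [ESeq] it is the sum of the series. *)
Definition PS a z : R[i] :=
  limn (fun N => complex.Re (psum a N z)) +i*
  limn (fun N => complex.Im (psum a N z)).

Lemma psumS a N z : psum a N.+1 z = psum a N z + a N * z ^+ N.
Proof. by rewrite /psum big_ord_recr. Qed.

(** A coefficient bound at radius 2 rho makes the k-th term at most M / 2^k. The right side is the
    exact geometric sum, in a telescoping form that the induction on [p] can carry. *)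
Lemma psum_dist a rho M z N p : absC z <= rho ->
  (forall k, absC (a k) * (2 * rho) ^+ k <= M) ->
  absC (psum a (N + p) z - psum a N z) <= 2 * M / 2 ^+ N - M * 2 / 2 ^+ (N + p).
Proof.
move=> zr HM; elim: p => [|p IH].
  by rewrite addn0 subrr absC0 [M * 2]mulrC subrr.
rewrite addnS psumS addrAC.
apply: (le_trans (absCD _ _)); apply: (le_trans (lerD IH (lexx _))).
have h : absC (a (N + p)%N * z ^+ (N + p)) <= M / 2 ^+ (N + p).
  rewrite ler_pdivlMr ?exprn_gt0 //; apply: le_trans (HM (N + p)%N).
  rewrite absCM absCX -mulrA ler_wpM2l ?absC_ge0 // exprMn mulrC.
  by rewrite ler_wpM2l ?exprn_ge0 // lerXn2r ?nnegrE ?absC_ge0 // (le_trans _ zr) ?absC_ge0.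
apply: (le_trans (lerD (lexx _) h)).
rewrite exprS invfM.
set u := (2 ^+ (N + p))^-1.
by rewrite le_eqVlt; apply/orP; left; apply/eqP; field.
Qed.

Lemma cvg_half_pow M : 2 * M / 2 ^+ n @[n --> \oo] --> (0 : R).
Proof.
have : (fun n => (2^-1 : R) ^+ n) @ \oo --> (0 : R).
  by apply: cvg_expr; rewrite ger0_norm // invf_lt1 // ltr1n.
move=> h; rewrite -(mulr0 (2 * M)).
under eq_fun => n do rewrite -exprVn.
by apply: cvgM => //; exact: cvg_cst.
Qed.

Lemma half_pow_small M e : 0 < e -> exists N, forall n, (N <= n)%N ->
  2 * M / 2 ^+ n <= e.
Proof.
move=> e0; have /cvgrPdist_le /(_ _ e0) [N _ HN] := cvg_half_pow M.
exists N => n /HN /=; rewrite sub0r normrN => /ler_normlW //.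
Qed.

Lemma cauchy_lim (u : nat -> R) (M : R) :
  (forall N p, `|u (N + p)%N - u N| <= 2 * M / 2 ^+ N) ->
  forall N, `|limn u - u N| <= 2 * M / 2 ^+ N.
Proof.
move=> H.
have cu : cvgn u.
  apply: cauchy_cvg; apply: cauchy_exP => e e0.
  have [|N HN] := @half_pow_small M (e / 2); first by rewrite divr_gt0.
  exists (u N); exists N => // n /= Nn; rewrite /ball /= distrC -(subnKC Nn).
  apply: (le_lt_trans (H _ _)); apply: (le_lt_trans (HN _ (leqnn _))).
  by rewrite ltr_pdivrMr // ltr_pMr // ltr1n.
move=> N; apply/ler_addgt0Pl => e e0.
have /cvgrPdist_le /(_ _ e0) [p _ Hp] := cu.
have {}Hp := Hp (N + p)%N (leq_addl _ _).
rewrite -[limn u - u N](subrKA (u (N + p)%N)).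
by apply: (le_trans (ler_normD _ _)); exact: lerD.
Qed.

Lemma ESeq_bound a rho : ESeq a -> 0 <= rho -> exists2 M, 0 <= M &
  forall k, absC (a k) * rho ^+ k <= M.
Proof.
move=> ha r0; have [M HM] := ha _ r0; exists M => //.
by apply: le_trans (HM 0%N); rewrite mulr_ge0 ?absC_ge0 // exprn_ge0.
Qed.

Lemma psum_tail a rho M z N p : absC z <= rho ->
  (forall k, absC (a k) * (2 * rho) ^+ k <= M) ->
  absC (psum a (N + p) z - psum a N z) <= 2 * M / 2 ^+ N.
Proof.
move=> zr HM; apply: (le_trans (psum_dist N p zr HM)).
rewrite gerBl mulr_ge0 // ?invr_ge0 ?exprn_ge0 // mulr_ge0 //.
apply: le_trans (HM 0%N); by rewrite mulr_ge0 ?absC_ge0.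
Qed.

(** The constant 4, against 2 for partial sums, pays for treating real and imaginary parts
    separately. *)
Lemma PS_tail a rho M z N : absC z <= rho ->
  (forall k, absC (a k) * (2 * rho) ^+ k <= M) ->
  absC (PS a z - psum a N z) <= 4 * M / 2 ^+ N.
Proof.
move=> zr HM; apply: (le_trans (absC_le_ReIm _)).
have -> : 4 * M / 2 ^+ N = 2 * M / 2 ^+ N + 2 * M / 2 ^+ N by ring.
rewrite ReD ImD ReN ImN; apply: lerD.
  apply: (@cauchy_lim (fun n => complex.Re (psum a n z))) => {}N p.
  apply: le_trans (psum_tail N p zr HM).
  by rewrite -ReN -ReD absC_Re.
apply: (@cauchy_lim (fun n => complex.Im (psum a n z))) => {}N p.
apply: le_trans (psum_tail N p zr HM).
by rewrite -ImN -ImD absC_Im.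
Qed.

Lemma PS_uniq a z l : ESeq a ->
  (forall e, 0 < e -> exists N, forall n, (N <= n)%N ->
     absC (l - psum a n z) <= e) -> PS a z = l.
Proof.
move=> ha H; apply/eqP; rewrite -subr_eq0 -absC_eq0 eq_le absC_ge0 andbT.
apply/ler_addgt0Pl => e e0; rewrite addr0.
have e2 : 0 < e / 2 by rewrite divr_gt0.
have [N HN] := H _ e2.
have [M HM] : exists M, forall k, absC (a k) * (2 * absC z) ^+ k <= M.
  by apply: ha; rewrite mulr_ge0 // absC_ge0.
have [N' HN'] := half_pow_small (2 * M) e2.
have h1 := HN (maxn N N') (leq_maxl _ _).
have h2 := HN' (maxn N N') (leq_maxr _ _).
have h3 := PS_tail (maxn N N') (lexx _) HM.
rewrite -[PS a z - l](subrKA (psum a (maxn N N') z)).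
apply: (le_trans (absCD _ _)); rewrite [e]splitr; apply: lerD.
  by apply: (le_trans h3); apply: le_trans h2; rewrite mulrA -natrM.
by rewrite absCB.
Qed.

Lemma PS_cvg a z : ESeq a -> forall e, 0 < e ->
  exists N, forall n, (N <= n)%N -> absC (PS a z - psum a n z) <= e.
Proof.
move=> ha e e0.
have [M HM] : exists M, forall k, absC (a k) * (2 * absC z) ^+ k <= M.
  by apply: ha; rewrite mulr_ge0 // absC_ge0.
have [N HN] := half_pow_small (2 * M) e0.
exists N => n /HN h; apply: (le_trans (PS_tail _ (lexx _) HM)).
by apply: le_trans h; rewrite mulrA -natrM.
Qed.

Lemma PS0 a : ESeq a -> PS a 0 = a 0%N.
Proof.
move=> ha; apply: PS_uniq => // e e0; exists 1%N => -[//|n _].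
rewrite /psum big_ord_recl expr0 mulr1 big1 ?addr0 ?subrr ?absC0 ?ltW //.
by move=> i _; rewrite /= exprS mul0r mulr0.
Qed.

Lemma PS_bound a rho M z : absC z <= rho ->
  (forall k, absC (a k) * (2 * rho) ^+ k <= M) -> absC (PS a z) <= 4 * M.
Proof.
move=> zr HM; have := PS_tail 0 zr HM.
by rewrite /psum big_ord0 subr0 expr0 divr1.
Qed.

Lemma ESeq_shift a k : ESeq a -> ESeq (fun j => a (k + j)%N).
Proof.
move=> ha rho r0; have [M M0 HM] := ESeq_bound ha (addr_ge0 ler01 r0).
exists M => j; apply: le_trans (HM (k + j)%N).
rewrite ler_wpM2l ?absC_ge0 //.
apply: (@le_trans _ _ ((1 + rho) ^+ j)).
  by rewrite lerXn2r ?nnegrE ?addr_ge0 // lerDr.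
by rewrite ler_weXn2l ?lerDl // leq_addl.
Qed.

Lemma PS_shift a k z : ESeq a ->
  PS a z = psum a k z + z ^+ k * PS (fun j => a (k + j)%N) z.
Proof.
move=> ha; apply: PS_uniq => // e e0.
have zk : 0 < absC z ^+ k + 1 by rewrite ltr_pwDr // exprn_ge0 // absC_ge0.
have e1 : 0 < e / (absC z ^+ k + 1) by rewrite divr_gt0.
have [N HN] := PS_cvg z (ESeq_shift k ha) e1.
exists (k + N)%N => n kn.
have kn' := leq_trans (leq_addr _ _) kn.
rewrite -(subnKC kn') in kn *; rewrite leq_add2l in kn.
have -> : psum a (k + (n - k))%N z =
    psum a k z + z ^+ k * psum (fun j => a (k + j)%N) (n - k) z.
  rewrite /psum big_split_ord /=; congr (_ + _); rewrite mulr_sumr.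
  by apply: eq_bigr => i _; rewrite exprD mulrCA.
rewrite opprD addrACA subrr add0r -mulrBr absCM absCX.
have h := HN _ kn.
apply: (@le_trans _ _ ((absC z ^+ k + 1) * (e / (absC z ^+ k + 1)))).
  by rewrite ler_pM ?absC_ge0 ?exprn_ge0 ?absC_ge0 // lerDl.
by rewrite mulrCA mulfV ?mulr1 // gt_eqF.
Qed.

Definition dseq a : nat -> R[i] := fun k => k.+1%:R * a k.+1.

Lemma natr_le_pow2 k : (k%:R : R) <= 2 ^+ k.
Proof. by rewrite -natrX ler_nat ltnW // ltn_expl. Qed.

Lemma absC_nat k : absC (k%:R : R[i]) = k%:R.
Proof. by rewrite -(rmorph_nat (real_complex R)) absC_real ger0_norm. Qed.

Lemma ESeq_dseq a : ESeq a -> ESeq (dseq a).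
Proof.
move=> ha rho r0.
have [|M M0 HM] := @ESeq_bound _ (2 * (1 + rho)) ha.
  by rewrite mulr_ge0 // addr_ge0.
exists M => j; apply: le_trans (HM j.+1); rewrite /dseq absCM absC_nat.
rewrite exprMn [_ * absC _]mulrC -mulrA ler_wpM2l ?absC_ge0 //.
rewrite ler_pM ?exprn_ge0 ?natr_le_pow2 // exprS.
rewrite -[leLHS]mul1r ler_pM ?exprn_ge0 // ?lerDl //.
by rewrite lerXn2r ?nnegrE ?addr_ge0 // lerDr.
Qed.

(** Passing from one exponent to the next multiplies the remainder by z + h and adds a term in h^2.
    The resulting growth k^2 (rho + 1)^k is harmless against coefficients that decay faster than any
    geometric sequence. *)
Lemma expr_taylor2 z h rho k : absC z <= rho -> absC h <= 1 ->
  absC ((z + h) ^+ k.+1 - z ^+ k.+1 - k.+1%:R * z ^+ k * h) <=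
    absC h ^+ 2 * (k.+1%:R ^+ 2 * (rho + 1) ^+ k.+1).
Proof.
move=> zr h1; have r0 : 0 <= rho := le_trans (absC_ge0 z) zr.
have s1 : 1 <= rho + 1 by rewrite lerDr.
elim: k => [|k IH].
  have -> : (z + h) ^+ 1 - z ^+ 1 - 1%:R * z ^+ 0 * h = 0 by ring.
  by rewrite absC0 !mulr_ge0 ?exprn_ge0 ?absC_ge0 // addr_ge0.
have -> : (z + h) ^+ k.+2 - z ^+ k.+2 - k.+2%:R * z ^+ k.+1 * h =
  (z + h) * ((z + h) ^+ k.+1 - z ^+ k.+1 - k.+1%:R * z ^+ k * h) +
  k.+1%:R * z ^+ k * h ^+ 2.
  by rewrite (exprS _ k.+1) (exprS z k.+1) (exprS z k) -(natr1 k.+1); ring.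
apply: (le_trans (absCD _ _)); rewrite !absCM !absCX absC_nat.
have zk : absC z ^+ k <= (rho + 1) ^+ k.+2.
  apply: (@le_trans _ _ ((rho + 1) ^+ k)).
    by rewrite lerXn2r ?nnegrE ?absC_ge0 ?addr_ge0 // (le_trans zr) // lerDl.
  by rewrite ler_weXn2l // leqW // leqW.
apply: (@le_trans _ _ ((rho + 1) * (absC h ^+ 2 *
    (k.+1%:R ^+ 2 * (rho + 1) ^+ k.+1)) +
    k.+1%:R * (rho + 1) ^+ k.+2 * absC h ^+ 2)).
  apply: lerD; last first.
    by apply: ler_wpM2r; [rewrite mulr_ge0 ?absC_ge0|apply: ler_wpM2l].
  by rewrite ler_pM ?absC_ge0 // (le_trans (absCD _ _)) // lerD.
rewrite [X in X + _](_ : _ =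
  absC h ^+ 2 * (k.+1%:R ^+ 2 * (rho + 1) ^+ k.+2)); last first.
  by rewrite (exprS _ k.+1); ring.
rewrite [k.+1%:R * _ * _]mulrC -mulrDr ler_wpM2l ?exprn_ge0 ?absC_ge0 //.
rewrite -mulrDl ler_wpM2r ?exprn_ge0 ?addr_ge0 //.
rewrite -(natr1 k.+1); set x : R := k.+1%:R.
have : 0 <= x by [].
by nra.
Qed.

Lemma PS_cdiff a z : ESeq a -> cdiff (PS a) z (PS (dseq a) z).
Proof.
move=> ha e e0; set rho := absC z + 1.
have r1 : 1 <= rho by rewrite lerDr absC_ge0.
(* 8 is a product of three factors 2: two of them absorb the square of k from [expr_taylor2], the
   third leaves the summable series of 2^(-k). *)
have [|M M0 HM] := @ESeq_bound _ (8 * (rho + 1)) ha.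
  by rewrite mulr_ge0 // addr_ge0 // ltW // (lt_le_trans ltr01).
have M1 : 0 < M + 1 by rewrite ltr_pwDr.
exists (Num.min 1 (e / (M + 1))); first by rewrite lt_min ltr01 divr_gt0.
move=> h; rewrite lt_min => /andP[/ltW h1 he].
apply: (@le_trans _ _ (absC h ^+ 2 * (M + 1))); last first.
  rewrite expr2 -mulrA mulrC ler_wpM2r ?absC_ge0 // -ler_pdivlMr //.
  exact: ltW.
have finite N : absC (psum a N.+1 (z + h) - psum a N.+1 z -
    psum (dseq a) N z * h) <= absC h ^+ 2 * M.
  have -> : psum a N.+1 (z + h) - psum a N.+1 z - psum (dseq a) N z * h =
    \sum_(k < N) a k.+1 *
      ((z + h) ^+ k.+1 - z ^+ k.+1 - k.+1%:R * z ^+ k * h).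
    rewrite /psum !big_ord_recl /= !expr0 opprD addrACA subrr add0r.
    rewrite mulr_suml -!sumrB; apply: eq_bigr => k _.
    by rewrite /dseq /= /bump /= !add1n; ring.
  apply: (le_trans (absC_sum _ _ _)).
  apply: (@le_trans _ _ (\sum_(k < N) absC h ^+ 2 * (M / 2 ^+ k.+1))).
    apply: ler_sum => k _; rewrite absCM.
    have zr : absC z <= rho by rewrite lerDl.
    apply: (le_trans (ler_wpM2l (absC_ge0 _) (expr_taylor2 k zr h1))).
    rewrite mulrCA ler_wpM2l ?exprn_ge0 ?absC_ge0 //.
    rewrite ler_pdivlMr ?exprn_gt0 // -mulrA; apply: le_trans (HM k.+1).
    rewrite ler_wpM2l ?absC_ge0 // mulrAC exprMn ler_wpM2r //.
      by rewrite exprn_ge0 // addr_ge0 // (le_trans _ r1).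
    have -> : (8 : R) = 2 * 2 * 2 by ring.
    by rewrite !exprMn ler_wpM2r ?exprn_ge0 // expr2 ler_pM // natr_le_pow2.
  rewrite -mulr_sumr ler_wpM2l ?exprn_ge0 ?absC_ge0 //.
  rewrite -mulr_sumr ler_piMr //.
  suff -> : \sum_(i < N) (2 ^+ i.+1)^-1 = 1 - (2 ^+ N)^-1 :> R.
    by rewrite gerBl invr_ge0 exprn_ge0.
  elim: N => [|N IH]; first by rewrite big_ord0 expr0 invr1 subrr.
  by rewrite big_ord_recr /= IH exprS invfM; field; rewrite expf_neq0.
(* The quadratic bound on partial sums is uniform in [N], so replacing the three partial sums by
   their limits costs only an arbitrary [d]. *)
suff H : forall d, 0 < d -> absC (PS a (z + h) - PS a z - PS (dseq a) z * h) <=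
    absC h ^+ 2 * M + d.
  apply: (@le_trans _ _ (absC h ^+ 2 * M)); first exact/ler_addgt0Pr.
  by rewrite ler_wpM2l ?exprn_ge0 ?absC_ge0 // lerDl.
move=> d d0; have d3 : 0 < d / 3 by rewrite divr_gt0.
have [N1 H1] := PS_cvg (z + h) ha d3.
have [N2 H2] := PS_cvg z ha d3.
have [N3 H3] := PS_cvg z (ESeq_dseq ha) d3.
pose N := maxn N1 (maxn N2 N3).
have N1N : (N1 <= N.+1)%N by rewrite ltnW // ltnS leq_maxl.
have N2N : (N2 <= N.+1)%N by rewrite ltnW // ltnS leq_max leq_maxl orbT.
have N3N : (N3 <= N)%N by rewrite leq_max leq_maxr orbT.
move: (H1 _ N1N) (H2 _ N2N) (H3 _ N3N) (finite N) => {}H1 {}H2 {}H3 HN.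
have split3 (u v w p q r : R[i]) : u - v - w * h =
  (p - q - r * h) + ((u - p) - (v - q) - (w - r) * h) by ring.
rewrite (split3 _ _ _ (psum a N.+1 (z + h)) (psum a N.+1 z) (psum (dseq a) N z)).
apply: (le_trans (absCD _ _)); apply: lerD; first exact: HN.
apply: (le_trans (absCD _ _)); rewrite absCN absCM.
have -> : d = d / 3 + d / 3 + d / 3 * 1 by field.
apply: lerD; last by apply: ler_pM; rewrite ?absC_ge0.
apply: (le_trans (absCD _ _)); rewrite absCN.
by apply: lerD; [exact: H1|exact: H2].
Qed.

Lemma PS_entire a : ESeq a -> entire (PS a).
Proof. by move=> ha; apply: cdiff_entire => z; exact: PS_cdiff. Qed.

End PowerSeries.

(** * Coefficient estimates by averages over roots of unity *)

Section RootsOfUnity.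
Context {R : realType}.
Implicit Types (a b : nat -> R[i]) (z w : R[i]) (rho B : R).

(** X^N - 1 splits over the algebraically closed field R[i] and is separable, hence has N distinct
    roots, and a full set of N-th roots of unity contains a primitive one. *)
Lemma primitive_root_exists N : (0 < N)%N -> exists w : R[i], N.-primitive_root w.
Proof.
move=> N0; pose p : {poly R[i]} := 'X^N - 1.
have [r Dp] := closed_field_poly_normal p.
rewrite (monicP _) ?monicXnsubC // scale1r in Dp.
have rn1 : all N.-unity_root r by apply/allP=> z; rewrite -root_prod_XsubC -Dp.
have sz_r : (N < (size r).+1)%N.
  by rewrite -(size_prod_XsubC r id) -Dp size_XnsubC.
have [|z] := hasP (has_prim_root N0 rn1 _ sz_r); last by exists z.
by rewrite -separable_prod_XsubC -Dp separable_Xn_sub_1 // pnatr_eq0 -lt0n.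
Qed.

Lemma absC_unity_root N w : (0 < N)%N -> w ^+ N = 1 -> absC w = 1.
Proof.
move=> N0 wN; apply/eqP.
by rewrite -(pexpr_eq1 N0 (absC_ge0 w)) -absCX wN absC1.
Qed.

Lemma sum_unity_root N w : w ^+ N = 1 -> w != 1 -> \sum_(j < N) w ^+ j = 0.
Proof.
move=> wN w1; apply/eqP; have := subrX1 w N; rewrite wN subrr => /esym/eqP.
by rewrite mulf_eq0 subr_eq0 (negPf w1).
Qed.

Lemma sum_psum a N M rho w x : x ^+ M = 1 ->
  \sum_(j < M) psum a N (rho%:C * w ^+ j) * x ^+ j =
  \sum_(l < N) a l * rho%:C ^+ l * \sum_(j < M) (w ^+ l * x) ^+ j.
Proof.
move=> xM; under eq_bigr do rewrite /psum mulr_suml.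
rewrite exchange_big /=; apply: eq_bigr => l _; rewrite mulr_sumr.
by apply: eq_bigr => j _; rewrite !exprMn -!exprM [(l * j)%N]mulnC; ring.
Qed.

Section Primitive.
Variables (M : nat) (w : R[i]).
Hypothesis pw : M.-primitive_root w.

Let wM : w ^+ M = 1 := prim_expr_order pw.
Let M0 : (0 < M)%N := prim_order_gt0 pw.

Lemma prim_absC j : absC (w ^+ j) = 1.
Proof. by rewrite absCX (absC_unity_root M0 wM) expr1n. Qed.

Lemma prim_neq0 : w != 0.
Proof. by rewrite -absC_gt0 (absC_unity_root M0 wM). Qed.

(** Discrete Fourier inversion: for l, k < M the root of unity w^(l - k) differs from 1 unless l =
    k, so a sum of at most M terms suffers no aliasing. *)
Lemma coef_sum a N rho k : (k < N <= M)%N ->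
  \sum_(j < M) psum a N (rho%:C * w ^+ j) * (w ^- k) ^+ j =
  M%:R * (a k * rho%:C ^+ k).
Proof.
case/andP=> kN NM; rewrite sum_psum; last first.
  by rewrite -exprVn exprAC exprVn wM invr1 expr1n.
rewrite (bigD1 (Ordinal kN)) //= divff ?expf_neq0 ?prim_neq0 //.
under eq_bigr do rewrite expr1n.
rewrite sumr_const card_ord mulrC [X in _ + X]big1 ?addr0 // => l lk.
rewrite sum_unity_root ?mulr0 //.
  by rewrite exprMn -exprVn exprAC wM expr1n exprAC exprVn wM invr1 expr1n mulr1.
rewrite -subr_eq0 -(inj_eq (mulIf (expf_neq0 k prim_neq0))) mul0r.
rewrite mulrBl mul1r divfK ?expf_neq0 ?prim_neq0 // subr_eq0.
rewrite (eq_prim_root_expr pw) !modn_small //; first exact: leq_trans NM.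
exact: leq_trans NM.
Qed.

(** All exponents l + k that occur lie strictly between 0 and M. This vanishing of the opposite
    harmonic is what lets the real part of the sum determine its coefficients. *)
Lemma coef_sum0 a N rho k : (0 < k)%N -> (N + k <= M)%N ->
  \sum_(j < M) psum a N (rho%:C * w ^+ j) * (w ^+ k) ^+ j = 0.
Proof.
move=> k0 NM; rewrite sum_psum; last by rewrite exprAC wM expr1n.
rewrite big1 // => l _; rewrite sum_unity_root ?mulr0 //.
  by rewrite -exprD exprAC wM expr1n.
rewrite -exprD -(prim_order_dvd pw) gtnNdvd //; first by rewrite addn_gt0 k0 orbT.
by apply: leq_trans NM; rewrite ltn_add2r.
Qed.

End Primitive.

Lemma psum_cauchy a N rho B k : 0 <= rho -> (k < N)%N ->
  (forall z, absC z = rho -> absC (psum a N z) <= B) ->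
  absC (a k) * rho ^+ k <= B.
Proof.
move=> r0 kN H; have N0 : (0 < N)%N := leq_ltn_trans (leq0n k) kN.
have [w pw] := primitive_root_exists N0.
have NR : 0 < N%:R :> R by rewrite ltr0n.
rewrite -(ler_pM2l NR) -[rho in leLHS](ger0_norm r0) -absC_real -absCX.
have S1 : (k < N <= N)%N by rewrite kN leqnn.
rewrite -absCM -[X in X * absC _]absC_nat -absCM -(coef_sum pw a rho S1).
apply: (le_trans (absC_sum _ _ _)).
have -> : N%:R * B = \sum_(j < N) B by rewrite sumr_const card_ord mulr_natl.
apply: ler_sum => j _; rewrite absCM absCX absCV (prim_absC pw) invr1 expr1n.
by rewrite mulr1 H // absCM (prim_absC pw) mulr1 absC_real ger0_norm.
Qed.

(* Borel-Caratheodory: the k-th coefficient is, up to a factor 2, the average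
   of (Re p - B) w^(-jk), because the average of p w^(jk) vanishes. *)
Lemma psum_borel_caratheodory a N rho B k : 0 <= rho -> (0 < k < N)%N ->
  (forall z, absC z = rho -> complex.Re (psum a N z) <= B) ->
  absC (a k) * rho ^+ k <= 2 * (B - complex.Re (a 0%N)).
Proof.
move=> r0 /andP[k0 kN] H.
have M0 : (0 < N + k)%N by rewrite addn_gt0 k0 orbT.
have [w pw] := primitive_root_exists M0; set M := (N + k)%N in pw M0.
have NM : (N <= M)%N := leq_addr _ _.
have kNM : (k < N <= M)%N by rewrite kN NM.
have S1 := coef_sum pw a rho kNM.
have S2 := coef_sum0 pw a rho k0 (leqnn _).
have zNM : (0 < N <= M)%N by rewrite NM (leq_ltn_trans _ kN).
have S0 := coef_sum pw a rho zNM.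
have MR : 0 < M%:R :> R by rewrite ltr0n.
pose u j := complex.Re (psum a N (rho%:C * w ^+ j)).
have wV : w^* = w^-1.
  apply: (mulfI (prim_neq0 pw)); rewrite mulC_conj divff ?(prim_neq0 pw) //.
  by rewrite -[w]expr1 (prim_absC pw) expr1n.
(* Re p = (p + conj p) / 2: the sum with conj p is the conjugate of [S2], and the constant [B]
   averages to zero because w^k != 1; what remains is minus half of the coefficient sum [S1]. *)
have S3 : \sum_(j < M) (B - u j)%:C * (w ^- k) ^+ j =
    - (M%:R * (a k * rho%:C ^+ k)) / 2.
  have SB : \sum_(j < M) (w ^- k) ^+ j = 0.
    rewrite sum_unity_root //.
      by rewrite -exprVn exprAC exprVn (prim_expr_order pw) invr1 expr1n.
    rewrite -invr_eq1 invrK -(prim_order_dvd pw) gtnNdvd //.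
    exact: leq_trans kN NM.
  have S2' : \sum_(j < M) (psum a N (rho%:C * w ^+ j))^* * (w ^- k) ^+ j = 0.
    transitivity ((0 : R[i])^*); last by rewrite conjc0.
    rewrite -[in RHS]S2 rmorph_sum; apply: eq_bigr => j _.
    by rewrite rmorphM !rmorphXn /= wV [w^-1 ^+ k]exprVn.
  transitivity (B%:C * (\sum_(j < M) (w ^- k) ^+ j) - 2^-1 *
    (\sum_(j < M) psum a N (rho%:C * w ^+ j) * (w ^- k) ^+ j +
     \sum_(j < M) (psum a N (rho%:C * w ^+ j))^* * (w ^- k) ^+ j)); last first.
    by rewrite SB S1 S2'; field.
  rewrite -big_split /= !mulr_sumr -sumrB.
  apply: eq_bigr => j _; rewrite -mulrDl addcJ -/(u j) rmorphB /=.
  by field.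
(* B - u j is nonnegative on the circle, so the moduli of the summands add up to the plain sum,
   which [S0] then evaluates through the constant coefficient. *)
have : M%:R * (absC (a k) * rho ^+ k) / 2 <= \sum_(j < M) (B - u j).
  rewrite -[rho in leLHS](ger0_norm r0) -absC_real -absCX -absCM.
  rewrite -[X in X * absC _ / _]absC_nat.
  have h2 : (2 : R)^-1 = absC (2^-1 : R[i]) by rewrite absCV absC_nat.
  rewrite -absCM h2 -absCM -absCN -mulNr -S3.
  apply: (le_trans (absC_sum _ _ _)); apply: ler_sum => j _.
  rewrite absCM absCX absCV (prim_absC pw) invr1 expr1n mulr1 absC_real.
  rewrite ger0_norm // subr_ge0 H // absCM (prim_absC pw) mulr1 absC_real.
  by rewrite ger0_norm.
have -> : \sum_(j < M) (B - u j) = M%:R * (B - complex.Re (a 0%N)).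
  rewrite sumrB sumr_const card_ord -[B *+ M]mulr_natl mulrBr; congr (_ - _).
  transitivity (complex.Re (M%:R * (a 0%N * rho%:C ^+ 0))).
    rewrite -S0 Re_sum; apply: eq_bigr => j _.
    by rewrite expr0 invr1 expr1n mulr1.
  by rewrite expr0 mulr1 -(rmorph_nat (real_complex R)) ReZ.
rewrite ler_pdivrMr // -mulrA ler_pM2l // => /le_trans; apply.
by rewrite mulrC.
Qed.

(** Partial sums converge uniformly on the circle, so [psum_cauchy] applies to a long one with the
    bound B + e. *)
Lemma PS_cauchy a rho B k : ESeq a -> 0 <= rho ->
  (forall z, absC z = rho -> absC (PS a z) <= B) ->
  absC (a k) * rho ^+ k <= B.
Proof.
move=> ha r0 H; apply/ler_addgt0Pr => e e0.
have [|M HM] := ha (2 * rho); first by rewrite mulr_ge0.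
have [N HN] := half_pow_small (2 * M) e0.
pose n := maxn N k.+1.
apply: (@psum_cauchy a n) => //; first by rewrite leq_maxr.
move=> z zr; have := PS_tail n (_ : absC z <= rho) HM.
rewrite zr lexx => /(_ isT) h.
rewrite -[psum a n z](subrK (PS a z)) addrC.
apply: (le_trans (absCD _ _)); rewrite lerD ?H // absCB (le_trans h) //.
by have := HN n (leq_maxl _ _); rewrite mulrA -natrM.
Qed.

Lemma PS_borel_caratheodory a rho B k : ESeq a -> 0 <= rho -> (0 < k)%N ->
  (forall z, absC z = rho -> complex.Re (PS a z) <= B) ->
  absC (a k) * rho ^+ k <= 2 * (B - complex.Re (a 0%N)).
Proof.
move=> ha r0 k0 H; apply/ler_addgt0Pr => e e0.
have e2 : 0 < e / 2 by rewrite divr_gt0.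
have [|M HM] := ha (2 * rho); first by rewrite mulr_ge0.
have [N HN] := half_pow_small (2 * M) e2.
pose n := maxn N k.+1.
have -> : 2 * (B - complex.Re (a 0%N)) + e =
  2 * (B + e / 2 - complex.Re (a 0%N)) by field.
apply: (@psum_borel_caratheodory a n) => //; first by rewrite k0 leq_maxr.
move=> z zr; have := PS_tail n (_ : absC z <= rho) HM.
rewrite zr lexx => /(_ isT) h.
rewrite -[psum a n z](subrK (PS a z)) addrC ReD.
rewrite lerD ?H // (le_trans (ler_norm _)) // (le_trans (absC_Re _)) //.
rewrite absCB (le_trans h) //.
by have := HN n (leq_maxl _ _); rewrite mulrA -natrM.
Qed.

End RootsOfUnity.

(** * Cauchy's theorem and Taylor expansion *)

Section RealVariable.
Context {R : realType}.
Implicit Types (f : R[i] -> R[i]) (u v G g : R -> R[i]) (z l : R[i]) (t : R).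
Local Notation mu := (@lebesgue_measure R).

Definition cder u t l := forall e : R, 0 < e -> exists2 d : R, 0 < d &
  forall h : R, `|h| < d -> absC (u (t + h) - u t - h%:C * l) <= e * `|h|.

Definition ccont u := forall t (e : R), 0 < e -> exists2 d : R, 0 < d &
  forall h : R, `|h| < d -> absC (u (t + h) - u t) <= e.

Lemma is_deriveP (h : R -> R) t (l : R) : is_derive t 1 h l <->
  forall e : R, 0 < e -> exists2 d : R, 0 < d &
  forall k : R, `|k| < d -> `|h (t + k) - h t - k * l| <= e * `|k|.
Proof.
split.
  move=> [dh <-] e e0; move: dh => /cvgrPdist_le /(_ _ e0)[d d0 Hd].
  exists d => // k kd; have [->|k0] := eqVneq k 0.
    by rewrite addr0 subrr mul0r subrr normr0 mulr0.
  have := Hd k; rewrite /ball_ /= sub0r normrN => /(_ kd k0).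
  rewrite -/('D_1 h t) => Hk; rewrite distrC.
  have -> : k * 'D_1 h t - (h (t + k) - h t) =
    ('D_1 h t - k^-1 *: (h (k *: (1 : R) + t) - h t)) * k.
    rewrite mulrBl; congr (_ - _); first by rewrite mulrC.
    by rewrite /GRing.scale /= mulr1 [k + t]addrC mulrAC mulVf // mul1r.
  by rewrite normrM ler_wpM2r.
move=> H; have cv : k^-1 *: (h (k *: (1 : R) + t) - h t) @[k --> 0^'] --> l.
  apply/cvgrPdist_le => e e0; have [d d0 Hd] := H _ e0.
  exists d => // k; rewrite /ball_ /= sub0r normrN => kd k0.
  have := Hd _ kd; rewrite -ler_pdivrMr ?normr_gt0 // -normf_div distrC.
  congr (`| _ | <= _); rewrite mulrBl [k * l]mulrC mulfK //; congr (_ - _).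
  by rewrite /GRing.scale /= mulr1 [k + t]addrC mulrC.
by apply: DeriveDef; [apply/cvg_ex; exists l|exact/cvg_lim].
Qed.

Lemma cder_comp u t l : cder u t l <->
  is_derive t 1 (fun x => complex.Re (u x)) (complex.Re l) /\
  is_derive t 1 (fun x => complex.Im (u x)) (complex.Im l).
Proof.
have ReE k : complex.Re (u (t + k)) - complex.Re (u t) - k * complex.Re l =
  complex.Re (u (t + k) - u t - k%:C * l) by rewrite !ReD !ReN ReZ.
have ImE k : complex.Im (u (t + k)) - complex.Im (u t) - k * complex.Im l =
  complex.Im (u (t + k) - u t - k%:C * l) by rewrite !ImD !ImN ImZ.
split.
  move=> H; split; apply/is_deriveP => e /H[d d0 Hd]; exists d => // k /Hd.
    by rewrite ReE; apply: le_trans; exact: absC_Re.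
  by rewrite ImE; apply: le_trans; exact: absC_Im.
move=> [/is_deriveP H1 /is_deriveP H2] e e0.
have e2 : 0 < e / 2 by rewrite divr_gt0.
have [d1 d10 h1] := H1 _ e2; have [d2 d20 h2] := H2 _ e2.
exists (Num.min d1 d2); first by rewrite lt_min d10.
move=> k; rewrite lt_min => /andP[/h1 + /h2]; rewrite ReE ImE => k1 k2.
apply: (le_trans (absC_le_ReIm _)); apply: (le_trans (lerD k1 k2)).
by rewrite -mulrDl -splitr.
Qed.

Lemma continuousP (h : R -> R) : continuous h <->
  forall t (e : R), 0 < e -> exists2 d : R, 0 < d &
  forall k : R, `|k| < d -> `|h (t + k) - h t| <= e.
Proof.
split=> [H t e e0|H t].
  have /cvgrPdist_le /(_ _ e0)[d d0 Hd] := H t; exists d => // k kd.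
  rewrite distrC; apply: (Hd (t + k)).
  by rewrite /ball_ /= opprD addNKr normrN.
apply/cvgrPdist_le => e e0; have [d d0 Hd] := H t e e0.
exists d => // k; rewrite /ball_ /= => kd.
by have := Hd (k - t); rewrite distrC => /(_ kd);
  rewrite [t + _]addrC subrK distrC.
Qed.

Lemma ccont_comp u : ccont u <->
  continuous (fun x => complex.Re (u x)) /\
  continuous (fun x => complex.Im (u x)).
Proof.
split.
  move=> H; split; apply/continuousP => t e e0; have [d d0 Hd] := H t e e0;
  exists d => // k /Hd; apply: le_trans.
    by rewrite -ReN -ReD absC_Re.
  by rewrite -ImN -ImD absC_Im.
move=> [/continuousP H1 /continuousP H2] t e e0.
have e2 : 0 < e / 2 by rewrite divr_gt0.
have [d1 d10 h1] := H1 t _ e2; have [d2 d20 h2] := H2 t _ e2.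
exists (Num.min d1 d2); first by rewrite lt_min d10.
move=> k; rewrite lt_min => /andP[/h1 k1 /h2 k2].
apply: (le_trans (absC_le_ReIm _)); rewrite ReD ImD ReN ImN [e]splitr.
exact: lerD.
Qed.

Lemma cder_ccont u : (forall t, exists l, cder u t l) -> ccont u.
Proof.
move=> H; apply/ccont_comp; split=> t; have [l /cder_comp[h1 h2]] := H t.
  by apply: differentiable_continuous; apply/derivable1_diffP; case: h1.
by apply: differentiable_continuous; apply/derivable1_diffP; case: h2.
Qed.

Lemma ccontf f u : (forall t, exists l, cdiff f (u t) l) -> ccont u ->
  ccont (fun t => f (u t)).
Proof.
move=> hf hu t e e0; have [l hl] := hf t.
have [d d0 Hd] := cdiff_cts hl e0.
have d2 : 0 < d / 2 by rewrite divr_gt0.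
have [d' d'0 Hd'] := hu t _ d2; exists d' => // h /Hd' hh.
have := Hd (u (t + h) - u t); rewrite [u t + _]addrC subrK; apply.
by apply: le_lt_trans hh _; rewrite ltr_pdivrMr // ltr_pMr // ltr1n.
Qed.

Lemma ccontM u v : ccont u -> ccont v -> ccont (fun t => u t * v t).
Proof.
move=> /ccont_comp[u1 u2] /ccont_comp[v1 v2]; apply/ccont_comp; split=> t.
  under eq_fun do rewrite ReM.
  by apply: cvgB; apply: cvgM; [exact: u1|exact: v1|exact: u2|exact: v2].
under eq_fun do rewrite ImM.
by apply: cvgD; apply: cvgM; [exact: u1|exact: v2|exact: u2|exact: v1].
Qed.

Lemma ccontD u v : ccont u -> ccont v -> ccont (fun t => u t + v t).
Proof.
move=> /ccont_comp[u1 u2] /ccont_comp[v1 v2]; apply/ccont_comp; split=> t.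
  by under eq_fun do rewrite ReD; apply: cvgD; [exact: u1|exact: v1].
by under eq_fun do rewrite ImD; apply: cvgD; [exact: u2|exact: v2].
Qed.

Lemma ccont_cst (c : R[i]) : ccont (fun=> c).
Proof. by move=> t e e0; exists 1 => // h _; rewrite subrr absC0 ltW. Qed.

Lemma cder_cst (c : R[i]) t : cder (fun=> c) t 0.
Proof.
move=> e e0; exists 1 => // h _.
by rewrite subrr mulr0 subrr absC0 mulr_ge0 // ltW.
Qed.

Lemma cder_id t : cder (fun x => x%:C) t 1.
Proof.
move=> e e0; exists 1 => // h _; rewrite mulr1 rmorphD /= [t%:C + _]addrC addrK.
by rewrite subrr absC0 mulr_ge0 // ltW.
Qed.

Lemma cderD u v t l l' : cder u t l -> cder v t l' ->
  cder (fun x => u x + v x) t (l + l').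
Proof.
move=> /cder_comp[u1 u2] /cder_comp[v1 v2]; apply/cder_comp; split.
  by under eq_fun do rewrite ReD; rewrite ReD; apply: is_deriveD.
by under eq_fun do rewrite ImD; rewrite ImD; apply: is_deriveD.
Qed.

Lemma cderN u t l : cder u t l -> cder (fun x => - u x) t (- l).
Proof.
move=> /cder_comp[u1 u2]; apply/cder_comp; split.
  by under eq_fun do rewrite ReN; rewrite ReN; apply: is_deriveN.
by under eq_fun do rewrite ImN; rewrite ImN; apply: is_deriveN.
Qed.

Lemma cderM u v t l l' : cder u t l -> cder v t l' ->
  cder (fun x => u x * v x) t (l * v t + u t * l').
Proof.
move=> /cder_comp[u1 u2] /cder_comp[v1 v2]; apply/cder_comp; split.
  under eq_fun do rewrite ReM.
  apply: (is_derive_eq (is_deriveB (is_deriveM u1 v1) (is_deriveM u2 v2))).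
  by rewrite !ReD !ReM /GRing.scale /=; ring.
under eq_fun do rewrite ImM.
apply: (is_derive_eq (is_deriveD (is_deriveM u1 v2) (is_deriveM u2 v1))).
by rewrite !ImD !ImM /GRing.scale /=; ring.
Qed.

Lemma cderf f u t l m : cdiff f (u t) l -> cder u t m ->
  cder (fun x => f (u x)) t (l * m).
Proof.
(* Since e1 <= 1, the increment of [u] is at most (|m| + 1) |h|, and the two errors add up to at
   most e1 (|m| + 1 + |l|) |h|; the other condition e1 <= e / K finishes. *)
move=> hf hu e e0; set K := absC l + absC m + 2.
have K0 : 0 < K by rewrite ltr_wpDl // addr_ge0 ?absC_ge0.
set e1 := Num.min 1 (e / K).
have e10 : 0 < e1 by rewrite lt_min ltr01 divr_gt0.
have [d d0 Hd] := hf _ e10; have [d' d'0 Hd'] := hu _ e10.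
have d''0 : 0 < d / K by rewrite divr_gt0.
exists (Num.min d' (d / K)); first by rewrite lt_min d'0.
move=> h; rewrite lt_min => /andP[/Hd' h1 h2].
have e1K : e1 * K <= e by rewrite -ler_pdivlMr // ge_min lexx orbT.
have hu1 : absC (u (t + h) - u t) <= (absC m + 1) * `|h|.
  rewrite -[u (t + h) - u t](subrK (h%:C * m)).
  apply: (le_trans (absCD _ _)); rewrite absCM absC_real mulrDl addrC.
  rewrite [absC m * _]mulrC lerD // (le_trans h1) // ler_wpM2r //.
  by rewrite ge_min lexx.
have hd : absC (u (t + h) - u t) < d.
  apply: (le_lt_trans hu1); rewrite ltr_pdivlMr // in h2.
  apply: le_lt_trans h2; rewrite mulrC ler_wpM2l // /K.
  by have := absC_ge0 l; have := absC_ge0 m; lra.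
have := Hd _ hd; rewrite [u t + _]addrC subrK => h3.
have -> : f (u (t + h)) - f (u t) - h%:C * (l * m) =
  (f (u (t + h)) - f (u t) - l * (u (t + h) - u t)) +
  l * (u (t + h) - u t - h%:C * m) by ring.
apply: (le_trans (absCD _ _)); rewrite absCM.
apply: (@le_trans _ _ (e1 * ((absC m + 1) * `|h|) + absC l * (e1 * `|h|))).
  apply: lerD; last by rewrite ler_wpM2l ?absC_ge0.
  by apply: (le_trans h3); rewrite ler_wpM2l // ltW.
apply: (@le_trans _ _ (e1 * K * `|h|)); last by rewrite ler_wpM2r.
have -> : e1 * ((absC m + 1) * `|h|) + absC l * (e1 * `|h|) =
  e1 * (absC m + 1 + absC l) * `|h| by ring.
by rewrite ler_wpM2r // ler_wpM2l ?(ltW e10) // /K; lra.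
Qed.

(** The fundamental theorem of calculus gives primitives on bounded intervals. Those based at -n are
    normalised to vanish at 0, so that two of them agree on their common domain and can be glued. *)
Lemma real_primitive (h : R -> R) : continuous h ->
  exists H : R -> R, forall t, is_derive t 1 H (h t).
Proof.
move=> ch.
have ih a b : mu.-integrable `[a, b] (EFin \o h).
  apply: continuous_compact_integrable; first exact: segment_compact.
  exact: continuous_subspaceT.
pose P (n : nat) (x : R) : R := \int[mu]_(y in `[- n%:R, x]) h y -
  \int[mu]_(y in `[- n%:R, 0]) h y.
have PE (n n' : nat) (x : R) : (n <= n')%N -> `|x| <= n%:R -> P n x = P n' x.
  move=> nn' xn.
  have nR : - n'%:R <= - n%:R :> R by rewrite lerN2 ler_nat.
  have I y : - n%:R <= y -> \int[mu]_(y in `[- n'%:R, y]) h y =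
     \int[mu]_(y in `[- n'%:R, - n%:R]) h y + \int[mu]_(y in `[- n%:R, y]) h y.
    move=> ny; rewrite -(@Rintegral_itv_obnd_cbnd _ (- n%:R) (BRight y)); last first.
      by apply: integrableS (ih (- n%:R) y) => //; exact: subset_itv_oc_cc.
    by rewrite -(@Rintegral_itvB _ h (BLeft (- n'%:R))) ?bnd_simp // subrKC.
  rewrite /P (I x) ?(I 0) ?oppr_le0 ?ler0n //; last first.
    by move: xn; rewrite ler_norml => /andP[].
  by ring.
have dP n (x : R) : `|x| < n%:R -> is_derive x 1 (P n) (h x).
  rewrite ltr_norml => /andP[x1 x2].
  have [d1 d2] := continuous_FTC1_closed x2 (ih (- n%:R) n%:R) x1 (ch x).
  have d3 := DeriveDef d1 (etrans (esym (derive1E _ _)) d2).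
  exact: (is_derive_eq (is_deriveB d3 (is_derive_cst _ x 1)) (subr0 _)).
exists (fun x => P (Num.truncn `|x|).+1 x) => x.
(* The index used at a point y varies with y; one extra unit makes a single [N] serve a whole
   neighbourhood of x. *)
pose N := (Num.truncn `|x|).+2.
have xN : `|x| < N%:R.
  by apply: lt_trans (truncnS_gt _) _; rewrite ltr_nat.
apply: near_eq_is_derive (dP N x xN).
near=> y; apply/esym/PE; last by rewrite ltW // truncnS_gt.
rewrite ltnS -[leqRHS]/(Num.truncn `|x|).+1.
have : `|y| < `|x| + 1.
  near: y; exists 1 => //= y; rewrite /ball_ /= distrC => yx.
  rewrite -[y](subrK x) addrC; apply: (le_lt_trans (ler_normD _ _)).
  by rewrite ltrD2l.
move=> yx; rewrite leqNgt truncn_gt_nat -ltNge (lt_trans yx) //.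
by rewrite -natr1 ltrD2r truncnS_gt.
Unshelve. all: by end_near. Qed.


Lemma primitive_exists g : ccont g -> exists G, forall t, cder G t (g t).
Proof.
move=> /ccont_comp[/real_primitive[G1 h1] /real_primitive[G2 h2]].
by exists (fun t => G1 t +i* G2 t) => t; apply/cder_comp; split; [exact: h1|exact: h2].
Qed.

(** The mean value theorem fails for complex values and is applied to real and imaginary parts,
    whence the factor 2. *)
Lemma cder_mean G g (M a b : R) : a <= b -> (forall t, cder G t (g t)) ->
  (forall t, a <= t <= b -> absC (g t) <= M) ->
  absC (G b - G a) <= 2 * M * (b - a).
Proof.
rewrite le_eqVlt => /predU1P[->|ab] hG hM.
  by rewrite !subrr absC0 mulr0.
have mean (h dh : R -> R) : (forall t, is_derive t 1 h (dh t)) ->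
    (forall t, a <= t <= b -> `|dh t| <= M) -> `|h b - h a| <= M * (b - a).
  move=> hh bh; have [|c cab ->] := @MVT _ h dh a b ab (fun x _ => hh x).
    apply: derivable_within_continuous => x _; by case: (hh x).
  rewrite normrM [`|b - a|]gtr0_norm ?subr_gt0 // ler_wpM2r ?subr_ge0 ?(ltW ab) //.
  by apply: bh; move: cab; rewrite in_itv /= => /andP[/ltW -> /ltW ->].
apply: (le_trans (absC_le_ReIm _)).
have -> : 2 * M * (b - a) = M * (b - a) + M * (b - a) by ring.
rewrite ReD ImD ReN ImN; apply: lerD.
  apply: (mean (fun x => complex.Re (G x)) (fun x => complex.Re (g x))).
    by move=> t; have /cder_comp[] := hG t.
  by move=> t /hM; apply: le_trans; exact: absC_Re.
apply: (mean (fun x => complex.Im (G x)) (fun x => complex.Im (g x))).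
  by move=> t; have /cder_comp[] := hG t.
by move=> t /hM; apply: le_trans; exact: absC_Im.
Qed.

Lemma cder0_cst G : (forall t, cder G t 0) -> forall s t, G s = G t.
Proof.
move=> H s t; apply: complexP.
  apply: (@is_derive_0_is_cst _ (fun x => complex.Re (G x))) => x.
  by have /cder_comp[] := H x.
apply: (@is_derive_0_is_cst _ (fun x => complex.Im (G x))) => x.
by have /cder_comp[] := H x.
Qed.

(* Defined through a primitive: the value is 0 when [g] has none. *)
Definition cint g (a b : R) : R[i] :=
  let G := xget (fun=> 0) [set G | forall t, cder G t (g t)] in G b - G a.

Lemma cintE G g a b : (forall t, cder G t (g t)) -> cint g a b = G b - G a.
Proof.
move=> hG; rewrite /cint; case: xgetP => [F _ /= hF|/(_ G)/(_ hG)//].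
have -> : F b = G b + (F a - G a); last by ring.
suff FG s t : F s - G s = F t - G t by rewrite -(FG b a); ring.
move: s t; apply: (@cder0_cst (fun x => F x - G x)) => x.
by rewrite -(subrr (g x)); apply: cderD => //; exact: cderN.
Qed.

(** Unconditional, whatever the order of the points, since [cint] is the increment of one chosen
    function; the bisection of rectangles relies on this. *)
Lemma cint_split g a b c : cint g a c = cint g a b + cint g b c.
Proof. by rewrite /cint /= [RHS]addrC subrKA. Qed.

Lemma cintD g g' a b : ccont g -> ccont g' ->
  cint (fun t => g t + g' t) a b = cint g a b + cint g' a b.
Proof.
move=> /primitive_exists[G hG] /primitive_exists[G' hG'].
rewrite (cintE a b hG) (cintE a b hG') (@cintE (fun t => G t + G' t)).
  by ring.
by move=> t; exact: cderD.
Qed.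

Lemma cintZ (c : R[i]) g a b : ccont g ->
  cint (fun t => c * g t) a b = c * cint g a b.
Proof.
move=> /primitive_exists[G hG].
rewrite (cintE a b hG) (@cintE (fun t => c * G t)) ?mulrBr // => t.
by have := cderM (cder_cst c t) (hG t); rewrite mul0r add0r.
Qed.

Lemma cint_bound g (M a b : R) : a <= b -> ccont g ->
  (forall t, a <= t <= b -> absC (g t) <= M) ->
  absC (cint g a b) <= 2 * M * (b - a).
Proof.
move=> ab /primitive_exists[G hG] hM.
by rewrite (cintE a b hG); exact: cder_mean hM.
Qed.

(** Continuity of the sum is carried through the same induction because each use of [cintD] requires
    it. *)
Lemma cint_psum (a : nat -> R -> R[i]) (N : nat) (s t : R) :
  (forall k, ccont (a k)) ->
  cint (fun x => \sum_(k < N) a k x) s t = \sum_(k < N) cint (a k) s t /\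
  ccont (fun x => \sum_(k < N) a k x).
Proof.
move=> ha; elim: N => [|N [IH1 IH2]].
  under eq_fun do rewrite big_ord0; rewrite big_ord0; split; last first.
    exact: ccont_cst.
  by rewrite (@cintE (fun=> 0)) ?subrr // => x; exact: cder_cst.
under eq_fun do rewrite big_ord_recr /=.
by rewrite big_ord_recr /= cintD // IH1; split => //; exact: ccontD.
Qed.

End RealVariable.

(** * Goursat's bisection argument *)

Section Goursat.
Context {R : realType}.
Implicit Types (s t h k : R).

(** The left endpoints increase, the right endpoints u n + h / 2^n decrease, and every left endpoint
    lies below every right one; the limit of the left endpoints is the common point. *)
Lemma nested_intervals (u : nat -> R) h : 0 <= h ->
  (forall n, u n <= u n.+1 <= u n + h / 2 ^+ n.+1) ->
  exists x, forall n, u n <= x <= u n + h / 2 ^+ n.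
Proof.
move=> h0 H.
have ui : {homo u : n m / (n <= m)%N >-> n <= m}.
  by apply/nondecreasing_seqP => n; have /andP[] := H n.
have vi : {homo (fun n => u n + h / 2 ^+ n) : n m / (n <= m)%N >-> m <= n}.
  apply/nonincreasing_seqP => n; have /andP[_] := H n.
  rewrite -(lerD2r (h / 2 ^+ n.+1)) => /le_trans; apply.
  rewrite -addrA lerD2l -mulr2n -mulr_natr exprS invfM.
  by rewrite le_eqVlt; apply/orP; left; apply/eqP; field; rewrite expf_neq0.
have uv m n : u m <= u n + h / 2 ^+ n.
  apply: (@le_trans _ _ (u (maxn m n))); first by rewrite ui // leq_maxl.
  apply: (@le_trans _ _ (u (maxn m n) + h / 2 ^+ maxn m n)).
    by rewrite lerDl divr_ge0 // exprn_ge0.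
  by rewrite vi // leq_maxr.
have cu : cvgn u.
  apply: nondecreasing_is_cvgn => //; exists (u 0%N + h / 2 ^+ 0).
  by move=> _ [m _ <-].
exists (limn u) => n; apply/andP; split.
  exact: nondecreasing_cvgn_le.
by apply: limr_le => //; near=> m; exact: uv.
Unshelve. all: by end_near. Qed.

(* Goursat's bisection, with the contour integral over the boundary of
   [s1, s2] x [t1, t2] abstracted to an additive function of rectangles. *)
Lemma goursat (I : R -> R -> R -> R -> R[i]) s0 h t0 k : 0 <= h -> 0 <= k ->
  (forall s1 s2 s3 t1 t2, I s1 s3 t1 t2 = I s1 s2 t1 t2 + I s2 s3 t1 t2) ->
  (forall s1 s2 t1 t2 t3, I s1 s2 t1 t3 = I s1 s2 t1 t2 + I s1 s2 t2 t3) ->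
  (forall s t, s <= s0 + h -> forall e : R, 0 < e -> exists2 d : R, 0 < d &
     forall s1 s2 t1 t2, s1 <= s <= s2 -> t1 <= t <= t2 -> s2 <= s0 + h ->
      s2 - s1 < d -> t2 - t1 < d ->
      absC (I s1 s2 t1 t2) <= e * (s2 - s1 + (t2 - t1)) ^+ 2) ->
  I s0 (s0 + h) t0 (t0 + k) = 0.
Proof.
move=> h0 k0 Is It Hloc.
set I0 := absC (I s0 (s0 + h) t0 (t0 + k)).
(* [Q n p] is the value on the rectangle of generation [n] with lower left corner [p]; [good]
   selects a quarter that keeps at least a fourth of the modulus. *)
pose Q n (p : R * R) := I p.1 (p.1 + h / 2 ^+ n) p.2 (p.2 + k / 2 ^+ n).
pose good n p p' := [/\ absC (Q n p) <= 4 * absC (Q n.+1 p'),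
  p.1 <= p'.1 <= p.1 + h / 2 ^+ n.+1 & p.2 <= p'.2 <= p.2 + k / 2 ^+ n.+1].
have half (x : R) n : x / 2 ^+ n = x / 2 ^+ n.+1 + x / 2 ^+ n.+1.
  by rewrite exprS; field; rewrite expf_neq0.
have ge0 (x : R) n : 0 <= x -> 0 <= x / 2 ^+ n.
  by move=> x0; rewrite divr_ge0 // exprn_ge0.
have step n p : exists p', good n p p'.
  case: p => s t; set a := h / 2 ^+ n.+1; set b := k / 2 ^+ n.+1.
  have ha : 0 <= a by exact: ge0.
  have hb : 0 <= b by exact: ge0.
  have E : Q n (s, t) = Q n.+1 (s, t) + Q n.+1 (s, t + b) +
      (Q n.+1 (s + a, t) + Q n.+1 (s + a, t + b)).
    rewrite /Q /= (half h) (half k) -/a -/b !addrA (Is s (s + a)).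
    by rewrite (It s _ t (t + b)) (It (s + a) _ t (t + b)) !addrA.
  have L : absC (Q n (s, t)) <= absC (Q n.+1 (s, t)) +
    absC (Q n.+1 (s, t + b)) + (absC (Q n.+1 (s + a, t)) +
    absC (Q n.+1 (s + a, t + b))).
    rewrite E (le_trans (absCD _ _)) // lerD // absCD //.
  have [l1|l1] := leP (absC (Q n (s, t))) (4 * absC (Q n.+1 (s, t))).
    by exists (s, t); split; rewrite //= -/a -/b ?lexx ?lerDl ?ha ?hb.
  have [l2|l2] := leP (absC (Q n (s, t))) (4 * absC (Q n.+1 (s, t + b))).
    by exists (s, t + b); split; rewrite //= -/a -/b ?lexx ?lerDl ?ha ?hb.
  have [l3|l3] := leP (absC (Q n (s, t))) (4 * absC (Q n.+1 (s + a, t))).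
    by exists (s + a, t); split; rewrite //= -/a -/b ?lexx ?lerDl ?ha ?hb.
  exists (s + a, t + b); split; rewrite //= -/a -/b ?lexx ?lerDl ?ha ?hb //.
  by move: l1 l2 l3 L; lra.
pose x := fix F n := if n is m.+1 then xget (0, 0) [set p' | good m (F m) p']
                     else (s0, t0).
have xg n : good n (x n) (x n.+1).
  by rewrite /=; case: xgetP => [//|/= H]; have [p'] := step n (x n); move/H.
have I0n n : I0 <= 4 ^+ n * absC (Q n (x n)).
  elim: n => [|n IH]; first by rewrite expr0 mul1r /Q /= !expr0 !divr1.
  apply: (le_trans IH); rewrite [4 ^+ n.+1]exprSr -mulrA.
  by rewrite ler_wpM2l ?exprn_ge0 //; case: (xg n).
have [s Hs] := @nested_intervals (fun n => (x n).1) h h0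
  (fun n => let: And3 _ H _ := xg n in H).
have [t Ht] := @nested_intervals (fun n => (x n).2) k k0
  (fun n => let: And3 _ _ H := xg n in H).
(* The local estimate is assumed only below s0 + h, a level that the chosen rectangles never
   exceed. *)
have topn n : (x n).1 + h / 2 ^+ n <= s0 + h.
  elim: n => [|n IH]; first by rewrite /= expr0 divr1.
  apply: le_trans IH; rewrite [in leRHS]half addrA lerD2r.
  by case: (xg n) => _ /andP[].
have ss0 : s <= s0 + h.
  by have /andP[_] := Hs 0%N; rewrite /= expr0 divr1.
suff I00 : I0 <= 0.
  by apply/eqP; rewrite -absC_eq0 eq_le absC_ge0 andbT.
apply/ler_addgt0Pr => e e0; rewrite add0r.
(* The factor 4^N lost in the selection cancels against the squared size ((h + k) / 2^N)^2, leaving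
   e (h + k)^2 / c <= e; the added 1 keeps [c] positive. *)
set c := (h + k) ^+ 2 + 1.
have c0 : 0 < c by rewrite ltr_pwDr // sqr_ge0.
have [d d0 Hd] := Hloc s t ss0 (e / c) (divr_gt0 e0 c0).
have d2 : 0 < d / 2 by rewrite divr_gt0.
have [N HN] := half_pow_small (h + k) d2.
have small : (h + k) / 2 ^+ N < d.
  have := HN N (leqnn _); rewrite -mulrA => small.
  have := ge0 _ N (addr_ge0 h0 k0) => p0.
  by move: small p0 d0; set y := _ / _; lra.
have /(_ (Hs N) (Ht N) (topn N)) := Hd (x N).1 ((x N).1 + h / 2 ^+ N)
  (x N).2 ((x N).2 + k / 2 ^+ N).
rewrite -/(Q N (x N)) ![_ + _ - _]addrAC !subrr !add0r => H.
have {}H : absC (Q N (x N)) <= e / c * ((h + k) / 2 ^+ N) ^+ 2.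
  rewrite mulrDl; apply: H; apply: le_lt_trans small.
    by rewrite mulrDl lerDl ge0.
  by rewrite mulrDl lerDr ge0.
apply: (le_trans (I0n N)).
apply: (@le_trans _ _ (4 ^+ N * (e / c * ((h + k) / 2 ^+ N) ^+ 2))).
  by rewrite ler_wpM2l // exprn_ge0.
have -> : 4 ^+ N * (e / c * ((h + k) / 2 ^+ N) ^+ 2) =
   e * ((h + k) ^+ 2 / c) * (4 ^+ N / (2 ^+ N) ^+ 2).
  by field; rewrite expf_neq0 //= gt_eqF.
have -> : 4 ^+ N / (2 ^+ N) ^+ 2 = 1 :> R.
  have -> : (4 : R) = 2 ^+ 2 by ring.
  by rewrite exprAC divff // !expf_neq0.
rewrite mulr1 ler_piMr ?(ltW e0) // ler_pdivrMr // mul1r /c lerDl //.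
Qed.

End Goursat.

(** * Cauchy's integral formula on a circle *)

Section Cauchy.
Context {R : realType}.
Implicit Types (f : R[i] -> R[i]) (z : R[i]) (r s t : R).

Definition ei t : R[i] := cos t +i* sin t.

Lemma cder_ei t : cder ei t ('i * ei t).
Proof.
apply/cder_comp; split; rewrite /ei; simpc.
  by apply: is_derive_cos.
by apply: is_derive_sin.
Qed.

Lemma absC_ei t : absC (ei t) = 1.
Proof. by rewrite absC_sqrt /= cos2Dsin2 sqrtr1. Qed.

Lemma ei_neq0 t : ei t != 0.
Proof. by rewrite -absC_gt0 absC_ei. Qed.

Lemma ei_period : ei (pi *+ 2) = ei 0.
Proof. by rewrite /ei cos2pi sin2pi cos0 sin0. Qed.

Lemma absCi : absC ('i : R[i]) = 1.
Proof. by rewrite absC_sqrt /= expr0n expr1n add0r sqrtr1. Qed.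

Lemma ccont_ei : ccont ei.
Proof. by apply: cder_ccont => t; exists ('i * ei t); exact: cder_ei. Qed.

Lemma ccont_bounded (u : R -> R[i]) (a b : R) : a <= b -> ccont u ->
  exists M, forall t, a <= t <= b -> absC (u t) <= M.
Proof.
move=> ab /ccont_comp[h1 h2].
pose g x := `|complex.Re (u x)| + `|complex.Im (u x)|.
have cg : {within `[a, b], continuous g}.
  apply: continuous_subspaceT => x; apply: cvgD.
    by apply: cvg_norm; exact: h1.
  by apply: cvg_norm; exact: h2.
have [c cab Hc] := EVT_max ab cg.
exists (g c) => t tab; apply: (le_trans (absC_le_ReIm _)); apply: (Hc t).
by rewrite in_itv.
Qed.

(** After factoring out the larger exponential, which is at most 1, this is 1 - exp(-x) <= x. It
    explains why the contraction parameter is kept nonpositive. *)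
Lemma expR_lip s s' : s <= 0 -> s' <= 0 -> `|expR s' - expR s| <= `|s' - s|.
Proof.
wlog ss' : s s' / s <= s' => [hw|] s0 s'0.
  have [|/ltW] := leP s s'; first by move/hw; exact.
  by move/hw; rewrite distrC [`|s' - s|]distrC; exact.
rewrite !ger0_norm ?subr_ge0 ?ler_expR //.
have -> : expR s' - expR s = expR s' * (1 - expR (s - s')).
  by rewrite mulrBr mulr1 -expRD [s' + _]addrC subrK.
apply: (@le_trans _ _ (1 * (1 - expR (s - s')))).
  rewrite ler_wpM2r ?subr_ge0 // -expR0 ler_expR // subr_le0 //.
by have := expR_ge1Dx (s - s'); lra.
Qed.

Lemma ccont_expR : ccont (fun s => (expR s)%:C : R[i]).
Proof.
apply/ccont_comp; split => /=; first exact: continuous_expR.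
by move=> x; exact: cvg_cst.
Qed.

Section Disc.
Variables (z : R[i]) (r : R).
Hypothesis zr : absC z < r.

Let r0 : 0 < r. Proof. exact: le_lt_trans (absC_ge0 z) zr. Qed.

(* [cH s t] = z + e^s (r e^(it) - z) contracts the circle of radius r onto z as
   s tends to -oo, with ds-derivative [cH s t - z] and dt-derivative
   [(cH s t - z) * cw t]; [cform f] is the integral of f(x) dx / (x - z) along
   the image of the boundary of a rectangle. *)
Definition cU t : R[i] := r%:C * ei t - z.
Definition cH s t : R[i] := z + (expR s)%:C * cU t.
Definition cw t : R[i] := 'i * (r%:C * ei t) * (cU t)^-1.
Let K := r / (r - absC z).

Let rz0 : 0 < r - absC z. Proof. by rewrite subr_gt0. Qed.

Lemma absC_rei t : absC (r%:C * ei t) = r.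
Proof. by rewrite absCM absC_ei mulr1 absC_real gtr0_norm. Qed.

Lemma cU_ge t : r - absC z <= absC (cU t).
Proof. by rewrite -{1}(absC_rei t); exact: absC_dist. Qed.

Lemma cU_neq0 t : cU t != 0.
Proof. by rewrite -absC_gt0 (lt_le_trans rz0) // cU_ge. Qed.

Lemma cU_le t : absC (cU t) <= 2 * r.
Proof.
apply: (le_trans (absCD _ _)); rewrite absCN absC_rei.
by move: zr; lra.
Qed.

Lemma cw_le t : absC (cw t) <= K.
Proof.
rewrite /cw !absCM absCi mul1r absCV absC_ei mulr1 absC_real gtr0_norm //.
by rewrite ler_wpM2l ?(ltW r0) // lef_pV2 ?posrE ?cU_ge // (lt_le_trans rz0) // cU_ge.
Qed.

Lemma cder_cU t : cder cU t ('i * (r%:C * ei t)).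
Proof.
have := cderD (cderM (cder_cst r%:C t) (cder_ei t)) (cder_cst (- z) t).
by rewrite mul0r add0r addr0 mulrCA.
Qed.

Lemma ccont_cU : ccont cU.
Proof. by apply: cder_ccont => t; eexists; exact: cder_cU. Qed.

Lemma ccont_cw : ccont cw.
Proof.
have h : ccont (fun t => (cU t)^-1).
  apply: (@ccontf _ (fun x => x^-1) cU); last exact: ccont_cU.
  by move=> t; eexists; exact: (@cdiffV _ id (cU t) 1 (cU_neq0 t) (cdiff_id _)).
exact: (ccontM (ccontM (ccont_cst 'i) (ccontM (ccont_cst r%:C) ccont_ei)) h).
Qed.

Lemma ccont_cHs t : ccont (fun s => cH s t).
Proof.
exact: (ccontD (ccont_cst z) (ccontM ccont_expR (ccont_cst (cU t)))).
Qed.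

Lemma ccont_cHt s : ccont (cH s).
Proof.
exact: (ccontD (ccont_cst z) (ccontM (ccont_cst (expR s)%:C) ccont_cU)).
Qed.

Lemma cU_lip t t' : absC (cU t' - cU t) <= 2 * r * `|t' - t|.
Proof.
wlog tt' : t t' / t <= t' => [hw|].
  have [/hw//|/ltW/hw] := leP t t'; by rewrite absCB distrC.
rewrite ger0_norm ?subr_ge0 //; apply: cder_mean => //; first exact: cder_cU.
by move=> x _; rewrite absCM absCi mul1r absC_rei.
Qed.

Lemma cH_lip s t s' t' : s <= 0 -> s' <= 0 ->
  absC (cH s' t' - cH s t) <= 2 * r * (`|s' - s| + `|t' - t|).
Proof.
move=> s0 s'0.
have -> : cH s' t' - cH s t = (expR s')%:C * (cU t' - cU t) +
  (expR s' - expR s)%:C * cU t by rewrite /cH rmorphB /=; ring.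
apply: (le_trans (absCD _ _)); rewrite !absCM !absC_real mulrDr addrC.
apply: lerD; first by rewrite mulrC ler_pM ?absC_ge0 ?cU_le ?expR_lip.
rewrite -[leRHS]mul1r ler_pM ?absC_ge0 ?cU_lip //.
by rewrite ger0_norm ?expR_ge0 // -expR0 ler_expR.
Qed.

Definition cform f s1 s2 t1 t2 : R[i] :=
  cint (fun s => f (cH s t1)) s1 s2 + cint (fun t => f (cH s2 t) * cw t) t1 t2
  - cint (fun s => f (cH s t2)) s1 s2 - cint (fun t => f (cH s1 t) * cw t) t1 t2.

Let cdiffall f := forall x, exists l, cdiff f x l.

Lemma ccont_fs f t : cdiffall f -> ccont (fun s => f (cH s t)).
Proof. by move=> hf; apply: ccontf; [move=> s; exact: hf|exact: ccont_cHs]. Qed.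

Lemma ccont_ft f s : cdiffall f -> ccont (fun t => f (cH s t) * cw t).
Proof.
move=> hf; apply: ccontM ccont_cw.
by apply: ccontf; [move=> t; exact: hf|exact: ccont_cHt].
Qed.

Lemma cformD f g s1 s2 t1 t2 : cdiffall f -> cdiffall g ->
  cform (fun x => f x + g x) s1 s2 t1 t2 =
  cform f s1 s2 t1 t2 + cform g s1 s2 t1 t2.
Proof.
move=> hf hg; rewrite /cform.
have E s : (fun t => (f (cH s t) + g (cH s t)) * cw t) =
    (fun t => f (cH s t) * cw t + g (cH s t) * cw t).
  by apply: funext => t; rewrite mulrDl.
have abcd (a b c d a' b' c' d' : R[i]) : a + a' + (b + b') - (c + c') - (d + d') =
  (a + b - c - d) + (a' + b' - c' - d') by ring.
rewrite !E !cintD; first exact: abcd.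
all: by [exact: ccont_fs|exact: ccont_ft].
Qed.

Lemma cformZ f c s1 s2 t1 t2 : cdiffall f ->
  cform (fun x => c * f x) s1 s2 t1 t2 = c * cform f s1 s2 t1 t2.
Proof.
move=> hf; rewrite /cform.
have E s : (fun t => c * f (cH s t) * cw t) =
    (fun t => c * (f (cH s t) * cw t)) by apply: funext => t; rewrite mulrA.
have abcd (k a b c' d : R[i]) : k * a + k * b - k * c' - k * d = k * (a + b - c' - d).
  by ring.
rewrite !E !cintZ; first exact: abcd.
all: by [exact: ccont_fs|exact: ccont_ft].
Qed.

(** In the coordinates (s, t) the form dx / (x - z) is ds + [cw] t dt; neither coefficient depends
    on the other variable, so opposite sides cancel. *)
Lemma cform1 s1 s2 t1 t2 : cform (fun=> 1) s1 s2 t1 t2 = 0.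
Proof. by rewrite /cform; ring. Qed.

(** Here the form is dx itself, with primitive [cH], so the four increments around the rectangle
    cancel. *)
Lemma cform_id s1 s2 t1 t2 : cform (fun x => x - z) s1 s2 t1 t2 = 0.
Proof.
have HE s t : cH s t - z = (expR s)%:C * cU t by rewrite /cH addrC addKr.
have S t : cint (fun s => cH s t - z) s1 s2 =
    (expR s2)%:C * cU t - (expR s1)%:C * cU t.
  apply: (@cintE _ (fun s => (expR s)%:C * cU t)) => s; rewrite HE.
  have := @cderM _ (fun s => (expR s)%:C) (fun=> cU t) s (expR s)%:C 0.
  rewrite mulr0 addr0; apply; last exact: cder_cst.
  by apply/cder_comp; split=> /=; [exact: is_derive_expR|exact: is_derive_cst].
have T s : cint (fun t => (cH s t - z) * cw t) t1 t2 =
    (expR s)%:C * cU t2 - (expR s)%:C * cU t1.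
  apply: (@cintE _ (fun t => (expR s)%:C * cU t)) => t.
  have := cderM (cder_cst (expR s)%:C t) (cder_cU t).
  have E : (expR s)%:C * cU t * cw t = (expR s)%:C * ('i * (r%:C * ei t)).
    by rewrite /cw; field; exact: cU_neq0.
  by rewrite mul0r add0r HE E.
by rewrite /cform !S !T; ring.
Qed.

(** By [goursat]: near each point f is a constant plus a multiple of x - z, both with zero [cform],
    plus an error small compared with the size of the rectangle. *)
Lemma cform_eq0 f (S : R) : cdiffall f -> 0 <= S ->
  cform f (- S) 0 0 (pi *+ 2) = 0.
Proof.
move=> hf S0.
have cut_s (a1 a2 b b' c1 c2 d : R[i]) : a1 + a2 + b - (c1 + c2) - d =
  (a1 + b' - c1 - d) + (a2 + b - c2 - b') by ring.
have cut_t (a b1 b2 c c' d1 d2 : R[i]) : a + (b1 + b2) - c - (d1 + d2) =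
  (a + b1 - c' - d1) + (c' + b2 - c - d2) by ring.
have := @goursat _ (cform f) (- S) S 0 (pi *+ 2) S0; rewrite addNr add0r.
apply; first by rewrite mulrn_wge0 // pi_ge0.
- move=> s1 s2 s3 t1 t2; rewrite /cform (cint_split _ s1 s2 s3).
  rewrite [cint (fun s => f (cH s t2)) s1 s3](cint_split _ s1 s2 s3).
  by apply: cut_s.
- move=> s1 s2 t1 t2 t3; rewrite /cform (cint_split _ t1 t2 t3).
  rewrite [cint (fun t => f (cH s1 t) * cw t) t1 t3](cint_split _ t1 t2 t3).
  by apply: cut_t.
move=> s t s0 e e0.
set L := 2 * r; have L0 : 0 < L by rewrite mulr_gt0.
have K0 : 0 < K by rewrite divr_gt0.
(* Each side contributes at most 2 B (1 + K) times its length, where B = eta L (sg + ta) bounds the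
   error and 1 + K dominates both coefficients 1 and |cw|. The four sides add up to 4 eta L (1 + K)
   (sg + ta)^2 = e (sg + ta)^2. *)
set eta := e / (4 * L * (1 + K)).
have eta0 : 0 < eta by rewrite divr_gt0 // !mulr_gt0 // addr_gt0.
have [l hl] := hf (cH s t).
have [d d0 Hd] := hl _ eta0.
exists (d / (2 * L)); first by rewrite divr_gt0 // mulr_gt0.
move=> s1 s2 t1 t2 /andP[s1s ss2] /andP[t1t tt2] s20 sd td.
pose E x := f x - f (cH s t) - l * (x - cH s t).
have hE : cdiffall E.
  move=> x; have [m hm] := hf x; exists (m + 0 + - l * (1 + 0)).
  rewrite /E; apply: cdiff_ext (_ : cdiff (fun x => f x + - f (cH s t) +
    (- l) * (x + - cH s t)) x _); first by move=> y /=; ring.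
  apply: cdiffD; first by apply: cdiffD => //; exact: cdiff_cst.
  have := cdiffM (cdiff_cst (- l) x) (cdiffD (cdiff_id x) (cdiff_cst (- cH s t) x)).
  by rewrite mul0r add0r.
pose D x := x - z.
have hD : cdiffall D.
  by move=> x; eexists; exact: (cdiffD (cdiff_id x) (cdiff_cst (- z) x)).
(* The affine part is recentred at [z], not at the point of differentiation, because x - z is the
   function whose [cform] is known to vanish. *)
have fE : f = (fun x => (f (cH s t) + l * (z - cH s t)) * 1 + l * D x + E x).
  by apply: funext => x; rewrite /E /D; ring.
have h1 : cdiffall (fun=> 1) by move=> x; exists 0; exact: cdiff_cst.
have hZ c g : cdiffall g -> cdiffall (fun x => c * g x).
  by move=> hg x; have [m hm] := hg x; eexists; exact: (cdiffM (cdiff_cst c x) hm).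
have hA g g' : cdiffall g -> cdiffall g' -> cdiffall (fun x => g x + g' x).
  move=> hg hg' x; have [m hm] := hg x; have [m' hm'] := hg' x.
  by eexists; exact: (cdiffD hm hm').
have -> : cform f s1 s2 t1 t2 = cform E s1 s2 t1 t2.
  rewrite {1}fE cformD; [|by apply: hA; exact: hZ|by []].
  rewrite cformD; [|exact: hZ|exact: hZ].
  rewrite (@cformZ (fun=> 1)) // (@cformZ D) // cform1 cform_id.
  by rewrite !mulr0 !add0r.
set sg := s2 - s1; set ta := t2 - t1.
have sg0 : 0 <= sg by rewrite subr_ge0 (le_trans s1s).
have ta0 : 0 <= ta by rewrite subr_ge0 (le_trans t1t).
have small s' t' : s1 <= s' <= s2 -> t1 <= t' <= t2 ->
    absC (E (cH s' t')) <= eta * (L * (sg + ta)).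
  move=> /andP[s1s' s's2] /andP[t1t' t't2].
  have HL : absC (cH s' t' - cH s t) <= L * (sg + ta).
    apply: (le_trans (cH_lip _ _ s0 (le_trans s's2 s20))).
    rewrite ler_wpM2l ?(ltW L0) // lerD // ler_norml /sg /ta; apply/andP; split; lra.
  have Ld : L * (sg + ta) < d.
    rewrite mulrC -ltr_pdivlMr //.
    have -> : d / L = d / (2 * L) + d / (2 * L) by field; rewrite gt_eqF.
    exact: ltrD.
  have := Hd _ (le_lt_trans HL Ld); rewrite [cH s t + _]addrC subrK => /le_trans.
  by apply; rewrite ler_wpM2l // ltW.
set B := eta * (L * (sg + ta)) in small.
have B0 : 0 <= B.
  by apply: mulr_ge0 (ltW eta0) (mulr_ge0 (ltW L0) (addr_ge0 sg0 ta0)).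
have K1 : 1 <= 1 + K by rewrite lerDl ltW.
have bs t' : t1 <= t' <= t2 ->
    absC (cint (fun x => E (cH x t')) s1 s2) <= 2 * (B * (1 + K)) * sg.
  move=> t't; apply: cint_bound; [by rewrite (le_trans s1s)|exact: ccont_fs|].
  move=> x xs; apply: (le_trans (small _ _ xs t't)).
  by rewrite -[leLHS]mulr1 ler_wpM2l.
have bt s' : s1 <= s' <= s2 ->
    absC (cint (fun x => E (cH s' x) * cw x) t1 t2) <= 2 * (B * (1 + K)) * ta.
  move=> s's; apply: cint_bound; [by rewrite (le_trans t1t)|exact: ccont_ft|].
  move=> x xs; rewrite absCM ler_pM ?absC_ge0 ?small //.
  by apply: (le_trans (cw_le _)); rewrite lerDr.
have -> : e * (sg + ta) ^+ 2 = 2 * (B * (1 + K)) * sg + 2 * (B * (1 + K)) * ta +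
   2 * (B * (1 + K)) * sg + 2 * (B * (1 + K)) * ta.
  rewrite /B /eta; field; rewrite !gt_eqF //.
  by rewrite addr_gt0.
have t1in : t1 <= t1 <= t2 by rewrite lexx (le_trans t1t).
have t2in : t1 <= t2 <= t2 by rewrite lexx (le_trans t1t).
have s1in : s1 <= s1 <= s2 by rewrite lexx (le_trans s1s).
have s2in : s1 <= s2 <= s2 by rewrite lexx (le_trans s1s).
rewrite /cform; apply: (le_trans (absCD _ _)); rewrite absCN.
apply: lerD; last exact: bt.
apply: (le_trans (absCD _ _)); rewrite absCN; apply: lerD; last exact: bs.
by apply: (le_trans (absCD _ _)); apply: lerD; [exact: bs|exact: bt].
Qed.

(** In [cform_eq0] the sides t = 0 and t = 2 pi cancel by periodicity, so the integral over the
    circle equals the one over the shrunken circle s = -S, where f is close to f z. The integral of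
    [cw] itself is evaluated in [cint_cw]. *)
Lemma cauchy_kernel f : cdiffall f ->
  cint (fun t => f (r%:C * ei t) * cw t) 0 (pi *+ 2) =
  f z * cint cw 0 (pi *+ 2).
Proof.
move=> hf; apply/eqP; rewrite -subr_eq0 -absC_eq0 eq_le absC_ge0 andbT.
apply/ler_addgt0Pr => e e0; rewrite add0r.
set P : R := pi *+ 2; have P0 : 0 < P by rewrite /P mulrn_wgt0 // pi_gt0.
have K0 : 0 < K by rewrite divr_gt0.
have e1 : 0 < e / (2 * K * P) by apply: divr_gt0 e0 (mulr_gt0 (mulr_gt0 _ K0) P0).
have [l hl] := hf z; have [d d0 Hd] := cdiff_cts hl e1.
(* exp(-S) <= d / (4 r) and |cU| <= 2 r put the shrunken circle within d / 2 of [z]; the minimum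
   with 1 ensures S >= 0. *)
pose S := - ln (Num.min 1 (d / (4 * r))).
have m0 : 0 < Num.min 1 (d / (4 * r)) by rewrite lt_min ltr01 divr_gt0 // mulr_gt0.
have S0 : 0 <= S.
  by rewrite oppr_ge0 -ln1 ler_ln ?posrE // ge_min lexx.
have eS : expR (- S) <= d / (4 * r) by rewrite opprK lnK ?posrE // ge_min lexx orbT.
have Hclose t : absC (cH (- S) t - z) < d.
  rewrite /cH addrC addKr absCM absC_real ger0_norm ?expR_ge0 //.
  apply: (@le_lt_trans _ _ (d / (4 * r) * (2 * r))).
    by rewrite ler_pM ?expR_ge0 ?absC_ge0 ?cU_le.
  have -> : d / (4 * r) * (2 * r) = d / 2 by field; rewrite gt_eqF.
  by rewrite ltr_pdivrMr // ltr_pMr // ltr1n.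
have := cform_eq0 hf S0; rewrite /cform.
have H2 s : cH s P = cH s 0 by rewrite /cH /cU /P ei_period.
have -> : (fun s => f (cH s (pi *+ 2))) = (fun s => f (cH s 0)).
  by apply: funext => s; rewrite H2.
have -> : (fun t => f (cH 0 t) * cw t) = (fun t => f (r%:C * ei t) * cw t).
  by apply: funext => t; rewrite /cH expR0 mul1r /cU addrC subrK.
set A1 := cint _ 0 _; set A2 := cint _ _ 0; set A3 := cint _ 0 _ => /eqP.
rewrite [A2 + A1]addrC addrK subr_eq0 => /eqP ->.
rewrite /A3 -mulNr -cintZ; last exact: ccont_cw.
rewrite -cintD; [|exact: ccont_ft|]; last first.
  by apply: ccontM; [exact: ccont_cst|exact: ccont_cw].
have E (x y : R) : 0 < x -> 0 < y -> e = 2 * (e / (2 * x * y) * x) * (y - 0).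
  by move=> x0 y0; field; rewrite !gt_eqF.
rewrite (E _ _ K0 P0).
apply: cint_bound; first exact: ltW.
  apply: ccontD; first exact: ccont_ft.
  by apply: ccontM; [exact: ccont_cst|exact: ccont_cw].
move=> t _; rewrite -mulrDl absCM ler_pM ?absC_ge0 ?cw_le //.
by have := Hd (cH (- S) t - z) (Hclose t); rewrite [z + _]addrC subrK.
Qed.

End Disc.
End Cauchy.

(** * Taylor expansion of entire functions *)

Section Taylor.
Context {R : realType}.
Implicit Types (f : R[i] -> R[i]) (z : R[i]) (r s t : R).

Lemma geometric_small (q B e : R) : 0 <= q -> q < 1 -> 0 < e ->
  exists N, forall n, (N <= n)%N -> B * q ^+ n <= e.
Proof.
move=> q0 q1 e0.
have h : (fun n => B * q ^+ n) @ \oo --> (0 : R).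
  rewrite -(mulr0 B); apply: cvgM; first exact: cvg_cst.
  by apply: cvg_expr; rewrite ger0_norm.
have /cvgrPdist_le /(_ _ e0) [N _ HN] := h.
by exists N => n /HN /=; rewrite sub0r normrN => /ler_normlW.
Qed.

Lemma ei_powV_cint k : cint (fun t => (ei t)^-1 ^+ k : R[i]) 0 (pi *+ 2) =
  if k == 0%N then (pi *+ 2)%:C else 0.
Proof.
case: k => [|k] /=.
  rewrite (@cintE _ (fun t => t%:C)) ?subr0 // => t; rewrite expr0.
  exact: cder_id.
have dV t : cder (fun t => (ei t)^-1 : R[i]) t (- 'i * (ei t)^-1).
  have := cderf (@cdiffV _ id (ei t) 1 (ei_neq0 t) (cdiff_id _)) (cder_ei t).
  by congr cder; field; exact: ei_neq0.
have dX n t : cder (fun t => (ei t)^-1 ^+ n : R[i]) t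
    (- 'i * n%:R * (ei t)^-1 ^+ n).
  elim: n => [|n IH].
    by rewrite mulr0 mul0r; under eq_fun do rewrite expr0; exact: cder_cst.
  have := cderM (dV t) IH; under eq_fun do rewrite -exprS; congr cder.
  by rewrite exprS -natr1; ring.
have i0 : ('i : R[i]) != 0 by rewrite -absC_gt0 absCi.
rewrite (@cintE _ (fun t => (- 'i * k.+1%:R)^-1 * (ei t)^-1 ^+ k.+1)).
  by rewrite ei_period subrr.
move=> t; have := cderM (cder_cst (- 'i * k.+1%:R)^-1 t) (dX k.+1 t).
rewrite mul0r add0r mulrA mulVf ?mul1r //.
by rewrite mulf_neq0 ?oppr_eq0 // pnatr_eq0.
Qed.

(** Equal to 2 pi times the k-th Taylor coefficient; that it does not depend on [r] is not yet known
    and follows from the comparison made in [taylor]. *)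
Definition fourier f r k : R[i] :=
  cint (fun t => f (r%:C * ei t) * (r%:C * ei t)^-1 ^+ k) 0 (pi *+ 2).

Let cdiffall f := forall x, exists l, cdiff f x l.

Let rei_neq0 r t : 0 < r -> r%:C * ei t != 0 :> R[i].
Proof.
by move=> r0; rewrite -absC_gt0 absCM absC_ei mulr1 absC_real normr_gt0 gt_eqF.
Qed.

Lemma ccont_rei r : ccont (fun t => r%:C * ei t : R[i]).
Proof. exact: (ccontM (ccont_cst _) ccont_ei). Qed.

Lemma ccontX (u : R -> R[i]) k : ccont u -> ccont (fun t => u t ^+ k).
Proof.
move=> hu; elim: k => [|k IH]; first exact: ccont_cst.
by under eq_fun do rewrite exprS; exact: ccontM.
Qed.

Lemma ccont_reiV r k : 0 < r -> ccont (fun t => (r%:C * ei t : R[i])^-1 ^+ k).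
Proof.
move=> r0; apply: ccontX.
apply: (@ccontf _ (fun x => x^-1) (fun t => r%:C * ei t)); last exact: ccont_rei.
by move=> t; eexists; exact: (@cdiffV _ id _ 1 (rei_neq0 t r0) (cdiff_id _)).
Qed.

Lemma ccont_frei f r : cdiffall f -> ccont (fun t => f (r%:C * ei t)).
Proof. by move=> hf; apply: ccontf; [move=> t; exact: hf|exact: ccont_rei]. Qed.

(** With v = r e^(it) and q = z / v, [cw] is i / (1 - q), and this is a finite geometric sum with
    exact remainder q^N i / (1 - q). Keeping the remainder avoids exchanging an integral with an
    infinite sum. *)
Lemma cw_expand z r t N : absC z < r ->
  cw z r t = \sum_(k < N) 'i * z ^+ k * (r%:C * ei t)^-1 ^+ k +
    z ^+ N * (r%:C * ei t)^-1 ^+ N * cw z r t.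
Proof.
move=> zr; have r0 : 0 < r := le_lt_trans (absC_ge0 z) zr.
set v := r%:C * ei t; have v0 : v != 0 by exact: rei_neq0.
have U0 : cU z r t != 0 by exact: cU_neq0.
have -> : \sum_(k < N) 'i * z ^+ k * v^-1 ^+ k =
    'i * (\sum_(k < N) (z / v) ^+ k).
  by rewrite mulr_sumr; apply: eq_bigr => k _; rewrite exprMn mulrA.
rewrite -exprMn; have := subrX1 (z / v) N; set S := \sum_(k < N) _ => SE.
have -> : (z / v) ^+ N = 1 + (z / v - 1) * S by rewrite -SE addrC subrK.
rewrite /cw -/v; rewrite /cU -/v in U0 *.
by field; rewrite v0 U0.
Qed.

Lemma cauchy_expand f z r M N : cdiffall f -> absC z < r ->
  (forall t, 0 <= t <= pi *+ 2 -> absC (f (r%:C * ei t)) <= M) ->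
  absC (cint (fun t => f (r%:C * ei t) * cw z r t) 0 (pi *+ 2) -
    'i * \sum_(k < N) fourier f r k * z ^+ k) <=
  2 * (M * (r / (r - absC z))) * (pi *+ 2) * (absC z / r) ^+ N.
Proof.
move=> hf zr HM; have r0 : 0 < r := le_lt_trans (absC_ge0 z) zr.
pose u k t := ('i * z ^+ k) * (f (r%:C * ei t) * (r%:C * ei t)^-1 ^+ k).
have cu k : ccont (fun t => f (r%:C * ei t) * (r%:C * ei t)^-1 ^+ k).
  by apply: ccontM; [exact: ccont_frei|exact: ccont_reiV].
have cuu k : ccont (u k) by apply: ccontM; [exact: ccont_cst|exact: cu].
pose E t := z ^+ N * (f (r%:C * ei t) * (r%:C * ei t)^-1 ^+ N * cw z r t).
have cE : ccont E.
  by apply: ccontM; [exact: ccont_cst|apply: ccontM; [exact: cu|exact: ccont_cw]].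
have -> : (fun t => f (r%:C * ei t) * cw z r t) =
    (fun t => \sum_(k < N) u k t + E t).
  apply: funext => t; rewrite {1}(cw_expand t N zr) mulrDr mulr_sumr.
  congr (_ + _); last by rewrite /E; ring.
  by apply: eq_bigr => k _; rewrite /u; ring.
have [S1 S2] := cint_psum N 0 (pi *+ 2) cuu.
rewrite cintD // S1 mulr_sumr.
have -> : \sum_(k < N) 'i * (fourier f r k * z ^+ k) =
   \sum_(k < N) cint (u k) 0 (pi *+ 2).
  apply: eq_bigr => k _; rewrite /u cintZ; last exact: cu.
  by rewrite /fourier; ring.
rewrite addrC addKr.
have P0 : 0 <= pi *+ 2 :> R by rewrite mulrn_wge0 // pi_ge0.
have -> : 2 * (M * (r / (r - absC z))) * (pi *+ 2) * (absC z / r) ^+ N =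
  2 * ((absC z / r) ^+ N * (M * (r / (r - absC z)))) * (pi *+ 2 - 0) by ring.
apply: cint_bound => // t /HM tM.
have -> : E t = (z * (r%:C * ei t)^-1) ^+ N * (f (r%:C * ei t) * cw z r t).
  by rewrite /E exprMn; ring.
rewrite absCM absCX absCM absCV (absC_rei zr).
apply: ler_wpM2l; first by rewrite exprn_ge0 // divr_ge0 ?absC_ge0 // ltW.
by rewrite absCM ler_pM ?absC_ge0 ?cw_le.
Qed.

(** This is [cauchy_expand] for the constant function 1, where only the coefficient of index 0 is
    nonzero; the remainder tends to 0. *)
Lemma cint_cw z r : absC z < r -> cint (cw z r) 0 (pi *+ 2) = 'i * (pi *+ 2)%:C.
Proof.
move=> zr; have r0 : 0 < r := le_lt_trans (absC_ge0 z) zr.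
apply/eqP; rewrite -subr_eq0 -absC_eq0 eq_le absC_ge0 andbT.
apply/ler_addgt0Pr => e e0; rewrite add0r.
have q0 : 0 <= absC z / r by rewrite divr_ge0 ?absC_ge0 // ltW.
have q1 : absC z / r < 1 by rewrite ltr_pdivrMr // mul1r.
have [N HN] := geometric_small (2 * (1 * (r / (r - absC z))) * (pi *+ 2)) q0 q1 e0.
have h1 : cdiffall (fun=> 1) by move=> x; exists 0; exact: cdiff_cst.
have hM t : 0 <= t <= pi *+ 2 -> absC ((fun=> 1) (r%:C * ei t) : R[i]) <= 1.
  by rewrite absC1.
have := cauchy_expand N.+1 h1 zr hM.
have -> : (fun t => 1 * cw z r t) = cw z r by apply: funext => t; rewrite mul1r.
have F k : fourier (fun=> 1) r k = if k == 0%N then (pi *+ 2)%:C else 0.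
  have E1 : (fun t => (1 : R[i]) * (r%:C * ei t)^-1 ^+ k) =
      (fun t => (r%:C^-1) ^+ k * (ei t)^-1 ^+ k).
    by apply: funext => t; rewrite mul1r invfM exprMn.
  have ceV : ccont (fun t => (ei t)^-1 ^+ k).
    have -> : (fun t => (ei t)^-1 ^+ k) = (fun t => (1%:C * ei t)^-1 ^+ k).
      by apply: funext => t; rewrite mul1r.
    exact: ccont_reiV.
  by rewrite /fourier E1 (cintZ _ _ _ ceV) ei_powV_cint; case: (k) => [|j] /=; rewrite ?expr0 ?mul1r ?mulr0.
rewrite big_ord_recl F /= expr0 mulr1 big1 ?addr0; last first.
  by move=> k _; rewrite F /= mul0r.
by move/le_trans; apply; exact: HN.
Qed.

Lemma cauchy_disc f r : cdiffall f -> 0 < r -> exists (a : nat -> R[i]) (M : R),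
  (forall k, absC (a k) * r ^+ k <= M) /\
  forall z N, absC z < r ->
    absC (f z - psum a N z) <= M * (r / (r - absC z)) * (absC z / r) ^+ N.
Proof.
move=> hf r0; set P : R := pi *+ 2.
have P0 : 0 < P by rewrite /P mulrn_wgt0 // pi_gt0.
have [M HM] := ccont_bounded (ltW P0) (ccont_frei r hf).
have M0 : 0 <= M.
  by apply: le_trans (HM 0 _); rewrite ?absC_ge0 // lexx ltW.
pose a k := P%:C^-1 * fourier f r k.
have aP : absC (P%:C^-1 : R[i]) = P^-1 by rewrite absCV absC_real gtr0_norm.
exists a, (2 * M); split.
  move=> k; rewrite /a absCM aP -mulrA ler_pdivrMl //.
  have -> : absC (fourier f r k) * r ^+ k =
      absC (r%:C ^+ k * fourier f r k).
    by rewrite absCM absCX absC_real gtr0_norm // mulrC.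
  rewrite /fourier -cintZ; last first.
    by apply: ccontM; [exact: ccont_frei|exact: ccont_reiV].
  have -> : P * (2 * M) = 2 * M * (P - 0) by ring.
  apply: cint_bound; first exact: ltW.
    apply: ccontM; first exact: ccont_cst.
    by apply: ccontM; [exact: ccont_frei|exact: ccont_reiV].
  move=> t /HM tM; rewrite mulrCA absCM -exprMn absCX.
  have -> : absC (r%:C * (r%:C * ei t)^-1 : R[i]) = 1.
    rewrite absCM absCV absCM absC_ei mulr1 absC_real gtr0_norm // mulfV //.
    by rewrite gt_eqF.
  by rewrite expr1n mulr1.
move=> z N zr; have := cauchy_expand N hf zr HM.
rewrite cauchy_kernel // cint_cw // -/P.
have -> : f z * ('i * P%:C) - 'i * (\sum_(k < N) fourier f r k * z ^+ k) =
  'i * P%:C * (f z - psum a N z).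
  have -> : psum a N z = P%:C^-1 * \sum_(k < N) fourier f r k * z ^+ k.
    by rewrite /psum mulr_sumr; apply: eq_bigr => k _; rewrite /a mulrA.
  have : (P%:C : R[i]) != 0 by rewrite -absC_gt0 absC_real normr_gt0 gt_eqF.
  by move: (P%:C : R[i]) => p p0; field.
rewrite absCM absCM absCi mul1r absC_real gtr0_norm //.
have -> : 2 * (M * (r / (r - absC z))) * P * (absC z / r) ^+ N =
  P * (2 * M * (r / (r - absC z)) * (absC z / r) ^+ N) by ring.
by rewrite ler_pM2l.
Qed.

(** Each radius r yields its own coefficients. Those for r and for 1 coincide: both partial sums
    tend to f uniformly on |z| = 1/2, and [psum_cauchy] applied to their difference makes it vanish.
    The coefficient bounds at all radii then give [ESeq]. *)
Theorem taylor f : entire f -> exists a : nat -> R[i], ESeq a /\ f =1 PS a.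
Proof.
move=> /entire_cdiff hf.
have [a [M [aM Ha]]] := cauchy_disc hf ltr01.
have key r : 1 <= r -> exists M', (forall k, absC (a k) * r ^+ k <= M') /\
  forall z N, absC z < r ->
    absC (f z - psum a N z) <= M' * (r / (r - absC z)) * (absC z / r) ^+ N.
  move=> r1; have r0 : 0 < r := lt_le_trans ltr01 r1.
  have [b [M' [bM Hb]]] := cauchy_disc hf r0.
  suff ab : a = b by exists M'; rewrite ab.
  apply: funext => k; apply/eqP; rewrite -subr_eq0 -absC_eq0 eq_le absC_ge0 andbT.
  have h0 : 0 < (2^-1 : R) ^+ k by rewrite exprn_gt0 // invr_gt0.
  rewrite -(ler_pM2r h0) mul0r; apply/ler_addgt0Pr => e e0; rewrite add0r.
  have e2 : 0 < e / 2 by rewrite divr_gt0.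
  have hr : 2^-1 < r by apply: lt_le_trans r1; rewrite invf_lt1 // ltr1n.
  have h1 : 2^-1 < 1 :> R by rewrite invf_lt1 // ltr1n.
  have [|||N1 HN1] := @geometric_small (2^-1 / 1) (M * (1 / (1 - 2^-1))) (e / 2).
  - by rewrite divr_ge0 ?invr_ge0.
  - by rewrite divr1.
  - by [].
  have [|||N2 HN2] := @geometric_small (2^-1 / r) (M' * (r / (r - 2^-1))) (e / 2).
  - by rewrite divr_ge0 ?invr_ge0 // ltW.
  - by rewrite ltr_pdivrMr // mul1r.
  - by [].
  pose N := maxn k.+1 (maxn N1 N2).
  have kN : (k < N)%N by rewrite leq_maxl.
  have N1N : (N1 <= N)%N by rewrite leq_max leq_maxl orbT.
  have N2N : (N2 <= N)%N by rewrite leq_max leq_maxr orbT.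
  apply: (@psum_cauchy _ (fun k => a k - b k) N) => //.
  move=> z zh; have -> : psum (fun k => a k - b k) N z =
    (f z - psum b N z) - (f z - psum a N z).
    rewrite opprB addrC addrA subrK /psum -sumrB.
    by apply: eq_bigr => j _; rewrite mulrBl.
  apply: (le_trans (absCD _ _)); rewrite absCN [e]splitr; apply: lerD.
    by apply: (le_trans (Hb _ _ _)); rewrite zh //; exact: HN2.
  apply: (le_trans (Ha _ _ _)); rewrite zh //; exact: HN1.
have ha : ESeq a.
  move=> rho r0; have [|M' [H _]] := key (1 + rho); first by rewrite lerDl.
  exists M' => k; apply: le_trans (H k); rewrite ler_wpM2l ?absC_ge0 //.
  by rewrite lerXn2r ?nnegrE ?addr_ge0 // lerDr.
exists a; split=> // z; apply/esym/PS_uniq => // e e0.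
have [|M' [_ H]] := key (1 + absC z); first by rewrite lerDl absC_ge0.
have z1 : absC z < 1 + absC z by rewrite ltrDr.
have z0 : 0 < 1 + absC z by rewrite (le_lt_trans (absC_ge0 z)).
have [|||N HN] := @geometric_small (absC z / (1 + absC z))
  (M' * ((1 + absC z) / (1 + absC z - absC z))) e.
- by rewrite divr_ge0 ?absC_ge0 // ltW.
- by rewrite ltr_pdivrMr // mul1r.
- by [].
by exists N => n Nn; apply: (le_trans (H _ _ z1)); exact: HN.
Qed.

End Taylor.

(** * Entire functions with finitely many zeros *)

Section Zeros.
Context {R : realType}.
Implicit Types (f g : R[i] -> R[i]) (a q : nat -> R[i]) (z c : R[i]) (l : seq R[i]).

Lemma PS_eq0 a z : (forall k, a k = 0) -> PS a z = 0.
Proof.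
move=> a0; apply: PS_uniq => [rho _|e e0].
  by exists 0 => k; rewrite a0 absC0 mul0r.
exists 0%N => n _; rewrite /psum big1 ?subrr ?absC0 ?ltW // => k _.
by rewrite a0 mul0r.
Qed.

Lemma PS_finite a N z : (forall k, (N <= k)%N -> a k = 0) -> ESeq a ->
  PS a z = psum a N z.
Proof.
move=> aN ha; rewrite (PS_shift N) // PS_eq0 ?mulr0 ?addr0 // => k.
by rewrite aN // leq_addr.
Qed.

Lemma entire_shift f c : entire f -> entire (fun z => f (z + c)).
Proof.
move=> /entire_cdiff hf z; have [l hl] := hf (z + c).
exact: cdiff_derivable (cdiff_shift hl).
Qed.

(** [k] is the index of the first nonzero Taylor coefficient at [c]; k = 0 is allowed, so [c] need
    not be a zero. *)
Lemma factor_zero f c : entire f -> (exists z, f z != 0) ->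
  exists k g, [/\ entire g, g c != 0 & forall z, f z = (z - c) ^+ k * g z].
Proof.
move=> ef [z0 fz0]; have [b [hb fb]] := taylor (@entire_shift f c ef).
have fE z : f z = PS b (z - c) by rewrite -fb subrK.
have ex : exists k, b k != 0.
  apply: contrapT => H; move: fz0; rewrite fE PS_eq0 ?eqxx // => k.
  by apply/eqP; apply: contrapT => bk; apply: H; exists k; apply/negP.
case: (ex_minnP ex) => k bk kmin.
exists k, (fun z => PS (fun j => b (k + j)%N) (z - c)); split.
- by apply: (@entire_shift _ (- c)); apply: PS_entire; exact: ESeq_shift.
- by rewrite subrr PS0 ?addn0 //; exact: ESeq_shift.
- move=> z; rewrite fE (PS_shift k) // /psum big1 ?add0r // => j _.
  suff -> : b j = 0 by rewrite mul0r.
  by apply/eqP; apply: contraTT (ltn_ord j); rewrite -leqNgt; exact: kmin.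
Qed.

(** [s] only has to contain the zeros; the list [l] produced by peeling them off records the actual
    ones with multiplicity. *)
Lemma factor_zeros (s : seq R[i]) f : entire f -> (exists z, f z != 0) ->
  (forall z, f z = 0 -> z \in s) -> exists l g, [/\ entire g,
    forall z, g z != 0 & forall z, f z = (\prod_(c <- l) (z - c)) * g z].
Proof.
elim: s f => [|c s IH] f ef nf fs.
  exists [::], f; split=> // z; last by rewrite big_nil mul1r.
  by apply/eqP => /fs.
have [k [g [eg gc fg]]] := factor_zero c ef nf.
have [||l [h [eh h0 gh]]] := IH g eg; first by exists c.
  move=> z gz; have := fs z; rewrite fg gz mulr0 => /(_ erefl).
  by rewrite in_cons => /predU1P[zc|//]; move: gc; rewrite -zc gz eqxx.
exists (nseq k c ++ l), h; split=> // z.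
by rewrite big_cat /= fg gh mulrA; congr (_ * _ * _); rewrite big_nseq iter_mulr_1.
Qed.

(** A radius beyond which every factor z - c with c in [l] has modulus at least 1, so that dividing
    by their product does not increase the modulus. *)
Definition lroots l : R := 1 + \sum_(c <- l) absC c.

Lemma lroots_ge1 l : 1 <= lroots l.
Proof. by rewrite lerDl sumr_ge0 // => c _; exact: absC_ge0. Qed.

Lemma absC_prod l (F : R[i] -> R[i]) :
  absC (\prod_(c <- l) F c) = \prod_(c <- l) absC (F c).
Proof. by apply: (big_morph _ (@absCM R)); exact: absC1. Qed.

Lemma lroots_mem l c : c \in l -> 1 + absC c <= lroots l.
Proof.
move=> cl; rewrite lerD2l (big_rem c) //= lerDl sumr_ge0 // => x _.
exact: absC_ge0.
Qed.

Lemma prod_roots_ge l z : lroots l <= absC z -> 1 <= absC (\prod_(c <- l) (z - c)).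
Proof.
move=> lz; rewrite absC_prod big_seq; elim/big_ind: _ => //.
  by move=> x y x1 y1; rewrite -[leLHS]mul1r ler_pM.
move=> c /lroots_mem cl; apply: le_trans (absC_dist _ _).
by rewrite lerBrDr (le_trans cl).
Qed.

Lemma prod_roots_le l z :
  absC (\prod_(c <- l) (z - c)) <= (absC z + lroots l) ^+ size l.
Proof.
rewrite absC_prod; have -> : (absC z + lroots l) ^+ size l =
   \prod_(c <- l) (absC z + lroots l).
  by rewrite big_const_seq count_predT iter_mulr_1.
rewrite big_seq [leRHS]big_seq; apply: ler_prod => c /lroots_mem cl.
rewrite absC_ge0 /=; apply: (le_trans (absCD _ _)); rewrite absCN lerD2l.
by apply: le_trans cl; rewrite lerDr.
Qed.

(* The real part of a logarithm of [g]: a primitive of g'/g, whose value along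
   the segment [0, z] is compared with ln |g|. *)
Lemma log_modulus g : entire g -> (forall z, g z != 0) ->
  exists q, [/\ ESeq q, q 0%N = 0 & forall z,
    absC (g z) ^+ 2 = absC (g 0) ^+ 2 * expR (2 * complex.Re (PS q z))].
Proof.
move=> eg g0; have [b [hb gb]] := taylor eg.
have dg z : cdiff g z (PS (dseq b) z).
  by apply: cdiff_ext (PS_cdiff z hb) => x; rewrite gb.
have eh : entire (fun z => PS (dseq b) z * (g z)^-1).
  move=> z; have h1 := PS_cdiff z (ESeq_dseq hb).
  exact: cdiff_derivable (cdiffM h1 (cdiffV (g0 z) (dg z))).
have [d [hd hE]] := taylor eh.
(* Term-by-term primitive of g'/g, whose coefficients are [d], with constant term 0. *)
pose q k := if k is j.+1 then d j / j.+1%:R else 0.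
have hq : ESeq q.
  move=> rho r0; have [M M0 HM] := ESeq_bound hd r0.
  exists (M * rho) => -[|k] /=; first by rewrite absC0 mul0r mulr_ge0.
  rewrite exprSr mulrA ler_wpM2r //; apply: le_trans (HM k).
  rewrite ler_wpM2r ?exprn_ge0 // absCM absCV absC_nat ler_piMr ?absC_ge0 //.
  by rewrite invf_le1 // ler1n.
have dq : dseq q = d.
  apply: funext => k; rewrite /dseq /q mulrC divfK // pnatr_eq0 //.
exists q; split=> // z.
pose u t := g (t%:C * z); pose v t := PS q (t%:C * z).
have dtz t : cder (fun t => t%:C * z) t z.
  by have := cderM (cder_id t) (cder_cst z t); rewrite mulr0 addr0 mul1r.
have du t : cder u t (PS (dseq b) (t%:C * z) * z) by exact: cderf (dg _) (dtz t).
have dv t : cder v t (PS d (t%:C * z) * z).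
  by apply: cderf (dtz t); rewrite -dq; exact: PS_cdiff.
(* Along the segment u'/u = v', hence |u|^2 exp(-2 Re v) is constant; squared moduli avoid
   differentiating a square root. *)
pose E t := absC (u t) ^+ 2 * expR (- (2 * complex.Re (v t))).
have E0 (t : R) : is_derive t 1 E 0.
  have /cder_comp[u1 u2] := du t; have /cder_comp[v1 _] := dv t.
  pose N t := complex.Re (u t) * complex.Re (u t) +
    complex.Im (u t) * complex.Im (u t).
  have -> : E = (fun t => N t * expR (- 2 * complex.Re (v t))).
    by apply: funext => s; rewrite /E absC_sqr mulNr.
  have dN := is_deriveD (is_deriveM u1 u1) (is_deriveM u2 u2).
  have de := @is_derive1_comp _ expR (fun s => - 2 * complex.Re (v s)) t _ _
    (is_derive_expR _) (is_deriveZ (- 2) v1).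
  apply: (is_derive_eq (is_deriveM dN de)).
  have -> : PS (dseq b) (t%:C * z) * z = PS d (t%:C * z) * z * u t.
    by rewrite -hE /u; field; exact: g0.
  rewrite -[X in X *: _]/(N t) /N; move: (PS d _ * z) (u t) => X Y.
  rewrite !ReM !ImM; set e := expR _; rewrite [X in _ + X *: _](_ : _ = e) //.
  by rewrite /GRing.scale /=; ring.
have := is_derive_0_is_cst 1 0 E0; rewrite /E /u /v !mul0r !mul1r PS0 //= mulr0.
rewrite oppr0 expR0 mulr1 => <-.
by rewrite -mulrA -expRD addNr expR0 mulr1.
Qed.

(** On |z| = rho Borel-Caratheodory gives |q k| rho^k <= B rho^m, which fails for large rho because
    m < k. *)
Lemma coef_vanish q (m rho0 c1 A : R) k : ESeq q -> q 0%N = 0 -> 0 < m ->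
  m < k%:R ->
  (forall z, rho0 <= absC z -> complex.Re (PS q z) <= c1 + A * absC z `^ m) ->
  q k = 0.
Proof.
move=> hq q0 m0 mk H; apply/eqP; rewrite -absC_eq0; apply/negPn/negP => qk0.
set x := absC (q k); have x0 : 0 < x by rewrite lt_def qk0 absC_ge0.
set B := 2 * (`|c1| + `|A|).
have B0 : 0 <= B by rewrite mulr_ge0 // addr_ge0.
(* Chosen so that w^(k - m) = B / x + 1, above the bound B / x that the estimate will impose. *)
set w := (B / x + 1) `^ (k%:R - m)^-1.
set rho := Num.max (Num.max rho0 1) w.
have rr0 : rho0 <= rho by rewrite !le_max lexx.
have r1 : 1 <= rho by rewrite !le_max lexx orbT.
have rw : w <= rho by rewrite le_max lexx orbT.
have r0 : 0 < rho := lt_le_trans ltr01 r1.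
have km : 0 < k%:R - m by rewrite subr_gt0.
have k0 : (0 < k)%N by rewrite -(ltr_nat R) (lt_trans m0).
have rm1 : 1 <= rho `^ m by rewrite -(powRr0 rho) ler_powR // ltW.
have : x * rho ^+ k <= B * rho `^ m.
  apply: (@le_trans _ _ (2 * (c1 + A * rho `^ m - complex.Re (q 0%N)))).
    apply: PS_borel_caratheodory => //; first exact: ltW.
    by move=> z zr; rewrite -zr; apply: H; rewrite zr.
  rewrite q0 /= subr0 -mulrA ler_pM2l // mulrDl; apply: lerD.
    by apply: (le_trans (ler_norm _)); rewrite ler_peMr.
  by rewrite ler_wpM2r ?ler_norm // powR_ge0.
have -> : rho ^+ k = rho `^ (k%:R - m) * rho `^ m.
  by rewrite -powRD ?(gt_eqF r0) ?implybT // subrK powR_mulrn // ltW.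
rewrite mulrA ler_pM2r ?powR_gt0 // => xB.
have : B / x + 1 <= rho `^ (k%:R - m).
  have -> : B / x + 1 = w `^ (k%:R - m).
    by rewrite /w -powRrM mulVf ?gt_eqF // powRr1 // addr_ge0 // divr_ge0 // ltW.
  by rewrite ge0_ler_powR ?nnegrE ?powR_ge0 // ltW.
have : rho `^ (k%:R - m) <= B / x by rewrite ler_pdivlMr // mulrC.
by move=> h1 h2; have := le_trans h2 h1; rewrite gerDl ler10.
Qed.

Lemma absC_psum_le q N z : 1 <= absC z ->
  absC (psum q N.+1 z) <= (\sum_(k < N.+1) absC (q k)) * absC z ^+ N.
Proof.
move=> z1; apply: (le_trans (absC_sum _ _ _)); rewrite mulr_suml.
apply: ler_sum => k _; rewrite absCM absCX ler_wpM2l ?absC_ge0 //.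
by rewrite ler_weXn2l // -ltnS.
Qed.

Lemma log_growth (c0 c1 dl : R) : 0 < dl ->
  ~ (forall k : nat, (0 < k)%N -> k%:R * dl * ln k%:R <= c0 * k%:R + c1 * ln k%:R).
Proof.
move=> dl0 H.
set C := `|c0| + `|c1|.
have [k kC] : exists k : nat, expR (C / dl) < k%:R.
  by exists (Num.truncn (expR (C / dl))).+1; exact: truncnS_gt.
have k0 : 0 < k%:R :> R := lt_trans (expR_gt0 _) kC.
have kn : (0 < k)%N by rewrite -(ltr_nat R).
have lk : C / dl < ln k%:R.
  by rewrite -(expRK (C / dl)) ltr_ln ?posrE ?expR_gt0.
have lk0 : 0 <= ln k%:R :> R by rewrite ln_ge0 // ler1n.
have lkk : ln k%:R <= k%:R :> R.
  by have := expR_ge1Dx (ln k%:R : R); rewrite lnK ?posrE //; lra.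
have h1 : c1 * ln k%:R <= `|c1| * k%:R.
  apply: (@le_trans _ _ (`|c1| * ln k%:R)); first by rewrite ler_wpM2r ?ler_norm.
  by rewrite ler_wpM2l.
have h2 : c0 * k%:R <= `|c0| * k%:R by rewrite ler_wpM2r ?ler_norm // ltW.
have := le_trans (H k kn) (lerD h2 h1); rewrite -mulrDl -/C mulrAC -mulrA mulrC.
rewrite ler_pM2r // leNgt => /negP; apply.
by rewrite -ltr_pdivrMr.
Qed.

(** The growth bound on values and the lower bound on coefficients together say that the order of
    growth is exactly [m]; finitely many zeros would make the order an integer. *)
Theorem infinite_zeros a (m C A D K : R) : ESeq a -> 0 < m ->
  m \isn't a Num.int ->
  (forall z, absC (PS a z) <= C * expR (A * absC z `^ m)) ->
  0 < D -> 0 < K ->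
  (forall k, (0 < k)%N -> D * (K * k%:R) `^ (- (k%:R / m)) <= absC (a k)) ->
  infinite_set [set z | PS a z = 0].
Proof.
move=> ha m0 mZ grow D0 K0 low /finite_seqP[s sE].
have nz : exists z, PS a z != 0.
  apply: contrapT => H; have a1 : absC (a 1%N) * 1 ^+ 1 <= 0.
    apply: PS_cauchy => // z _; suff -> : PS a z = 0 by rewrite absC0.
    by apply/eqP/negPn/negP => h; apply: H; exists z.
  have := low 1%N isT; rewrite leNgt => /negP; apply.
  apply: (@le_lt_trans _ _ 0); first by rewrite expr1n mulr1 in a1.
  by rewrite mulr_gt0 // powR_gt0 // mulr_gt0.
have [|l [g [eg g0 fg]]] := factor_zeros (s := s) (PS_entire ha) nz.
  move=> z /= fz; have : [set z | PS a z = 0] z by [].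
  by rewrite sE.
have [q [hq q0 gE]] := log_modulus eg g0.
have C0 : 0 < C.
  have [z z0] := nz; have := grow z; rewrite -(absC_gt0 (PS a z)) in z0.
  by move/(lt_le_trans z0); rewrite pmulr_lgt0 // expR_gt0.
have G0 : 0 < absC (g 0) by rewrite absC_gt0.
have reQ z : lroots l <= absC z ->
    complex.Re (PS q z) <= (ln C - ln (absC (g 0))) + A * absC z `^ m.
  move=> lz; have gC : absC (g z) <= C * expR (A * absC z `^ m).
    apply: le_trans (grow z); rewrite fg absCM ler_peMl ?absC_ge0 //.
    exact: prod_roots_ge.
  have := gE z; move/(congr1 (@ln R)); rewrite lnM ?posrE ?exprn_gt0 ?expR_gt0 //.
  rewrite expRK !lnXn ?absC_gt0 // => lnE.
  have lng : ln (absC (g z)) <= ln C + A * absC z `^ m.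
    rewrite -[X in _ + X]expRK -lnM ?posrE ?expR_gt0 //.
    by rewrite ler_ln ?posrE ?absC_gt0 // mulr_gt0 ?expR_gt0.
  by move: lnE lng; lra.
set n0 := Num.truncn m.
(* Non-integrality enters here: floor(m) is strictly below [m], so a polynomial Q of degree at most
   m has degree strictly less than m. *)
have n0m : n0%:R < m.
  have /andP[h _] := truncn_itv (ltW m0).
  rewrite lt_neqAle h andbT; apply: contraNneq mZ => <-.
  exact: rpred_nat.
have qv k : (n0.+1 <= k)%N -> q k = 0.
  move=> nk; apply: coef_vanish hq q0 m0 _ reQ.
  by apply: lt_le_trans (truncnS_gt m) _; rewrite ler_nat.
(* A midpoint rather than [n0] itself, because [n0] may be 0 and 1 / d is needed below. *)
set d := (n0%:R + m) / 2.
have dm : d < m by rewrite ltr_pdivrMr // mulr_natr mulr2n ltrD2r.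
have nd : n0%:R <= d by rewrite ler_pdivlMr // mulr_natr mulr2n lerD2l ltW.
have d0 : 0 < d by rewrite divr_gt0 // ltr_wpDl.
set B := \sum_(k < n0.+1) absC (q k).
have B0 : 0 <= B by apply: sumr_ge0 => k _; exact: absC_ge0.
have gle z : 1 <= absC z -> absC (g z) <= absC (g 0) * expR (B * absC z `^ d).
  move=> z1; rewrite -(ler_pXn2r (_ : (0 < 2)%N)) ?nnegrE ?mulr_ge0 ?expR_ge0 ?absC_ge0 //.
  rewrite gE exprMn ler_wpM2l ?exprn_ge0 ?absC_ge0 // -expRM_natl ler_expR.
  rewrite ler_pM2l // (PS_finite z qv hq); apply: (le_trans (ler_norm _)).
  apply: (le_trans (absC_Re _)); apply: (le_trans (absC_psum_le q n0 z1)).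
  by rewrite ler_wpM2l // -powR_mulrn ?absC_ge0 // ler_powR.
set L := lroots l; have L1 : 1 <= L := lroots_ge1 l.
set p := size l.
have up k x : 1 <= x -> absC (a k) * x ^+ k <=
    ((1 + L) * x) ^+ p * (absC (g 0) * expR (B * x `^ d)).
  move=> x1; have x0 : 0 <= x := le_trans ler01 x1.
  apply: PS_cauchy => // z zx; rewrite fg absCM ler_pM ?absC_ge0 //; last first.
    by rewrite -zx gle // zx.
  apply: (le_trans (prod_roots_le l z)); rewrite zx.
  have L0 : 0 <= L := le_trans ler01 L1.
  have h1 : x + L <= (1 + L) * x by rewrite mulrDl mul1r lerD2l ler_peMr.
  have h0 : 0 <= x + L := addr_ge0 x0 L0.
  by rewrite lerXn2r // nnegrE (le_trans h0).
pose dl := d^-1 - m^-1.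
have dl0 : 0 < dl by rewrite subr_gt0 ltf_pV2.
(* After taking logarithms, [c0] gathers the terms of order k and p / d is the coefficient of ln k;
   the constant terms are absorbed into an absolute value times k, as k >= 1. *)
pose c0 := m^-1 * ln K + `|p%:R * ln (1 + L) + ln (absC (g 0)) - ln D| + B.
apply: (@log_growth c0 (p%:R / d) dl dl0) => k k0.
have kR : 0 < k%:R :> R by rewrite ltr0n.
have k1 : 1 <= k%:R :> R by rewrite ler1n.
(* The radius that balances x^k against exp(B x^d): x^d = k, so the exponential contributes only
   exp(B k), while x^k = k^(k/d). *)
pose x := k%:R `^ d^-1.
have x1 : 1 <= x by rewrite -(powRr0 (k%:R)) ler_powR // invr_ge0 ltW.
have x0 : 0 < x := lt_le_trans ltr01 x1.
have xd : x `^ d = k%:R by rewrite -powRrM mulVf ?gt_eqF // powRr1 // ltW.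
have lnx : ln x = d^-1 * ln k%:R by rewrite ln_powR.
have L10 : 0 < 1 + L by rewrite ltr_pwDl // (le_trans ler01).
have h : D * (K * k%:R) `^ (- (k%:R / m)) * x ^+ k <=
    ((1 + L) * x) ^+ p * (absC (g 0) * expR (B * x `^ d)).
  apply: le_trans (up k x x1); rewrite ler_wpM2r ?exprn_ge0 ?low //.
  exact: ltW.
have KK : 0 < K * k%:R by rewrite mulr_gt0.
have pos1 : 0 < D * (K * k%:R) `^ (- (k%:R / m)) * x ^+ k.
  by rewrite !mulr_gt0 ?powR_gt0 ?exprn_gt0.
have pos2 : 0 < ((1 + L) * x) ^+ p * (absC (g 0) * expR (B * x `^ d)).
  by rewrite !mulr_gt0 ?exprn_gt0 ?mulr_gt0 ?expR_gt0.
move: h; rewrite -ler_ln ?posrE // xd.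
rewrite !lnM ?posrE ?powR_gt0 ?exprn_gt0 ?mulr_gt0 ?powR_gt0 ?expR_gt0 ?exprn_gt0 ?mulr_gt0 //.
rewrite !lnXn ?mulr_gt0 // ln_powR expRK !lnM ?posrE // lnx -(mulr_natl _ k) -(mulr_natl _ p).
set kk : R := k%:R in kR k1 *; set lk : R := ln kk.
set P : R := p%:R; rewrite /c0 /dl -/P.
set Y := P * ln (1 + L) + ln (absC (g 0)) - ln D => h.
have hY : Y <= `|Y| * kk by apply: (le_trans (ler_norm _)); rewrite ler_peMr.
rewrite mulrBr mulrBl; move: h hY; rewrite /Y.
set lK := ln K; set di := d^-1; set mi := m^-1.
set y := `|_|.
by move=> h hY; lra.
Qed.

End Zeros.

(** * Rotation invariance of the area measure *)

Section Rotation.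
Context {R : realType}.
Local Notation mR := (measurableTypeR R).
Local Notation mu := (@lebesgue_measure R).
Local Notation ar := (mu \x mu)%E.
Local Open Scope ereal_scope.
Implicit Types (f : mR * mR -> \bar R) (c t : R).

Lemma measurable_addr c : measurable_fun [set: mR] (fun x : R => (x + c)%R : mR).
Proof. by apply: measurable_funD => //; exact: measurable_cst. Qed.

Lemma lebesgue_translation c (A : set mR) : measurable A ->
  pushforward mu (fun x : R => (x + c)%R : mR) A = mu A.
Proof.
move=> mA; apply/esym/lebesgue_measure_unique => //=.
  exact: measurable_addr.
move=> _ _ [[a b]] _ <-.
rewrite /pushforward.
have -> : (fun x : R => (x + c)%R) @^-1` `]a, b] = `](a - c)%R, (b - c)%R]%classic.
  by apply/seteqP; split => x /=; rewrite !in_itv /= ltrBlDr lerBrDr.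
rewrite !lebesgue_measure_itv /= !lte_fin ltrD2r; case: ifP => // _.
by rewrite -!EFinD; congr EFin; ring.
Qed.

Lemma ge0_integral_translation (g : mR -> \bar R) c :
  measurable_fun setT g -> (forall x, 0 <= g x) ->
  \int[mu]_x g (x + c)%R = \int[mu]_x g x.
Proof.
move=> mg g0.
have /= <- := @ge0_integral_pushforward _ _ _ _ _ _ (measurable_addr c) mu setT g
  measurableT mg (fun x _ => g0 x).
apply: eq_measure_integral => //=; first exact: measurable_addr.
by move=> ? A mA _; exact: lebesgue_translation.
Qed.

Definition shear1 t (p : mR * mR) : mR * mR := (p.1 + t * p.2, p.2)%R.
Definition shear2 t (p : mR * mR) : mR * mR := (p.1, p.2 + t * p.1)%R.

Lemma measurable_shear1 t : measurable_fun setT (shear1 t).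
Proof.
apply/measurable_fun_pairP; split => /=; last exact: measurable_snd.
apply: measurable_funD; first exact: measurable_fst.
by apply: measurable_funM; [exact: measurable_cst|exact: measurable_snd].
Qed.

Lemma measurable_shear2 t : measurable_fun setT (shear2 t).
Proof.
apply/measurable_fun_pairP; split => /=; first exact: measurable_fst.
apply: measurable_funD; first exact: measurable_snd.
by apply: measurable_funM; [exact: measurable_cst|exact: measurable_fst].
Qed.

(** With the second coordinate fixed, a shear translates the first one, so Tonelli with the first
    variable innermost reduces the claim to translation invariance. *)
Lemma ge0_integral_shear1 t f : measurable_fun setT f -> (forall p, 0 <= f p) ->
  \int[ar]_p f (shear1 t p) = \int[ar]_p f p.
Proof.
move=> mf f0.
have mfs : measurable_fun setT (fun p => f (shear1 t p)).
  by apply: measurableT_comp mf _; exact: measurable_shear1.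
rewrite (@fubini_tonelli2 _ _ _ _ _ mu mu _ mfs) //.
rewrite (@fubini_tonelli2 _ _ _ _ _ mu mu _ mf) //.
apply: eq_integral => y _; rewrite /fubini_G /shear1 /=.
apply: (@ge0_integral_translation (fun x => f (x, y))) => //.
by exact: measurable_fun_pair1.
Qed.

Lemma ge0_integral_shear2 t f : measurable_fun setT f -> (forall p, 0 <= f p) ->
  \int[ar]_p f (shear2 t p) = \int[ar]_p f p.
Proof.
move=> mf f0.
have mfs : measurable_fun setT (fun p => f (shear2 t p)).
  by apply: measurableT_comp mf _; exact: measurable_shear2.
rewrite (@fubini_tonelli1 _ _ _ _ _ mu mu _ mfs) //.
rewrite (@fubini_tonelli1 _ _ _ _ _ mu mu _ mf) //.
apply: eq_integral => x _; rewrite /fubini_F /shear2 /=.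
apply: (@ge0_integral_translation (fun y => f (x, y))) => //.
by exact: measurable_fun_pair2.
Qed.

Definition rotp (w : R[i]) (p : mR * mR) : mR * mR :=
  (complex.Re w * p.1 - complex.Im w * p.2,
   complex.Re w * p.2 + complex.Im w * p.1)%R.

Lemma planeC_rotp w p : planeC (rotp w p) = (w * planeC p)%R.
Proof. by case: w => a b; case: p => x y; rewrite /rotp /planeC; simpc. Qed.

(* A rotation other than the half-turn is a product of three shears. *)
Lemma rotp_shear w : absC w = 1%R -> w != (-1)%R ->
  let t := (- (complex.Im w / (1 + complex.Re w)))%R in
  rotp w = shear1 t \o shear2 (complex.Im w) \o shear1 t.
Proof.
move=> w1 wN1 t; have := absC_sqr w; rewrite w1 expr1n.
case: w w1 wN1 @t => a b /= w1 wN1; set t := (- _)%R => ab.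
have a1 : (1 + a != 0)%R.
  apply: contraNneq wN1 => a0; have aN : a = (-1)%R by lra.
  move: ab; rewrite aN sqrrN expr1n => /esym/eqP.
  by rewrite -subr_eq0 addrAC subrr add0r sqrf_eq0 => /eqP ->; rewrite eq_complex /= oppr0 !eqxx.
have b2 : (b ^+ 2 = (1 + a) * (1 - a))%R by rewrite -[RHS]addr0; lra.
(* [t] is minus the tangent of half the angle; [tb] and [tt] identify the entries of the product of
   the three shears. *)
have tb : (1 + t * b = a)%R.
  rewrite /t; apply: (mulfI a1); rewrite mulrDr mulr1 mulNr mulrN mulrA.
  by rewrite mulrCA mulrA mulfK // -expr2 b2; ring.
have tt : (t * (1 + a) = - b)%R by rewrite /t mulNr divfK.
apply: funext => -[x y]; rewrite /rotp /shear1 /shear2 /=; congr pair; last first.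
  by rewrite -tb; ring.
have -> : (x + t * y + t * (y + b * (x + t * y)) = (1 + t * b) * x + (t * (1 + (1 + t * b))) * y)%R.
  by ring.
by rewrite tb tt; ring.
Qed.

Lemma ge0_integral_rotp w f : absC w = 1%R -> w != (-1)%R ->
  measurable_fun setT f -> (forall p, 0 <= f p) ->
  \int[ar]_p f (rotp w p) = \int[ar]_p f p.
Proof.
move=> w1 wN1 mf f0; rewrite (rotp_shear w1 wN1) /=; set t := (- _)%R.
pose g p := f (shear1 t p); pose h p := g (shear2 (complex.Im w) p).
have mg : measurable_fun setT g by apply: measurableT_comp mf _; exact: measurable_shear1.
have mh : measurable_fun setT h by apply: measurableT_comp mg _; exact: measurable_shear2.
transitivity (\int[ar]_p h p); first exact: (ge0_integral_shear1 t mh (fun p => f0 _)).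
transitivity (\int[ar]_p g p); first exact: (ge0_integral_shear2 _ mg (fun p => f0 _)).
exact: ge0_integral_shear1.
Qed.

Lemma integral_rotp w f : absC w = 1%R -> w != (-1)%R ->
  measurable_fun setT f ->
  \int[ar]_p f (rotp w p) = \int[ar]_p f p.
Proof.
move=> w1 wN1 mf; rewrite [LHS]integralE [RHS]integralE; congr (_ - _).
  rewrite -[RHS](@ge0_integral_rotp w _ w1 wN1 (measurable_funepos mf)) //.
  by apply: eq_integral => p _; rewrite !funeposE.
rewrite -[RHS](@ge0_integral_rotp w _ w1 wN1 (measurable_funeneg mf)) //.
by apply: eq_integral => p _; rewrite !funenegE.
Qed.

End Rotation.

(** * Integrability of radial weights *)

Section WeightIntegrable.
Context {R : realType}.
Local Notation mR := (measurableTypeR R).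
Local Notation mu := (@lebesgue_measure R).
Local Notation ar := (mu \x mu)%E.
Implicit Types (p : mR * mR) (n b m r : R).

Lemma measurable_absC_plane :
  measurable_fun [set: mR * mR] (fun p => absC (planeC p) : R).
Proof.
have -> : (fun p => absC (planeC p) : R) =
    (fun x => x `^ 2^-1) \o (fun p : mR * mR => p.1 ^+ 2 + p.2 ^+ 2).
  by apply: funext => -[x y] /=; rewrite absC_sqrt /= powR12_sqrt // addr_ge0 // sqr_ge0.
apply: measurableT_comp; first exact: measurable_powR.
by apply: measurable_funD; apply: measurable_funX;
  [exact: measurable_fst|exact: measurable_snd].
Qed.

(** [W] without its constant factor and with a free coefficient [b]: later estimates spend half of
    [alpha] and integrate what is left. *)
Definition radial n b m (z : R[i]) : R :=
  absC z `^ n * expR (- (b * absC z `^ (2 * m))).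

Lemma radial_ge0 n b m z : 0 <= radial n b m z.
Proof. by rewrite mulr_ge0 ?powR_ge0 ?expR_ge0. Qed.

Lemma measurable_radial n b m :
  measurable_fun [set: mR * mR] (fun p => radial n b m (planeC p) : R).
Proof.
apply: measurable_funM.
  by apply: (measurableT_comp (measurable_powR n)); exact: measurable_absC_plane.
apply: measurableT_comp; first exact: measurable_expR.
apply: measurable_funN; apply: measurable_funM; first exact: measurable_cst.
by apply: (measurableT_comp (measurable_powR _)); exact: measurable_absC_plane.
Qed.

Definition box r : set (mR * mR) := `[- r, r]%classic `*` `[- r, r]%classic.

Lemma measurable_box r : measurable (box r).
Proof. exact: measurableX. Qed.

Lemma area_box r : 0 <= r -> (ar (box r) = (4 * r ^+ 2)%:E)%E.
Proof.
rewrite le_eqVlt => /predU1P[<-|r0].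
  rewrite product_measure1E //= !lebesgue_measure_itv /= lte_fin oppr0 ltxx mul0e.
  by rewrite expr0n mulr0.
rewrite product_measure1E //= !lebesgue_measure_itv /= lte_fin.
have -> : - r < r by rewrite (lt_trans _ r0) // oppr_lt0.
by rewrite -EFinD -EFinM; congr EFin; ring.
Qed.

Lemma integral_box r : 0 <= r ->
  (\int[ar]_p (\1_(box r) p)%:E = (4 * r ^+ 2)%:E)%E.
Proof.
move=> r0; rewrite integral_indic //; last exact: measurable_box.
by rewrite setIT; exact: area_box.
Qed.

Lemma in_box p r : absC (planeC p) <= r -> box r p.
Proof.
move=> pr; split; rewrite /= in_itv /= -ler_norml; apply: le_trans pr.
  exact: (absC_Re (planeC p)).
exact: (absC_Im (planeC p)).
Qed.

Lemma dyadic (y : R) : 1 <= y -> exists j, 2 ^+ j <= y < 2 ^+ j.+1.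
Proof.
move=> y1; have y0 : 0 <= y := le_trans ler01 y1.
have /andP[t1 t2] := truncn_itv y0.
have t0 : (0 < Num.truncn y)%N by rewrite truncn_gt0.
have /andP[l1 l2] := @trunc_log_bounds 2 (Num.truncn y) isT t0.
exists (trunc_log 2 (Num.truncn y)); rewrite -!natrX; apply/andP; split.
  by apply: le_trans t1; rewrite ler_nat.
by apply: lt_le_trans t2 _; rewrite ler_nat.
Qed.

(** The power y^4 outweighs the area, of order y^2, of the dyadic squares used below and leaves a
    convergent series. *)
Lemma exp_decay n b m : 0 < b -> 0 < m -> exists2 C, 0 <= C & forall y, 1 <= y ->
  y `^ n * expR (- (b * y `^ (2 * m))) * y ^+ 4 <= C.
Proof.
(* Large enough that y^(n + 4) <= (y^(2 m))^(N + 1) for y >= 1, a power that a single term of the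
   exponential series controls. *)
move=> b0 m0; set N := Num.truncn (`|n + 4| / (2 * m)).
have N1 : n + 4 <= 2 * m * N.+1%:R.
  apply: (le_trans (ler_norm _)); rewrite mulrC -ler_pdivrMr ?mulr_gt0 //.
  exact/ltW/truncnS_gt.
exists ((N.+1)`!%:R / b ^+ N.+1); first by rewrite divr_ge0 // exprn_ge0 // ltW.
move=> y y1; have y0 : 0 < y := lt_le_trans ltr01 y1.
set x := b * y `^ (2 * m).
have x0 : 0 < x by rewrite mulr_gt0 // powR_gt0.
have yn : y `^ n * y ^+ 4 <= y `^ (2 * m) ^+ N.+1.
  rewrite -[y ^+ 4]powR_mulrn ?(ltW y0) // -powRD ?(gt_eqF y0) ?implybT //.
  by rewrite -powR_mulrn ?powR_ge0 // -powRrM ler_powR.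
have ex : x ^+ N.+1 / (N.+1)`!%:R <= expR x.
  by apply: le_trans (expR_ge1Dxn N (ltW x0)); rewrite lerDr.
rewrite mulrAC expRN ler_pdivrMr ?expR_gt0 //; apply: (le_trans yn).
rewrite mulrAC ler_pdivlMr ?exprn_gt0 // -exprMn mulrC -/x.
by move: ex; rewrite ler_pdivrMr ?ltr0n ?fact_gt0 // mulrC.
Qed.

Lemma geometric_sum_le (q : R) N : 0 <= q -> q < 1 ->
  \sum_(0 <= j < N) q ^+ j <= (1 - q)^-1.
Proof.
move=> q0 q1; have d0 : 0 < 1 - q by rewrite subr_gt0.
rewrite -div1r ler_pdivlMr // mulrC big_mkord.
have := subrX1 q N; move/(congr1 -%R); rewrite -mulNr !opprB => <-.
by rewrite gerBl exprn_ge0.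
Qed.

(** In place of polar coordinates, the integrand is dominated by a series of multiples of indicators
    of dyadic squares, shrinking to the origin for |z| <= 1 and growing outside. The condition n >
    -2 makes the inner series converge. *)
Lemma radial_integral_fin n b m : -2 < n -> 0 < b -> 0 < m ->
  (\int[ar]_p (radial n b m (planeC p))%:E < +oo)%E.
Proof.
move=> n2 b0 m0.
have [C C0 HC] := exp_decay n b0 m0.
(* On the shell 2^(-j-1) < |z| <= 2^(-j) one has |z|^n <= q^(j+1); the 1 covers n >= 0, and q < 4
   amounts to n > -2. *)
set q := Num.max 1 (2 `^ (- n)).
have q1 : 1 <= q by rewrite le_max lexx.
have q4 : q < 4.
  rewrite gt_max ltr1n /=; have -> : (4 : R) = 2 `^ 2.
    by rewrite powR_mulrn // expr2; ring.
  by rewrite -ltr_ln ?posrE ?powR_gt0 // !ln_powR ltr_pM2r ?ln_gt0 ?ltr1n //; lra.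
have q0 : 0 < q := lt_le_trans ltr01 q1.
pose c1 j := q ^+ j.+1; pose c2 j := C / 16 ^+ j.
have c10 j : 0 <= c1 j by rewrite exprn_ge0 // ltW.
have c20 j : 0 <= c2 j by rewrite divr_ge0 // exprn_ge0.
pose f1 j p := ((c1 j)%:E * (\1_(box (2^-1 ^+ j)) p)%:E)%E.
pose f2 j p := ((c2 j)%:E * (\1_(box (2 ^+ j.+1)) p)%:E)%E.
have f10 j p : (0 <= f1 j p)%E by rewrite mule_ge0 // lee_fin.
have f20 j p : (0 <= f2 j p)%E by rewrite mule_ge0 // lee_fin.
have mf1 j : measurable_fun setT (f1 j).
  apply: measurable_funeM; apply/measurable_EFinP; apply: measurable_indic.
  exact: measurable_box.
have mf2 j : measurable_fun setT (f2 j).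
  apply: measurable_funeM; apply/measurable_EFinP; apply: measurable_indic.
  exact: measurable_box.
pose f j p := (f1 j p + f2 j p)%E.
have f0 j p : (0 <= f j p)%E by rewrite adde_ge0.
have mf j : measurable_fun setT (f j) by exact: emeasurable_funD.
have fle j p : (f j p <= \sum_(0 <= i <oo) f i p)%E.
  apply: (@le_trans _ _ (\sum_(0 <= i < j.+1) f i p)%E).
    by rewrite big_nat_recr //= leeDr // sume_ge0.
  by apply: nneseries_lim_ge => i _ _.
have Vle p : ((radial n b m (planeC p))%:E <= \sum_(0 <= i <oo) f i p)%E.
  set y := absC (planeC p); have y0 : 0 <= y by exact: absC_ge0.
  have [y1|y1] := leP y 1; last first.
    have [j /andP[j1 j2]] := dyadic (ltW y1).
    apply: le_trans (fle j p); apply: (@le_trans _ _ (f2 j p)); last first.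
      by rewrite /f leeDr.
    rewrite /f2 indicE mem_set; last by apply: in_box; rewrite -/y ltW.
    rewrite mule1 lee_fin /radial -/y /c2 ler_pdivlMr ?exprn_gt0 //.
    apply: le_trans (HC y (ltW y1)).
    rewrite ler_wpM2l ?mulr_ge0 ?powR_ge0 ?expR_ge0 //.
    have -> : (16 : R) = 2 ^+ 4 by ring.
    by rewrite exprAC lerXn2r // nnegrE ?exprn_ge0.
  suff [j [j1 j2]] : exists j, y <= 2^-1 ^+ j /\ y `^ n <= c1 j.
    apply: le_trans (fle j p); apply: (@le_trans _ _ (f1 j p)); last first.
      by rewrite /f leeDl.
    rewrite /f1 indicE mem_set; last exact: in_box.
    rewrite mule1 lee_fin /radial -/y -[leRHS]mulr1.
    rewrite ler_pM ?powR_ge0 ?expR_ge0 // -expR0 ler_expR oppr_le0.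
    by rewrite mulr_ge0 ?powR_ge0 // ltW.
  move: y0; rewrite le_eqVlt => /predU1P[<-|y0].
    exists 0%N; rewrite expr0 /c1 expr1; split => //; apply: le_trans q1.
    have [->|n0] := eqVneq n 0; first by rewrite powRr0.
    by rewrite powR0.
  have [|j /andP[j1 j2]] := @dyadic y^-1; first by rewrite invf_ge1.
  exists j; split.
    by rewrite exprVn -[y]invrK lef_pV2 ?posrE ?exprn_gt0 ?invr_gt0.
  have [n0|n0] := leP 0 n.
    apply: (@le_trans _ _ 1); last by rewrite exprn_ege1.
    have p1 : 1 `^ n = 1 :> R by rewrite powR1.
    by rewrite -[leRHS]p1 ge0_ler_powR ?nnegrE // ltW.
  apply: (@le_trans _ _ ((2 `^ (- n)) ^+ j.+1)); last first.
    by rewrite lerXn2r ?nnegrE ?powR_ge0 ?(ltW q0) // le_max lexx orbT.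
  rewrite -powR_mulrn ?powR_ge0 // -powRrM mulrC powRrM powR_mulrn //.
  have -> : y `^ n = y^-1 `^ (- n).
    by rewrite -[y^-1]powR_inv1 ?(ltW y0) // -powRrM mulN1r opprK.
  by rewrite ge0_ler_powR ?nnegrE ?invr_ge0 ?exprn_ge0 ?(ltW y0) ?(ltW j2) // ltW // oppr_gt0.
(* The inner square of index j has area 4 / 4^j and the outer one 16 times 4^j, which gives
   geometric series of ratios q / 4 and 1 / 4; the former ratio is the larger, as q >= 1. *)
set th := q / 4.
have th0 : 0 <= th by rewrite divr_ge0 // ltW.
have th1 : th < 1 by rewrite ltr_pdivrMr // mul1r.
set K := 4 * q + 16 * C.
have K0 : 0 <= K by rewrite addr_ge0 // mulr_ge0 // ltW.
have If j : (\int[ar]_p f j p <= (K * th ^+ j)%:E)%E.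
  rewrite ge0_integralD //.
  rewrite ge0_integralZl //; last 2 first.
    by apply/measurable_EFinP; apply: measurable_indic; exact: measurable_box.
    by rewrite lee_fin.
  rewrite ge0_integralZl //; last 2 first.
    by apply/measurable_EFinP; apply: measurable_indic; exact: measurable_box.
    by rewrite lee_fin.
  rewrite !integral_box ?exprn_ge0 // -!EFinM -EFinD lee_fin.
  have -> : c1 j * (4 * (2^-1 ^+ j) ^+ 2) = 4 * q * th ^+ j.
    rewrite /c1 /th exprS exprMn exprAC.
    have -> : (2^-1 ^+ 2 : R) = 4^-1 by field.
    by ring.
  have -> : c2 j * (4 * (2 ^+ j.+1) ^+ 2) = 16 * C * 4^-1 ^+ j.
    have -> : ((2 : R) ^+ j.+1) ^+ 2 = 4 * 4 ^+ j.
      by rewrite exprAC -exprS; congr (_ ^+ _); ring.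
    have -> : c2 j = C / (4 ^+ j * 4 ^+ j).
      by rewrite /c2 -exprMn; congr (_ / _ ^+ _); ring.
    by rewrite exprVn; field; rewrite expf_neq0.
  have -> : K * th ^+ j = 4 * q * th ^+ j + 16 * C * th ^+ j by rewrite /K; ring.
  apply: lerD => //; apply: ler_wpM2l; first by rewrite mulr_ge0.
  by rewrite lerXn2r ?nnegrE ?invr_ge0 // /th ler_peMl // invr_ge0.
apply: (@le_lt_trans _ _ (\int[ar]_p (\sum_(0 <= i <oo) f i p))%E).
  apply: ge0_le_integral => //.
  - by move=> p _; rewrite lee_fin radial_ge0.
  - by apply/measurable_EFinP; exact: measurable_radial.
  - by apply: ge0_emeasurable_sum => // ? ? ? _.
rewrite integral_nneseries //.
apply: (@le_lt_trans _ _ (K / (1 - th))%:E); last exact: ltry.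
apply: lime_le.
  by apply: is_cvg_nneseries => i _ _; exact: integral_ge0.
apply: nearW => N; apply: (@le_trans _ _ (\sum_(0 <= j < N) (K * th ^+ j)%:E)%E).
  exact: lee_sum.
by rewrite sumEFin lee_fin -mulr_sumr ler_wpM2l // geometric_sum_le.
Qed.

End WeightIntegrable.

(** * Complex-valued integrals over the plane *)

Section ComplexIntegral.
Context {R : realType}.
Local Notation mR := (measurableTypeR R).
Local Notation mu := (@lebesgue_measure R).
Local Notation ar := (mu \x mu)%E.
Implicit Types (f g h : R[i] -> R[i]) (u : R[i] -> R).

Definition measR u := measurable_fun [set: mR * mR] (fun p => u (planeC p)).
Definition intR u := ar.-integrable setT (fun p => (u (planeC p))%:E).
Definition RI u : R := (\int[ar]_p u (planeC p))%R.
Definition intC h := intR (fun z => complex.Re (h z)) /\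
  intR (fun z => complex.Im (h z)).

Lemma measRM u v : measR u -> measR v -> measR (fun z => u z * v z).
Proof. by move=> hu hv; exact: measurable_funM. Qed.
Lemma measR_cst (c : R) : measR (fun=> c).
Proof. exact: measurable_cst. Qed.
Lemma measR_absC : measR (fun z => absC z).
Proof. exact: measurable_absC_plane. Qed.
Lemma measRX u k : measR u -> measR (fun z => u z ^+ k).
Proof. by move=> hu; exact: measurable_funX. Qed.

Lemma measC_cst (c : R[i]) : Defs.measurableC (fun=> c).
Proof. by split; exact: measurable_cst. Qed.
Lemma measC_id : Defs.measurableC (@id R[i]).
Proof. by split; [exact: measurable_fst|exact: measurable_snd]. Qed.
Lemma measCD f g : Defs.measurableC f -> Defs.measurableC g ->
  Defs.measurableC (fun z => f z + g z).
Proof.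
move=> [f1 f2] [g1 g2]; split.
  by under eq_fun do rewrite ReD; exact: measurable_funD.
by under eq_fun do rewrite ImD; exact: measurable_funD.
Qed.
Lemma measCN f : Defs.measurableC f -> Defs.measurableC (fun z => - f z).
Proof.
move=> [f1 f2]; split.
  by under eq_fun do rewrite ReN; exact: measurable_funN.
by under eq_fun do rewrite ImN; exact: measurable_funN.
Qed.
Lemma measCM f g : Defs.measurableC f -> Defs.measurableC g ->
  Defs.measurableC (fun z => f z * g z).
Proof.
move=> [f1 f2] [g1 g2]; split.
  by under eq_fun do rewrite ReM; apply: measurable_funB; exact: measurable_funM.
by under eq_fun do rewrite ImM; apply: measurable_funD; exact: measurable_funM.
Qed.
Lemma measC_conj f : Defs.measurableC f -> Defs.measurableC (fun z => (f z)^*).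
Proof.
move=> [f1 f2]; split.
  by apply: eq_measurable_fun f1 => p _ /=; case: (f _).
have := measurable_funN f2; apply: eq_measurable_fun => p _ /=.
by case: (f _).
Qed.
Lemma measC_real u : measR u -> Defs.measurableC (fun z => (u z)%:C).
Proof. by move=> hu; split => //; exact: measurable_cst. Qed.
Lemma measCX f k : Defs.measurableC f -> Defs.measurableC (fun z => f z ^+ k).
Proof.
move=> hf; elim: k => [|k IH]; first exact: measC_cst.
have -> : (fun z => f z ^+ k.+1) = (fun z => f z * f z ^+ k).
  by apply: funext => z; rewrite exprS.
exact: measCM.
Qed.
Lemma measC_absC f : Defs.measurableC f -> measR (fun z => absC (f z)).
Proof.
move=> [f1 f2].
have -> : (fun z => absC (f z)) =
   (fun z => (complex.Re (f z) ^+ 2 + complex.Im (f z) ^+ 2) `^ 2^-1).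
  apply: funext => z; rewrite absC_sqrt powR12_sqrt // addr_ge0 // sqr_ge0 //.
apply: (measurableT_comp (measurable_powR _)).
by apply: measurable_funD; exact: measurable_funX.
Qed.

Lemma measC_psum (a : nat -> R[i]) N : Defs.measurableC (psum a N).
Proof.
elim: N => [|N IH].
  have -> : psum a 0 = fun=> 0 by apply: funext => z; rewrite /psum big_ord0.
  exact: measC_cst.
have -> : psum a N.+1 = fun z => psum a N z + a N * z ^+ N.
  by apply: funext => z; rewrite psumS.
by apply: measCD => //; apply: measCM; [exact: measC_cst|exact/measCX/measC_id].
Qed.

Definition cvgC (s : nat -> R[i]) (l : R[i]) := forall e : R, 0 < e ->
  exists N, forall n, (N <= n)%N -> absC (l - s n) <= e.

Lemma cvgC_Re s l : cvgC s l ->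
  (fun n => complex.Re (s n)) @ \oo --> complex.Re l.
Proof.
move=> H; apply/cvgrPdist_le => e /H[N HN]; exists N => // n /HN; apply: le_trans.
by rewrite -ReN -ReD absC_Re.
Qed.

Lemma cvgC_Im s l : cvgC s l ->
  (fun n => complex.Im (s n)) @ \oo --> complex.Im l.
Proof.
move=> H; apply/cvgrPdist_le => e /H[N HN]; exists N => // n /HN; apply: le_trans.
by rewrite -ImN -ImD absC_Im.
Qed.

Lemma cvgC_ReIm s l : (fun n => complex.Re (s n)) @ \oo --> complex.Re l ->
  (fun n => complex.Im (s n)) @ \oo --> complex.Im l -> cvgC s l.
Proof.
move=> /cvgrPdist_le H1 /cvgrPdist_le H2 e e0.
have e2 : 0 < e / 2 by rewrite divr_gt0.
have [N1 _ h1] := H1 _ e2; have [N2 _ h2] := H2 _ e2.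
exists (maxn N1 N2) => n; rewrite geq_max => /andP[/h1 n1 /h2 n2].
apply: (le_trans (absC_le_ReIm _)); rewrite ReD ImD ReN ImN [e]splitr.
exact: lerD.
Qed.

Lemma cvgC_uniq s l l' : cvgC s l -> cvgC s l' -> l = l'.
Proof.
move=> h h'; apply: complexP.
  exact: (cvg_unique _ (cvgC_Re h) (cvgC_Re h')).
exact: (cvg_unique _ (cvgC_Im h) (cvgC_Im h')).
Qed.

Lemma cvgC_PS (a : nat -> R[i]) z : ESeq a -> cvgC (fun N => psum a N z) (PS a z).
Proof. by move=> ha e e0; exact: PS_cvg. Qed.

Lemma measC_cvg (s : nat -> R[i] -> R[i]) f : (forall n, Defs.measurableC (s n)) ->
  (forall z, cvgC (s^~ z) (f z)) -> Defs.measurableC f.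
Proof.
move=> ms sf; split.
  apply: (@measurable_fun_cvg _ _ _ _ (fun n p => complex.Re (s n (planeC p)))).
    by move=> n; case: (ms n).
  by move=> p _; exact: (cvgC_Re (sf (planeC p))).
apply: (@measurable_fun_cvg _ _ _ _ (fun n p => complex.Im (s n (planeC p)))).
  by move=> n; case: (ms n).
by move=> p _; exact: (cvgC_Im (sf (planeC p))).
Qed.

Lemma measC_PS (a : nat -> R[i]) : ESeq a -> Defs.measurableC (PS a).
Proof.
by move=> ha; apply: (measC_cvg (measC_psum a)) => z; exact: cvgC_PS.
Qed.

Lemma measC_entire f : entire f -> Defs.measurableC f.
Proof. by move=> /taylor[a [ha /funext ->]]; exact: measC_PS. Qed.

Lemma intR_dom u v : measR u -> intR v -> (forall z, `|u z| <= v z) -> intR u.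
Proof.
move=> mu_ iv uv; apply: le_integrable iv => //; first exact/measurable_EFinP.
by move=> p _; rewrite lee_fin (le_trans (uv _)) // ler_norm.
Qed.

Lemma intC_dom h v : Defs.measurableC h -> intR v ->
  (forall z, absC (h z) <= v z) -> intC h.
Proof.
move=> [h1 h2] iv hv; split; apply: intR_dom iv _ => // z;
  apply: le_trans (hv z); [exact: absC_Re|exact: absC_Im].
Qed.

Lemma intR_fin u : measR u -> (forall z, 0 <= u z) ->
  (\int[ar]_p (u (planeC p))%:E < +oo)%E -> intR u.
Proof.
move=> mu_ u0 ui; apply/integrableP; split; first exact/measurable_EFinP.
by under eq_integral do rewrite gee0_abs ?lee_fin //.
Qed.

Lemma intR_lt u : intR u -> (forall z, 0 <= u z) ->
  (\int[ar]_p (u (planeC p))%:E < +oo)%E.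
Proof.
by move=> /integrableP[_ +] u0; under eq_integral do rewrite gee0_abs ?lee_fin //.
Qed.

Lemma intRD u v : intR u -> intR v -> intR (fun z => u z + v z).
Proof.
move=> iu iv; have := integrableD measurableT iu iv.
by apply: eq_integrable => // p _; rewrite /= EFinD.
Qed.

Lemma intRZ (c : R) u : intR u -> intR (fun z => c * u z).
Proof.
move=> iu; have := integrableZl measurableT c iu.
by apply: eq_integrable => // p _; rewrite /= EFinM.
Qed.

Lemma RID u v : intR u -> intR v -> RI (fun z => u z + v z) = RI u + RI v.
Proof. by move=> iu iv; exact: (RintegralD measurableT iu iv). Qed.

Lemma RIZ (c : R) u : intR u -> RI (fun z => c * u z) = c * RI u.
Proof. by move=> iu; exact: (RintegralZl _ measurableT iu). Qed.

Lemma RI_le u v : intR u -> intR v -> (forall z, u z <= v z) -> RI u <= RI v.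
Proof. by move=> iu iv uv; exact: (le_Rintegral measurableT iu iv). Qed.

Lemma RI_ge0 u : (forall z, 0 <= u z) -> 0 <= RI u.
Proof. by move=> u0; apply: Rintegral_ge0. Qed.

Lemma RI_norm u v : measR u -> intR v -> (forall z, `|u z| <= v z) -> `|RI u| <= RI v.
Proof.
move=> mu_ iv uv; have iu := intR_dom mu_ iv uv.
rewrite ler_norml; apply/andP; split.
  rewrite -mulN1r -RIZ //; apply: RI_le => //; first exact: intRZ.
  by move=> z; rewrite mulN1r lerNl (le_trans (ler_norm _)) // normrN.
by apply: RI_le => // z; rewrite (le_trans (ler_norm _)).
Qed.

Lemma integralCE h : integralC h =
  RI (fun z => complex.Re (h z)) +i* RI (fun z => complex.Im (h z)).
Proof. by []. Qed.

Lemma intCD h h' : intC h -> intC h' ->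
  integralC (fun z => h z + h' z) = integralC h + integralC h'.
Proof.
move=> [h1 h2] [h1' h2']; rewrite !integralCE; apply: complexP; rewrite ?ReD ?ImD /=.
  by rewrite -RID //; congr RI; apply: funext => z; rewrite ReD.
by rewrite -RID //; congr RI; apply: funext => z; rewrite ImD.
Qed.

Lemma intCZ c h : intC h -> integralC (fun z => c * h z) = c * integralC h.
Proof.
move=> [h1 h2]; rewrite !integralCE; apply: complexP; rewrite ?ReM ?ImM /=.
  rewrite -!RIZ // -mulN1r -RIZ -?RID //; try exact: intRZ; try by do 2 apply: intRZ.
  by congr RI; apply: funext => z; rewrite ReM mulN1r.
rewrite -!RIZ // -RID //; try exact: intRZ.
by congr RI; apply: funext => z; rewrite ImM.
Qed.

Lemma intC_Z c h : intC h -> intC (fun z => c * h z).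
Proof.
move=> [h1 h2]; split.
  have := intRD (intRZ (complex.Re c) h1) (intRZ (- complex.Im c) h2).
  by apply: eq_integrable => // p _; rewrite ReM mulNr.
have := intRD (intRZ (complex.Re c) h2) (intRZ (complex.Im c) h1).
by apply: eq_integrable => // p _; rewrite ImM.
Qed.

Lemma intC_D h h' : intC h -> intC h' -> intC (fun z => h z + h' z).
Proof.
move=> [h1 h2] [h1' h2']; split.
  by have := intRD h1 h1'; apply: eq_integrable => // p _; rewrite ReD.
by have := intRD h2 h2'; apply: eq_integrable => // p _; rewrite ImD.
Qed.

Lemma integralC_bound h v : Defs.measurableC h -> intR v ->
  (forall z, absC (h z) <= v z) -> absC (integralC h) <= 2 * RI v.
Proof.
move=> [h1 h2] iv hv; rewrite integralCE; apply: (le_trans (absC_le_ReIm _)) => /=.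
rewrite mulr_natl mulr2n; apply: lerD; apply: RI_norm => // z; apply: le_trans (hv z);
  [exact: absC_Re|exact: absC_Im].
Qed.

Lemma RI_dominated (s : nat -> R[i] -> R) u v : (forall n, measR (s n)) ->
  (forall z, (s^~ z) @ \oo --> u z) -> intR v ->
  (forall n z, `|s n z| <= v z) -> (fun n => RI (s n)) @ \oo --> RI u.
Proof.
move=> ms su iv sv.
have mu_ : measR u.
  by apply: (@measurable_fun_cvg _ _ _ _ (fun n p => s n (planeC p))) => // p _; exact: su.
have ptw (p : mR * mR) : [set: mR * mR] p ->
    (fun n => (s n (planeC p))%:E) @ \oo --> (u (planeC p))%:E.
  by move=> _; apply: cvg_EFin; [exact: nearW|exact: su].
have svp (p : mR * mR) : forall n, [set: mR * mR] p ->
    (`|(s n (planeC p))%:E| <= (v (planeC p))%:E)%E.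
  by move=> n _; rewrite lee_fin.
have [iu _ c] := @dominated_convergence _ _ _ ar setT measurableT
  (fun n p => (s n (planeC p))%:E) (fun p => (u (planeC p))%:E)
  (fun p => (v (planeC p))%:E)
  (fun n => (measurable_EFinP _ _).2 (ms n)) ((measurable_EFinP _ _).2 mu_)
  (aeW _ ptw) iv
  (aeW _ svp).
have uE : (\int[ar]_p (u (planeC p))%:E = (RI u)%:E)%E.
  by rewrite /RI /Rintegral fineK //; exact: integrable_fin_num.
by rewrite uE in c; exact: fine_cvg c.
Qed.

Lemma integralC_dominated (s : nat -> R[i] -> R[i]) f v :
  (forall n, Defs.measurableC (s n)) ->
  (forall z, cvgC (s^~ z) (f z)) -> intR v ->
  (forall n z, absC (s n z) <= v z) ->
  cvgC (fun n => integralC (s n)) (integralC f).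
Proof.
move=> ms sf iv sv; apply: cvgC_ReIm => /=.
  apply: (@RI_dominated (fun n z => complex.Re (s n z)) (fun z => complex.Re (f z)) v) => //.
  - by move=> n; case: (ms n).
  - by move=> z; exact: (cvgC_Re (sf z)).
  - by move=> n z; apply: le_trans (sv n z); exact: absC_Re.
apply: (@RI_dominated (fun n z => complex.Im (s n z)) (fun z => complex.Im (f z)) v) => //.
- by move=> n; case: (ms n).
- by move=> z; exact: (cvgC_Im (sf z)).
- by move=> n z; apply: le_trans (sv n z); exact: absC_Im.
Qed.

Lemma RI_rot w u : absC w = 1 -> w != -1 -> measR u ->
  RI (fun z => u (w * z)) = RI u.
Proof.
move=> w1 wN1 mu_; rewrite /RI /Rintegral; congr fine.
rewrite -(@integral_rotp _ w (fun p => (u (planeC p))%:E)) //; last first.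
  exact/measurable_EFinP.
by apply: eq_integral => p _; rewrite planeC_rotp.
Qed.

Lemma integralC_rot w h : absC w = 1 -> w != -1 -> Defs.measurableC h ->
  integralC (fun z => h (w * z)) = integralC h.
Proof.
move=> w1 wN1 [h1 h2]; rewrite !integralCE; apply: complexP => /=.
  exact: (@RI_rot w (fun z => complex.Re (h z))).
exact: (@RI_rot w (fun z => complex.Im (h z))).
Qed.

End ComplexIntegral.

Section Conjugation.
Context {R : realType}.

Lemma conjCM (x y : R[i]) : conjc (x * y) = conjc x * conjc y.
Proof. exact: rmorphM. Qed.

Lemma conjCD (x y : R[i]) : conjc (x + y) = conjc x + conjc y.
Proof. exact: rmorphD. Qed.

Lemma conjCX (x : R[i]) k : conjc (x ^+ k) = conjc x ^+ k.
Proof. exact: rmorphXn. Qed.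

End Conjugation.

(** * Bergman spaces of rotation invariant weights *)

Section WeightedSpace.
Context {R : realType}.
Implicit Types (f g h : R[i] -> R[i]) (z w : R[i]).
Variables (mu : R[i] -> R) (m : R).
Hypothesis m0 : 0 < m.
Hypothesis mmu : measR mu.
Hypothesis mu0 : forall z, 0 <= mu z.
Hypothesis murot : forall w z, absC w = 1 -> mu (w * z) = mu z.
(** The integrability input: it puts every measurable function of growth exp(A |z|^m) into L^2,
    hence the monomials, the kernels and their partial sums, and it supplies majorants for dominated
    convergence. *)
Hypothesis muint : forall A, intR (fun z => expR (A * absC z `^ m) * mu z).

Definition mom k : R := RI (fun z => absC z ^+ (2 * k) * mu z).
Definition sqnorm f : R := RI (fun z => absC (f z) ^+ 2 * mu z).
Definition mono k : R[i] -> R[i] := fun z => z ^+ k.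

Definition expgrowth f := exists (C A : R), 0 <= C /\
  forall z, absC (f z) <= C * expR (A * absC z `^ m).

Lemma pow_le_exp k : exists2 C : R, 0 <= C &
  forall y, 0 <= y -> y ^+ k <= C * expR (y `^ m).
Proof.
set N := Num.truncn (k%:R / m).
have N1 : k%:R <= m * N.+1%:R by rewrite mulrC -ler_pdivrMr // ltW // truncnS_gt.
exists ((N.+1)`!%:R) => // y y0.
have f1 : 1 <= (N.+1)`!%:R :> R by rewrite ler1n fact_gt0.
have e1 : 1 <= expR (y `^ m) by rewrite -expR0 ler_expR powR_ge0.
have [y1|y1] := leP y 1.
  apply: (@le_trans _ _ 1); first exact: exprn_ile1.
  by rewrite -[leLHS]mul1r ler_pM.
have ex : (y `^ m) ^+ N.+1 / (N.+1)`!%:R <= expR (y `^ m).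
  by apply: le_trans (expR_ge1Dxn N (powR_ge0 y m)); rewrite lerDr.
rewrite ler_pdivrMr ?ltr0n ?fact_gt0 // mulrC in ex; apply: le_trans ex.
by rewrite -!powR_mulrn ?powR_ge0 // -powRrM ler_powR // ltW.
Qed.

Lemma expgrowth_mono k : expgrowth (mono k).
Proof.
have [C C0 H] := pow_le_exp k; exists C, 1; split=> // z.
by rewrite absCX mul1r; apply: H; exact: absC_ge0.
Qed.

Lemma expgrowth_L2 f : Defs.measurableC f -> expgrowth f -> L2 mu f.
Proof.
move=> mf [C [A [C0 H]]]; split=> //.
apply: (@intR_lt _ (fun z => absC (f z) ^+ 2 * mu z)); last first.
  by move=> z; rewrite mulr_ge0 // exprn_ge0 // absC_ge0.
apply: (intR_dom _ (intRZ (C ^+ 2) (muint (2 * A)))).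
  by apply: measRM => //; apply: measRX; exact: measC_absC.
move=> z; rewrite ger0_norm ?mulr_ge0 ?exprn_ge0 ?absC_ge0 // mulrA.
rewrite ler_wpM2r // -mulrA expRM_natl -exprMn lerXn2r // ?nnegrE ?absC_ge0 //.
by rewrite mulr_ge0 ?expR_ge0.
Qed.

Lemma measC_mono k : Defs.measurableC (mono k).
Proof. exact/measCX/measC_id. Qed.

Lemma mono_entire k : entire (mono k).
Proof.
have E : mono k = PS (fun j => if j == k then 1 else 0).
  apply: funext => z; apply/esym; have h : ESeq (fun j => if j == k then 1 else 0 : R[i]).
    move=> rho r0; exists (rho ^+ k) => j; case: eqP => [->|_].
      by rewrite absC1 mul1r.
    by rewrite absC0 mul0r exprn_ge0.
  apply: PS_uniq => // e e0; exists k.+1 => n kn.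
  rewrite /psum (bigD1 (Ordinal kn)) //= eqxx mul1r big1 ?addr0 ?subrr ?absC0 ?ltW //.
  by move=> j; rewrite -val_eqE /= => /negPf ->; rewrite mul0r.
rewrite E; apply: PS_entire => rho r0; exists (rho ^+ k) => j; case: eqP => [->|_].
  by rewrite absC1 mul1r.
by rewrite absC0 mul0r exprn_ge0.
Qed.

Lemma mono_L2H k : L2H mu (mono k).
Proof.
by split; [apply: expgrowth_L2; [exact: measC_mono|exact: expgrowth_mono]|exact: mono_entire].
Qed.

Lemma L2_int f : L2 mu f -> intR (fun z => absC (f z) ^+ 2 * mu z).
Proof.
move=> [mf fi]; apply: intR_fin => //.
  by apply: measRM => //; apply: measRX; exact: measC_absC.
by move=> z; rewrite mulr_ge0 // exprn_ge0 // absC_ge0.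
Qed.

Lemma sqnorm_ge0 f : 0 <= sqnorm f.
Proof. by apply: RI_ge0 => z; rewrite mulr_ge0 // exprn_ge0 // absC_ge0. Qed.

Lemma inner_self f : inner mu f f = (sqnorm f)%:C.
Proof.
rewrite /inner integralCE; apply: complexP => /=.
  by congr RI; apply: funext => z; rewrite mulC_conj -rmorphM.
rewrite /RI; under eq_Rintegral do rewrite mulC_conj -rmorphM /=.
by rewrite /Rintegral integral0.
Qed.

Lemma L2norm_lt f d : 0 <= d -> L2norm mu f < d -> sqnorm f < d ^+ 2.
Proof.
move=> d0; rewrite /L2norm inner_self /= => fd.
rewrite -[sqnorm f]sqr_sqrtr ?sqnorm_ge0 // ltrXn2r // ?nnegrE ?sqrtr_ge0 //.
Qed.

Definition kern f g z : R[i] := f z * conjc (g z) * (mu z)%:C.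

Lemma measC_kern f g : Defs.measurableC f -> Defs.measurableC g ->
  Defs.measurableC (kern f g).
Proof.
move=> mf mg; apply: measCM; last exact: measC_real.
by apply: measCM => //; exact: measC_conj.
Qed.

Lemma absC_kern f g z : absC (kern f g z) = absC (f z) * absC (g z) * mu z.
Proof. by rewrite /kern !absCM absC_conj absC_real ger0_norm. Qed.

(** With a free [t] this stands in for the Cauchy-Schwarz inequality, without square roots; later
    uses tune [t] to the sizes of the two norms. *)
Lemma amgm (t x y : R) : 0 < t -> x * y <= t * x ^+ 2 + t^-1 * y ^+ 2.
Proof.
move=> t0; have t1 : 0 < t^-1 by rewrite invr_gt0.
have : 0 <= t^-1 * ((t * x - y) ^+ 2 + (t * x) ^+ 2 + y ^+ 2).
  by rewrite mulr_ge0 ?(ltW t1) // !addr_ge0 ?sqr_ge0.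
have -> : t^-1 * ((t * x - y) ^+ 2 + (t * x) ^+ 2 + y ^+ 2) =
   2 * (t * x ^+ 2 + t^-1 * y ^+ 2 - x * y) by field; rewrite gt_eqF.
by rewrite pmulr_rge0 // subr_ge0.
Qed.

Lemma kern_le t f g z : 0 < t -> absC (kern f g z) <=
  t * (absC (f z) ^+ 2 * mu z) + t^-1 * (absC (g z) ^+ 2 * mu z).
Proof.
move=> t0; rewrite absC_kern.
have -> : t * (absC (f z) ^+ 2 * mu z) + t^-1 * (absC (g z) ^+ 2 * mu z) =
  (t * absC (f z) ^+ 2 + t^-1 * absC (g z) ^+ 2) * mu z by ring.
by rewrite ler_wpM2r // amgm.
Qed.

Lemma kern_dom t f g : L2 mu f -> L2 mu g ->
  intR (fun z => t * (absC (f z) ^+ 2 * mu z) + t^-1 * (absC (g z) ^+ 2 * mu z)).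
Proof. by move=> hf hg; apply: intRD; apply: intRZ; exact: L2_int. Qed.

Lemma kern_int f g : L2 mu f -> L2 mu g -> intC (kern f g).
Proof.
move=> hf hg; apply: (intC_dom _ (kern_dom 1 hf hg)).
  by apply: measC_kern; [case: hf|case: hg].
by move=> z; apply: kern_le.
Qed.

Lemma inner_bound t f g : 0 < t -> L2 mu f -> L2 mu g ->
  absC (inner mu f g) <= 2 * (t * sqnorm f + t^-1 * sqnorm g).
Proof.
move=> t0 hf hg; rewrite /sqnorm -!RIZ -?RID; try exact: L2_int; try by apply: intRZ; exact: L2_int.
apply: integralC_bound; last by move=> z; exact: kern_le.
  by apply: measC_kern; [case: hf|case: hg].
exact: kern_dom.
Qed.

Lemma L2D f g : L2 mu f -> L2 mu g -> L2 mu (fun z => f z + g z).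
Proof.
move=> hf hg; have mfg : Defs.measurableC (fun z => f z + g z).
  by apply: measCD; [case: hf|case: hg].
split=> //; apply: (@intR_lt _ (fun z => absC (f z + g z) ^+ 2 * mu z)); last first.
  by move=> z; rewrite mulr_ge0 // exprn_ge0 // absC_ge0.
apply: (intR_dom _ (intRD (intRZ 2 (L2_int hf)) (intRZ 2 (L2_int hg)))).
  by apply: measRM => //; apply: measRX; exact: measC_absC.
move=> z; rewrite ger0_norm ?mulr_ge0 ?exprn_ge0 ?absC_ge0 //.
have -> : 2 * (absC (f z) ^+ 2 * mu z) + 2 * (absC (g z) ^+ 2 * mu z) =
  (2 * absC (f z) ^+ 2 + 2 * absC (g z) ^+ 2) * mu z by ring.
rewrite ler_wpM2r //; have := absCD (f z) (g z).
have := absC_ge0 (f z + g z); have := absC_ge0 (f z); have := absC_ge0 (g z).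
set x := absC (f z); set y := absC (g z); set s := absC _ => y0 x0 s0 sxy.
apply: (@le_trans _ _ ((x + y) ^+ 2)); first by rewrite lerXn2r // nnegrE addr_ge0.
by have := sqr_ge0 (x - y); nra.
Qed.

Lemma L2N f : L2 mu f -> L2 mu (fun z => - f z).
Proof.
move=> [mf fi]; split; first exact: measCN.
by under eq_integral do rewrite absCN.
Qed.

Lemma L2B f g : L2 mu f -> L2 mu g -> L2 mu (f \- g).
Proof. by move=> hf hg; exact: (L2D hf (L2N hg)). Qed.

Lemma innerB f g h : L2 mu f -> L2 mu g -> L2 mu h ->
  inner mu (f \- g) h = inner mu f h - inner mu g h.
Proof.
move=> hf hg hh; rewrite /inner.
have -> : (fun z => (f \- g) z * (h z)^* * (mu z)%:C) =
   (fun z => kern f h z + (-1) * kern g h z).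
  by apply: funext => z; rewrite /kern /=; ring.
rewrite intCD; [|exact: kern_int|apply: intC_Z; exact: kern_int].
by rewrite intCZ ?mulN1r //; exact: kern_int.
Qed.

Definition ind (rho : R) z : R := (absC z <= rho)%R%:R.

Lemma measR_ind rho : measR (ind rho).
Proof.
have -> : ind rho = fun z => \1_(`]-oo, rho]%classic) (absC z).
  apply: funext => z; rewrite /ind indicE; congr (nat_of_bool _)%:R.
  by apply/idP/idP; rewrite inE /= in_itv.
have h : measurable_fun [set: measurableTypeR R] (\1_(`]-oo, rho]%classic) : R -> R).
  exact: measurable_indic.
exact: (measurableT_comp h measR_absC).
Qed.

Lemma ind_le1 rho z : ind rho z <= 1. Proof. by rewrite lern1 leq_b1. Qed.

(** Truncation to the disc of radius [rho], where Taylor sums converge uniformly and can be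
    integrated term by term. *)
Definition cutmom rho k : R := RI (fun z => absC z ^+ (2 * k) * (ind rho z * mu z)).
Definition cutkern rho f l z : R[i] := f z * conjc (z ^+ l) * (ind rho z * mu z)%:C.

Lemma measC_cutkern rho f l : Defs.measurableC f -> Defs.measurableC (cutkern rho f l).
Proof.
move=> mf; apply: measCM; last by apply: measC_real; apply: measRM => //; exact: measR_ind.
by apply: measCM => //; apply: measC_conj; exact: measC_mono.
Qed.

Lemma intR_mu : intR mu.
Proof.
have := muint 0; apply: eq_integrable => // p _.
by rewrite mul0r expR0 mul1r.
Qed.

Lemma cutkern_le rho f l (B : R) z : 0 <= rho -> 0 <= B ->
  (absC z <= rho -> absC (f z) <= B) ->
  absC (cutkern rho f l z) <= B * rho ^+ l * mu z.
Proof.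
move=> r0 B0 H; rewrite /cutkern !absCM absC_conj absCX absC_real /ind.
rewrite ger0_norm ?mulr_ge0 //; case: (boolP (absC z <= rho)) => [zr|_]; last first.
  by rewrite mul0r mulr0 !mulr_ge0 ?exprn_ge0.
rewrite mul1r ler_wpM2r // ler_pM ?absC_ge0 ?exprn_ge0 ?absC_ge0 ?H //.
by rewrite lerXn2r ?nnegrE ?absC_ge0.
Qed.

Lemma cutkern_int rho f l (B : R) : Defs.measurableC f -> 0 <= rho -> 0 <= B ->
  (forall z, absC z <= rho -> absC (f z) <= B) -> intC (cutkern rho f l).
Proof.
move=> mf r0 B0 H; apply: (intC_dom (measC_cutkern _ _ mf) (intRZ (B * rho ^+ l) intR_mu)).
by move=> z; apply: cutkern_le => //; exact: H.
Qed.

(* Rotating by a root of unity of large odd order multiplies the integral by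
   w ^+ k * w ^- l != 1. *)
Lemma mono_orth rho k l : 0 <= rho -> k != l ->
  integralC (cutkern rho (mono k) l) = 0.
Proof.
(* Odd, so that w != -1 and rotation invariance of integrals applies; larger than [k] and [l], so
   that w^k != w^l. *)
move=> r0 kl; pose M := (2 * (k + l)).+1.
have [w pw] := @primitive_root_exists R M isT.
have w1 : absC w = 1 by exact: absC_unity_root (prim_expr_order pw).
have wN1 : w != -1.
  apply/eqP => wN; have := prim_expr_order pw; rewrite wN /M exprS exprM sqrrN.
  rewrite !expr1n mulr1 => /eqP; rewrite -subr_eq0 -opprD oppr_eq0.
  by rewrite -(natrD _ 1 1) pnatr_eq0.
have mk : Defs.measurableC (cutkern rho (mono k) l).
  by apply: measC_cutkern; exact: measC_mono.
have ik : intC (cutkern rho (mono k) l).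
  apply: (@cutkern_int _ _ _ (rho ^+ k)); rewrite ?exprn_ge0 //; first exact: measC_mono.
  by move=> z zr; rewrite absCX lerXn2r ?nnegrE ?absC_ge0.
have w0 : w != 0 by exact: prim_neq0 pw.
have wV : conjc w = w^-1.
  by apply: (mulfI w0); rewrite mulC_conj w1 expr1n divff.
have := integralC_rot w1 wN1 mk.
have -> : (fun z => cutkern rho (mono k) l (w * z)) =
   (fun z => (w ^+ k * w^-1 ^+ l) * cutkern rho (mono k) l z).
  apply: funext => z; rewrite /cutkern /ind murot // absCM w1 mul1r /mono.
  by rewrite !exprMn conjCM !conjCX wV rmorphM; ring.
rewrite intCZ // => /eqP; rewrite -subr_eq0 -{2}[integralC _]mul1r -mulrBl mulf_eq0.
move=> /orP[|/eqP//]; rewrite subr_eq0.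
rewrite exprVn -(inj_eq (mulIf (expf_neq0 l w0))) mul1r divfK ?expf_neq0 //.
rewrite (eq_prim_root_expr pw) !modn_small ?(negPf kl) // /M ltnS mul2n -addnn.
  by apply: leq_trans (leq_addr _ _); exact: leq_addl.
by apply: leq_trans (leq_addr _ _); exact: leq_addr.
Qed.

Lemma mono_diag rho k :
  integralC (cutkern rho (mono k) k) = (cutmom rho k)%:C.
Proof.
have E z : cutkern rho (mono k) k z =
    (absC z ^+ (2 * k) * (ind rho z * mu z))%:C.
  by rewrite /cutkern /mono mulC_conj absCX -exprM mulnC -rmorphM.
rewrite integralCE; apply: complexP => /=.
  by congr RI; apply: funext => z; rewrite E.
by rewrite /RI; under eq_Rintegral do rewrite E /=; rewrite /Rintegral integral0.
Qed.

Lemma psum_cut rho a l N : 0 <= rho -> intC (cutkern rho (psum a N) l) /\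
  integralC (cutkern rho (psum a N) l) =
    if (l < N)%N then a l * (cutmom rho l)%:C else 0.
Proof.
move=> r0; elim: N => [|N [IH1 IH2]].
  have -> : cutkern rho (psum a 0) l = fun=> 0.
    by apply: funext => z; rewrite /cutkern /psum big_ord0 !mul0r.
  split; first by split; exact: integrable0.
  by rewrite integralCE /RI /Rintegral /= integral0.
have -> : cutkern rho (psum a N.+1) l =
   (fun z => cutkern rho (psum a N) l z + a N * cutkern rho (mono N) l z).
  by apply: funext => z; rewrite /cutkern psumS /mono; ring.
have iN : intC (cutkern rho (mono N) l).
  apply: (@cutkern_int _ _ _ (rho ^+ N)); rewrite ?exprn_ge0 //; first exact: measC_mono.
  by move=> z zr; rewrite absCX lerXn2r ?nnegrE ?absC_ge0.
split; first by apply: intC_D => //; exact: intC_Z.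
rewrite intCD //; last exact: intC_Z.
rewrite intCZ // IH2; case: (ltngtP l N) => [lN|Nl|lN].
- by rewrite ltnS (ltnW lN) mono_orth ?mulr0 ?addr0 // gtn_eqF.
- by rewrite ltnS leqNgt Nl /= mono_orth ?mulr0 ?addr0 // ltn_eqF.
- by rewrite lN ltnSn add0r mono_diag.
Qed.

Lemma PS_cut rho a l : 0 <= rho -> ESeq a ->
  integralC (cutkern rho (PS a) l) = a l * (cutmom rho l)%:C.
Proof.
move=> r0 ha; have [|M M0 HM] := @ESeq_bound _ a (2 * rho) ha; first by rewrite mulr_ge0.
have c : cvgC (fun N => integralC (cutkern rho (psum a N) l))
    (integralC (cutkern rho (PS a) l)).
  apply: (@integralC_dominated _ _ _ (fun z => 2 * M * rho ^+ l * mu z)).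
  - by move=> n; apply: measC_cutkern; exact: measC_psum.
  - move=> z e e0; set K := absC ((z ^+ l)^* * (ind rho z * mu z)%:C) + 1.
    have K0 : 0 < K by rewrite ltr_wpDl ?absC_ge0.
    have [N HN] := PS_cvg z ha (divr_gt0 e0 K0).
    exists N => n /HN h; rewrite /cutkern -!mulrA -mulrBl absCM.
    apply: (@le_trans _ _ (e / K * K)); last by rewrite divfK // gt_eqF.
    by rewrite ler_pM ?absC_ge0 // /K lerDl.
  - by apply: intRZ; exact: intR_mu.
  - move=> n z; apply: cutkern_le => //; first by rewrite mulr_ge0.
    move=> zr; have := psum_tail 0 n zr HM.
    by rewrite {2}/psum big_ord0 subr0 expr0 divr1.
apply: (cvgC_uniq c) => e e0; exists l.+1 => n ln.
by rewrite (psum_cut a l n r0).2 ln subrr absC0 ltW.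
Qed.

Lemma ind_cvg z : exists N, forall n, (N <= n)%N -> ind n%:R z = 1.
Proof.
exists (Num.truncn (absC z)).+1 => n Nn; rewrite /ind.
by rewrite (le_trans (ltW (truncnS_gt _))) // ler_nat.
Qed.

(** The cutoff radius tends to infinity in [PS_cut]. Domination now comes from the integrability of
    the product of two elements of L^2, the function and the monomial. *)
Lemma inner_mono a l : ESeq a -> L2 mu (PS a) ->
  inner mu (PS a) (mono l) = a l * (mom l)%:C.
Proof.
move=> ha h2.
have c1 : cvgC (fun n => integralC (cutkern n%:R (PS a) l)) (inner mu (PS a) (mono l)).
  apply: (integralC_dominated _ _ (kern_dom 1 h2 (mono_L2H l).1)).
  - by move=> n; apply: measC_cutkern; exact: measC_PS.
  - move=> z e e0; have [N HN] := ind_cvg z; exists N => n /HN h.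
    by rewrite /cutkern h mul1r subrr absC0 ltW.
  - move=> n z; apply: le_trans (kern_le _ _ _ ltr01).
    rewrite absC_kern /cutkern !absCM absC_conj absC_real ger0_norm ?mulr_ge0 //.
    by rewrite ler_wpM2l ?mulr_ge0 ?absC_ge0 // ler_piMl // ind_le1.
have im : intR (fun z => absC z ^+ (2 * l) * mu z).
  have := L2_int (mono_L2H l).1; apply: eq_integrable => // p _.
  by rewrite absCX -exprM mulnC.
have c2 : (fun n => cutmom n%:R l) @ \oo --> mom l.
  apply: (RI_dominated _ _ im).
  - move=> n; apply: measRM; first by apply: measRX; exact: measR_absC.
    by apply: measRM => //; exact: measR_ind.
  - move=> z; have [N HN] := ind_cvg z; apply: cvg_near_cst.
    by exists N => // n /HN /= ->; rewrite mul1r.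
  - move=> n z; rewrite ger0_norm ?mulr_ge0 ?exprn_ge0 ?absC_ge0 //.
    by rewrite ler_wpM2l ?exprn_ge0 ?absC_ge0 // ler_piMl // ind_le1.
apply: (cvgC_uniq c1) => e e0; set K := absC (a l) + 1.
have K0 : 0 < K by rewrite ltr_wpDl ?absC_ge0.
have /cvgrPdist_le /(_ _ (divr_gt0 e0 K0)) [N _ HN] := c2.
exists N => n /HN /= h; rewrite PS_cut // -mulrBr -rmorphB absCM absC_real.
apply: (@le_trans _ _ (K * (e / K))); last by rewrite mulrCA mulfV ?mulr1 // gt_eqF.
by rewrite ler_pM ?absC_ge0 // /K lerDl.
Qed.

(** The radius [rho] is left free, to be chosen according to the argument of the kernel; [c0] and
    [A] do not depend on [k]. *)
Hypothesis clow : exists c0 A : R, [/\ 0 < c0, 0 <= A & forall k rho, 1 <= rho ->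
  c0 * rho ^+ (2 * k) * expR (- (A * rho `^ (2 * m))) <= mom k].
Hypothesis mupos : {ae area R, forall p, 0 < mu (planeC p)}.

Lemma mom_gt0 k : 0 < mom k.
Proof.
have [c0 [A [c00 _ H]]] := clow; apply: lt_le_trans (H k 1 (lexx _)).
by rewrite expr1n mulr1 mulr_gt0 ?expR_gt0.
Qed.

(* The coefficients of the kernel: K(z, w) is the sum of (z^* w)^k / c_k, where
   c_k = [mom k] is the squared norm of the k-th monomial. *)
Definition kseq k : R[i] := ((mom k)^-1)%:C.

Lemma absC_kseq k : absC (kseq k) = (mom k)^-1.
Proof. by rewrite absC_real gtr0_norm // invr_gt0 mom_gt0. Qed.

(** The argument 2 x is the one that [PS_bound] and [psum_tail] ask for; the majorant is uniform in
    [k] and already has the growth claimed for the kernel. *)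
Lemma kseq_bound : exists C A : R, [/\ 0 <= C, 0 <= A & forall x k, 0 <= x ->
  absC (kseq k) * (2 * x) ^+ k <= C * expR (A * x `^ m)].
Proof.
have [c0 [A [c00 A0 H]]] := clow.
exists (c0^-1 * expR A), (A * 2 `^ m); split.
- by rewrite mulr_ge0 ?expR_ge0 // invr_ge0 ltW.
- by rewrite mulr_ge0 ?powR_ge0.
(* With this choice rho^(2 k) = y^k >= (2 x)^k and rho^(2 m) = y^m <= 1 + 2^m x^m; the maximum with
   1 meets the condition rho >= 1 and costs the factor exp A. *)
move=> x k x0; set y := Num.max 1 (2 * x); set rho := Num.sqrt y.
have y1 : 1 <= y by rewrite le_max lexx.
have y0 : 0 <= y := le_trans ler01 y1.
have r1 : 1 <= rho by rewrite -sqrtr1 ler_wsqrtr.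
have r2 : rho ^+ 2 = y by rewrite sqr_sqrtr.
have xy : (2 * x) ^+ k <= y ^+ k.
  by rewrite lerXn2r ?nnegrE ?mulr_ge0 // le_max lexx orbT.
have ym : y `^ m <= 1 + 2 `^ m * x `^ m.
  rewrite -powRM // /y; case: (leP 1 (2 * x)) => _.
    by rewrite lerDr.
  by rewrite powR1 lerDl powR_ge0.
have := H k rho r1; rewrite exprM r2 powRrM powR_mulrn ?sqrtr_ge0 // r2 => Hk.
have yk : 0 < y ^+ k by rewrite exprn_gt0 // (lt_le_trans ltr01).
rewrite absC_kseq mulrC ler_pdivrMr ?mom_gt0 //.
apply: (le_trans xy); rewrite -(ler_pM2l c00); apply: (@le_trans _ _ (mom k * expR (A * y `^ m))).
  rewrite -ler_pdivrMr ?expR_gt0 // -expRN; exact: Hk.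
have -> : c0 * (c0^-1 * expR A * expR (A * 2 `^ m * x `^ m) * mom k) =
   mom k * (expR A * expR (A * 2 `^ m * x `^ m)) by field; rewrite gt_eqF.
rewrite ler_pM2l ?mom_gt0 // -expRD ler_expR -{2}[A]mulr1 -mulrA -mulrDr.
by rewrite ler_wpM2l.
Qed.

Lemma ESeq_kseq : ESeq kseq.
Proof.
have [C [A [C0 A0 H]]] := kseq_bound.
move=> rho r0; exists (C * expR (A * (rho / 2) `^ m)) => k.
have := H (rho / 2) k; rewrite divr_ge0 // => /(_ isT).
by have -> : 2 * (rho / 2) = rho by field.
Qed.

(** The partial sums share the majorant of the sum, as dominated convergence of the kernel series
    requires. *)
Lemma PS_kseq_growth : exists C A : R, [/\ 0 <= C, 0 <= A,
  forall u, absC (PS kseq u) <= C * expR (A * absC u `^ m) &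
  forall N u, absC (psum kseq N u) <= C * expR (A * absC u `^ m)].
Proof.
have [C [A [C0 A0 H]]] := kseq_bound.
exists (4 * C), A; split=> //; first by rewrite mulr_ge0.
  move=> u; rewrite -mulrA; apply: (@PS_bound _ _ (absC u)) => // k.
  by apply: H; exact: absC_ge0.
move=> N u; have := @psum_tail _ kseq (absC u) _ u 0 N (lexx _)
   (fun k => H (absC u) k (absC_ge0 u)).
rewrite {2}/psum big_ord0 subr0 expr0 divr1 => /le_trans; apply.
by rewrite -mulrA ler_wpM2r ?mulr_ge0 ?expR_ge0 // ler_nat.
Qed.

Definition Bker z : R[i] -> R[i] := fun zeta => PS kseq (conjc z * zeta).
Definition Bcoef z k : R[i] := kseq k * conjc z ^+ k.

Lemma psum_Bcoef z n zeta : psum (Bcoef z) n zeta = psum kseq n (conjc z * zeta).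
Proof. by apply: eq_bigr => k _; rewrite exprMn mulrA. Qed.

Lemma ESeq_Bcoef z : ESeq (Bcoef z).
Proof.
move=> rho r0; have [|M HM] := ESeq_kseq (_ : 0 <= absC z * rho).
  by rewrite mulr_ge0 // absC_ge0.
exists M => k; apply: le_trans (HM k).
by rewrite /Bcoef absCM absCX absC_conj exprMn mulrA.
Qed.

Lemma Bker_PS z : Bker z = PS (Bcoef z).
Proof.
apply: funext => zeta; apply/esym/PS_uniq; first exact: ESeq_Bcoef.
move=> e e0; have [N HN] := PS_cvg (conjc z * zeta) ESeq_kseq e0.
by exists N => n /HN; rewrite psum_Bcoef.
Qed.

Lemma Bker_entire z : entire (Bker z).
Proof. by rewrite Bker_PS; apply: PS_entire; exact: ESeq_Bcoef. Qed.

Lemma Bker_L2H z : L2H mu (Bker z).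
Proof.
split; last exact: Bker_entire.
apply: expgrowth_L2; first by apply: measC_entire; exact: Bker_entire.
have [C [A [C0 A0 H _]]] := PS_kseq_growth.
exists C, (A * absC z `^ m); split=> // zeta.
apply: (le_trans (H _)); rewrite absCM absC_conj powRM ?absC_ge0 //.
by rewrite mulrA.
Qed.

(** Taylor coefficients of the orthogonal projection of [f] onto L^2_H; [f] itself need not be
    holomorphic. *)
Definition fcoef f k : R[i] := inner mu f (mono k) * kseq k.

(** Dominated convergence in the second argument: the partial sums of the kernel are majorised by
    [G], of growth exp(A |x|^m) and so in L^2. Of [f] only membership in L^2 is asked. *)
Lemma repro_series f z : L2 mu f ->
  cvgC (fun N => psum (fcoef f) N z) (inner mu f (Bker z)).
Proof.
move=> hf; pose S N zeta := psum kseq N (conjc z * zeta).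
have hS N : L2 mu (S N).
  have [C [A [C0 A0 _ H]]] := PS_kseq_growth.
  apply: expgrowth_L2.
    have -> : S N = psum (Bcoef z) N by apply: funext => x; rewrite psum_Bcoef.
    exact: measC_psum.
  exists C, (A * absC z `^ m); split=> // zeta.
  by apply: (le_trans (H _ _)); rewrite absCM absC_conj powRM ?absC_ge0 // mulrA.
have E N : inner mu f (S N) = psum (fcoef f) N z.
  elim: N => [|N IH].
    rewrite /psum big_ord0 /inner.
    have -> : (fun x => f x * conjc (S 0%N x) * (mu x)%:C) = fun=> 0.
      by apply: funext => x; rewrite /S /psum big_ord0 conjc0 mulr0 mul0r.
    by rewrite integralCE /RI /Rintegral /= integral0.
  rewrite psumS -IH /fcoef.
  have -> : inner mu f (S N.+1) =
     integralC (fun x => kern f (S N) x + (kseq N * z ^+ N) * kern f (mono N) x).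
    rewrite -[LHS]/(integralC (kern f (S N.+1))); congr integralC.
    apply: funext => x; rewrite /kern /S psumS conjCD exprMn !conjCM !conjCX.
    by rewrite conjcK conjc_real; ring.
  have h1 := kern_int hf (hS N).
  have h2 := kern_int hf (mono_L2H N).1.
  rewrite intCD //; last exact: intC_Z.
  by rewrite intCZ // [inner mu f (mono N) * _]mulrC mulrAC.
have [C [A [C0 A0 H1 H]]] := PS_kseq_growth.
pose G x : R[i] := (C * expR (A * absC z `^ m * absC x `^ m))%:C.
have Gpos x : 0 <= C * expR (A * absC z `^ m * absC x `^ m).
  by rewrite mulr_ge0 ?expR_ge0.
have hG : L2 mu G.
  apply: expgrowth_L2.
    apply: measC_real.
    have mp : measR (fun x : R[i] => absC x `^ m).
      exact: (measurableT_comp (measurable_powR m) measR_absC).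
    have me := measRM (measR_cst (A * absC z `^ m)) mp.
    have mexp : measurable_fun [set: measurableTypeR R] (@expR R).
      exact: measurable_expR.
    exact: (measRM (measR_cst C) (measurableT_comp mexp me)).
  exists C, (A * absC z `^ m); split=> // x.
  by rewrite /G absC_real ger0_norm.
have SG N x : absC (S N x) <= absC (G x).
  rewrite /G absC_real ger0_norm //; apply: (le_trans (H _ _)).
  by rewrite absCM absC_conj powRM ?absC_ge0 // mulrA.
have c : cvgC (fun N => integralC (kern f (S N))) (integralC (kern f (Bker z))).
  apply: (integralC_dominated _ _ (kern_dom 1 hf hG)).
  - by move=> n; apply: measC_kern; [case: hf|case: (hS n)].
  - move=> x e e0; set K := absC (f x) * mu x + 1.
    have K0 : 0 < K by rewrite ltr_wpDl // mulr_ge0 ?absC_ge0.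
    have [N HN] := PS_cvg (conjc z * x) ESeq_kseq (divr_gt0 e0 K0).
    exists N => n /HN h; rewrite /kern -mulrBl -mulrBr -rmorphB /= absCM absC_real.
    rewrite absCM absC_conj ger0_norm //.
    apply: (@le_trans _ _ (K * (e / K))); last by rewrite mulrCA mulfV ?mulr1 // gt_eqF.
    rewrite mulrAC ler_pM ?mulr_ge0 ?absC_ge0 // /K lerDl //.
  - move=> n x; apply: le_trans (kern_le _ _ _ ltr01).
    by rewrite !absC_kern ler_wpM2r // ler_wpM2l ?absC_ge0.
by move=> e /c[N HN]; exists N => n /HN; rewrite -E.
Qed.

Lemma fcoef_PS a : ESeq a -> L2 mu (PS a) -> fcoef (PS a) = a.
Proof.
move=> ha h2; apply: funext => k; rewrite /fcoef inner_mono // -mulrA -rmorphM /=.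
by rewrite mulfV ?mulr1 // gt_eqF // mom_gt0.
Qed.

Lemma reproducing f z : L2H mu f -> f z = inner mu f (Bker z).
Proof.
move=> [hf /taylor[a [ha /funext fa]]]; move: hf; rewrite fa => hf.
have := repro_series z hf; rewrite fcoef_PS //; apply: cvgC_uniq.
exact: cvgC_PS.
Qed.

Lemma represents_Bker z : represents mu z (Bker z).
Proof. by split; [exact: Bker_L2H|move=> f hf; exact: reproducing]. Qed.

Lemma inner_conj f g : L2 mu f -> L2 mu g -> inner mu g f = conjc (inner mu f g).
Proof.
move=> hf hg; have [h1 h2] := kern_int hf hg.
rewrite /inner !integralCE; apply: complexP => /=.
  congr RI; apply: funext => x; rewrite !ReM ?ImM /=.
  by case: (f x) (g x) => [a b] [c d] /=; ring.
rewrite -mulN1r -RIZ //.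
congr RI; apply: funext => x; rewrite !ImM ?ReM /=.
by case: (f x) (g x) => [a b] [c d] /=; ring.
Qed.

(** Testing a representing function against the monomials prescribes its inner products with them,
    up to conjugation, and hence its Taylor coefficients. *)
Lemma represents_uniq z B : represents mu z B -> B = Bker z.
Proof.
move=> [[hB eB] H]; have [b [hb /funext Bb]] := taylor eB.
rewrite Bker_PS Bb; congr PS; apply: funext => k.
rewrite Bb in hB; have := fcoef_PS hb hB => /(congr1 (@^~ k)) <-.
rewrite /fcoef inner_conj //; last exact: (mono_L2H k).1.
have := H _ (mono_L2H k); rewrite Bb => <-.
by rewrite /mono conjCX mulrC.
Qed.

Lemma kernel_value z w : bergman_kernel mu z w = PS kseq (conjc z * w).
Proof.
rewrite /bergman_kernel; case: xgetP => [B _ /= hB|/(_ (Bker z)) []].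
  by rewrite (represents_uniq hB).
exact: represents_Bker.
Qed.

Lemma eval_cont z : Defs.eval_continuous mu z.
Proof.
move=> f hf eps e0; set N := sqnorm (Bker z); have N0 : 0 <= N := sqnorm_ge0 _.
(* [inner_bound] with t = 1 / d will bound the difference of values by 2 (d + d N); the extra 1 in
   the denominator makes this strictly less than [eps]. *)
set d := eps / (2 * (1 + N) + 1).
have K0 : 0 < 2 * (1 + N) + 1 by rewrite ltr_wpDl // mulr_ge0 // addr_ge0.
have d0 : 0 < d by rewrite divr_gt0.
exists d => // g hg gf.
have hgf := L2B hg.1 hf.1.
rewrite (reproducing z hg) (reproducing z hf) -innerB //; [|exact: hg.1|exact: hf.1|exact: (Bker_L2H z).1].
have di : 0 < d^-1 by rewrite invr_gt0.
apply: (le_lt_trans (inner_bound di hgf (Bker_L2H z).1)); rewrite invrK -/N.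
have h := L2norm_lt (ltW d0) gf.
have h1 : d^-1 * sqnorm (g \- f) <= d.
  by rewrite mulrC ler_pdivrMr // -expr2 ltW.
apply: (@le_lt_trans _ _ (2 * (d + d * N))); first by rewrite ler_pM2l // lerD2r.
have -> : 2 * (d + d * N) = d * (2 * (1 + N)) by ring.
by rewrite /d mulrAC ltr_pdivrMr // ltr_pM2l // ltrDl.
Qed.

(** The parameter of [inner_bound] is taken to be T^k: the first term is then controlled by the
    kernel coefficients at radius T rho, the second by (rho / T)^k <= 1. *)
Lemma ESeq_fcoef f : L2 mu f -> ESeq (fcoef f).
Proof.
move=> hf rho r0; set T := 1 + rho; have T1 : 1 <= T by rewrite lerDl.
have T0 : 0 < T := lt_le_trans ltr01 T1.
have [|M HM] := ESeq_kseq (_ : 0 <= T * rho); first by rewrite mulr_ge0 // ltW.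
exists (2 * (sqnorm f * M + 1)) => k.
have Tk : 0 < T ^+ k by rewrite exprn_gt0.
rewrite /fcoef absCM -mulrA.
apply: (le_trans (ler_wpM2r _ (inner_bound Tk hf (mono_L2H k).1))).
  by rewrite mulr_ge0 ?absC_ge0 ?exprn_ge0.
have -> : sqnorm (mono k) = mom k.
  by congr RI; apply: funext => z; rewrite absCX -exprM mulnC.
rewrite -mulrA ler_pM2l // mulrDl; apply: lerD.
  have -> : T ^+ k * sqnorm f * (absC (kseq k) * rho ^+ k) =
    sqnorm f * (absC (kseq k) * (T * rho) ^+ k) by rewrite exprMn; ring.
  by rewrite ler_wpM2l ?sqnorm_ge0.
have -> : (T ^+ k)^-1 * mom k * (absC (kseq k) * rho ^+ k) =
    rho ^+ k / T ^+ k.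
  by rewrite absC_kseq; field; rewrite !gt_eqF // mom_gt0.
by rewrite ler_pdivrMr // mul1r lerXn2r ?nnegrE ?(ltW T0) // /T lerDr.
Qed.

Lemma projection_entire f : L2 mu f -> entire (fun z => inner mu f (Bker z)).
Proof.
move=> hf; have -> : (fun z => inner mu f (Bker z)) = PS (fcoef f).
  apply: funext => z; apply: (cvgC_uniq (repro_series z hf)).
  by apply: cvgC_PS; exact: ESeq_fcoef.
by apply: PS_entire; exact: ESeq_fcoef.
Qed.

(** The candidate limit is the projection h z = <f, B_z>, entire for every f in L^2. The
    approximants tend to it pointwise, so Fatou's lemma gives f - h norm 0; as [mu] is positive
    almost everywhere, f = h almost everywhere, and h inherits square integrability from f. *)
Lemma closed_L2H : L2H_closed mu.
Proof.
move=> f hf H.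
have : forall n : nat, exists g, L2H mu g /\ L2norm mu (f \- g) < n.+1%:R^-1.
  by move=> n; have [|g h1 h2] := H n.+1%:R^-1; [rewrite invr_gt0|exists g].
move=> /choice[g Hg].
pose h z := inner mu f (Bker z).
have eh : entire h := projection_entire hf.
have mh : Defs.measurableC h := measC_entire eh.
have hfg n : L2 mu (f \- g n) := L2B hf (Hg n).1.1.
have Nfg n : sqnorm (f \- g n) < n.+1%:R^-1 ^+ 2.
  by apply: L2norm_lt (Hg n).2; rewrite invr_ge0.
have gh z : cvgC (fun n => g n z) (h z).
  (* With t = n + 1 both terms of [inner_bound] are of order 1 / (n + 1), since the squared norm of
     f - g n is below 1 / (n + 1)^2. *)
  move=> e e0; set N := 2 * (1 + sqnorm (Bker z)).
  have N0 : 0 <= N by rewrite mulr_ge0 // addr_ge0 // sqnorm_ge0.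
  exists (Num.truncn (N / e)).+1 => n Nn.
  have n0 : 0 < n.+1%:R :> R by rewrite ltr0n.
  rewrite (reproducing z (Hg n).1) -innerB //; [|exact: (Hg n).1.1|exact: (Bker_L2H z).1].
  apply: (le_trans (inner_bound n0 (hfg n) (Bker_L2H z).1)).
  apply: (@le_trans _ _ (N / n.+1%:R)).
    rewrite /N -mulrA ler_pM2l // mulrDl mul1r; apply: lerD; last by rewrite mulrC.
    rewrite -ler_pdivlMl //; apply: (le_trans (ltW (Nfg n))).
    by rewrite expr2.
  rewrite ler_pdivrMr // mulrC -ler_pdivrMr //.
  apply: (le_trans (ltW (truncnS_gt _))); rewrite ler_nat.
  by apply: (leq_trans Nn).
pose u n (p : measurableTypeR R * measurableTypeR R) :=
  (absC ((f \- g n) (planeC p)) ^+ 2 * mu (planeC p))%:E.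
pose v (p : measurableTypeR R * measurableTypeR R) :=
  (absC (f (planeC p) - h (planeC p)) ^+ 2 * mu (planeC p))%:E.
have mv : measurable_fun setT v.
  apply/measurable_EFinP; apply: (@measRM _ (fun z => absC (f z - h z) ^+ 2) mu) => //.
  by apply: measRX; apply: measC_absC; exact: measCD hf.1 (measCN mh).
have mun n : measurable_fun setT (u n).
  apply/measurable_EFinP; apply: (@measRM _ (fun z => absC ((f \- g n) z) ^+ 2) mu) => //.
  by apply: measRX; apply: measC_absC; exact: (hfg n).1.
have u0 n p : (0 <= u n p)%E by rewrite lee_fin mulr_ge0 // exprn_ge0 // absC_ge0.
have v0 p : (0 <= v p)%E by rewrite lee_fin mulr_ge0 // exprn_ge0 // absC_ge0.
have uv p : (fun n => u n p) @ \oo --> v p.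
  apply: cvg_EFin; first exact: nearW.
  apply: cvgM; last exact: cvg_cst.
  have ab : (fun n => absC ((f \- g n) (planeC p))) @ \oo -->
      absC (f (planeC p) - h (planeC p)).
    apply/cvgrPdist_le => e /(gh (planeC p))[N HN]; exists N => // n /HN /=.
    set a := f _; set b := h _; set c := g _ _ => bc.
    have E : absC (a - b - (a - c)) <= e.
      by rewrite opprB addrC addrA subrK absCB.
    rewrite ler_norml; apply/andP; split.
      rewrite lerNl opprB; apply: le_trans (absC_dist _ _) _.
      by rewrite absCB.
    by apply: le_trans (absC_dist _ _) _.
  by apply: cvgM.
have Iv : (\int[area R]_p v p = 0)%E.
  apply/eqP; rewrite eq_le integral_ge0 ?andbT; last by move=> p _; exact: v0.
  have -> : (\int[area R]_p v p = \int[area R]_p limn_einf (u^~ p))%E.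
    by apply: eq_integral => p _; rewrite (cvg_limn_einf_sup (uv p)).1.
  apply: (le_trans (fatou _ measurableT mun (fun n p _ => u0 n p))).
  suff c0 : (fun n => \int[area R]_p u n p)%E @ \oo --> 0%E.
    by rewrite (cvg_limn_einf_sup c0).1.
  have E n : (\int[area R]_p u n p = (sqnorm (f \- g n))%:E)%E.
    rewrite /sqnorm /RI /Rintegral fineK //.
    exact: (integrable_fin_num measurableT (L2_int (hfg n))).
  under eq_fun do rewrite E.
  apply: cvg_EFin; first exact: nearW.
  apply/cvgrPdist_le => e e0; exists (Num.truncn e^-1) => // n /= Nn.
  rewrite sub0r normrN ger0_norm ?sqnorm_ge0 //.
  apply: (le_trans (ltW (Nfg n))).
  have n1 : n.+1%:R^-1 <= 1 :> R by rewrite invf_le1 // ler1n.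
  apply: (@le_trans _ _ n.+1%:R^-1); first by rewrite expr2 ler_piMr // invr_ge0.
  rewrite -[e]invrK lef_pV2 ?posrE ?invr_gt0 //.
  by apply: (le_trans (ltW (truncnS_gt _))); rewrite ler_nat.
have fh : {ae area R, forall p, f (planeC p) = h (planeC p)}.
  have := (ae_eq_integral_abs (area R) measurableT mv).1.
  under eq_integral do rewrite gee0_abs //.
  move=> /(_ Iv) av.
  apply: (@filterS2 _ _ (ae_filter_ringOfSetsType (area R)) _ _ _ _ av mupos).
  move=> p /(_ I) vp mp; apply/eqP; rewrite -subr_eq0 -absC_eq0 -sqrf_eq0.
  by move/eqP: vp; rewrite eqe mulf_eq0 (gt_eqF mp) orbF.
exists h => //; split => //; split => //.
apply: le_lt_trans hf.2; rewrite le_eqVlt; apply/orP; left; apply/eqP.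
apply: ae_eq_integral => //.
- apply/measurable_EFinP; apply: (@measRM _ (fun z => absC (h z) ^+ 2) mu) => //.
  by apply: measRX; apply: measC_absC.
- apply/measurable_EFinP; apply: (@measRM _ (fun z => absC (f z) ^+ 2) mu) => //.
  by apply: measRX; apply: measC_absC; exact: hf.1.
- apply: (@filterS _ _ (ae_filter_ringOfSetsType (area R)) _ _ _ fh).
  by move=> p /= fhp _; rewrite fhp.
Qed.

End WeightedSpace.

(** * The weights W *)

Section RadialWeight.
Context {R : realType}.
Implicit Types (z w : R[i]).
Variables (n alpha m : R).
Hypotheses (hn : -2 < n) (halpha : 0 < alpha) (hm : 0 < m).
Local Notation mR := (measurableTypeR R).
Local Notation Wt := (W n alpha m).

Let c2pi : R := (2 * pi)^-1.
Let c2pi_gt0 : 0 < c2pi. Proof. by rewrite invr_gt0 mulr_gt0 // pi_gt0. Qed.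

Lemma W_radial z : Wt z = c2pi * radial n alpha m z.
Proof. by rewrite /W /radial mulrA. Qed.

Lemma measR_radial (b : R) : measR (@radial R n b m).
Proof. exact: measurable_radial. Qed.

Lemma measR_W : measR Wt.
Proof.
rewrite (_ : Wt = fun z => c2pi * radial n alpha m z).
  by apply: measRM; [exact: measR_cst|exact: measR_radial].
by apply: funext => z; exact: W_radial.
Qed.

Lemma W_ge0 z : 0 <= Wt z.
Proof. by rewrite W_radial mulr_ge0 ?radial_ge0 // ltW. Qed.

Lemma W_rot w z : absC w = 1 -> Wt (w * z) = Wt z.
Proof. by move=> w1; rewrite /W absCM w1 mul1r. Qed.

Lemma intR_radial (b : R) : 0 < b -> intR (@radial R n b m).
Proof.
move=> b0; apply: intR_fin; first exact: measR_radial.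
  by move=> z; exact: radial_ge0.
exact: radial_integral_fin.
Qed.

Lemma pow2m (y : R) : 0 <= y -> y `^ (2 * m) = (y `^ m) ^+ 2.
Proof. by move=> y0; rewrite mulrC powRrM powR_mulrn // powR_ge0. Qed.

(** Completing the square in x = |z|^m gives A x - alpha x^2 <= A^2 / (2 alpha) - (alpha / 2) x^2,
    so half of the decay of the weight absorbs the exponential. *)
Lemma intR_exp_W (A : R) : intR (fun z => expR (A * absC z `^ m) * Wt z).
Proof.
have a2 : 0 < alpha / 2 by rewrite divr_gt0.
apply: (intR_dom _ (intRZ (c2pi * expR (A ^+ 2 / (2 * alpha))) (intR_radial a2))).
  apply: measRM; last exact: measR_W.
  have mp : measR (fun x : R[i] => absC x `^ m).
    exact: (measurableT_comp (measurable_powR m) measR_absC).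
  have mexp : measurable_fun [set: mR] (@expR R) by exact: measurable_expR.
  exact: (measurableT_comp mexp (measRM (measR_cst A) mp)).
move=> z; have p0 : 0 <= expR (A * absC z `^ m) * Wt z.
  by apply: mulr_ge0; [exact: expR_ge0|exact: W_ge0].
rewrite (ger0_norm p0) W_radial [leLHS]mulrCA -[leRHS]mulrA ler_pM2l //.
rewrite /radial [leLHS]mulrCA [leRHS]mulrCA ler_wpM2l ?powR_ge0 //.
rewrite -!expRD ler_expR pow2m ?absC_ge0 //; set x := absC z `^ m.
rewrite -subr_ge0.
have -> : A ^+ 2 / (2 * alpha) + - (alpha / 2 * x ^+ 2) - (A * x + - (alpha * x ^+ 2))
   = (A - alpha * x) ^+ 2 / (2 * alpha) by field; rewrite gt_eqF.
by rewrite divr_ge0 ?sqr_ge0 // mulr_ge0 // ltW.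
Qed.

Lemma W_pos z : z != 0 -> 0 < Wt z.
Proof.
move=> z0; rewrite W_radial mulr_gt0 // mulr_gt0 ?expR_gt0 // powR_gt0 //.
by rewrite absC_gt0.
Qed.

Lemma W_ae_pos : {ae area R, forall p, 0 < Wt (planeC p)}.
Proof.
exists ([set 0] `*` [set 0]); split.
- by apply: measurableX; exact: measurable_set1.
- rewrite product_measure1E; [|exact: measurable_set1|exact: measurable_set1].
  by rewrite [X in (X * _)%E](_ : _ = 0%E) ?mul0e //; exact: lebesgue_measure_set1.
- move=> p /= H; apply: contrapT => p0; apply: H; apply: W_pos.
  apply/eqP => pz; apply: p0; move: pz; case: p => x y.
  by rewrite /planeC /= => -[-> ->].
Qed.

Lemma mom_intR k : intR (fun z => absC z ^+ (2 * k) * Wt z).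
Proof.
have := L2_int measR_W W_ge0 (mono_L2H hm measR_W W_ge0 intR_exp_W k).1.
by apply: eq_integrable => // p _; rewrite absCX -exprM mulnC.
Qed.

(** The moment is at least its part over one square near radius [rho], on which rho <= |z| <= 3
    rho. *)
Lemma mom_lower : exists c0 A : R, [/\ 0 < c0, 0 <= A & forall k rho, 1 <= rho ->
  c0 * rho ^+ (2 * k) * expR (- (A * rho `^ (2 * m))) <= mom Wt k].
Proof.
(* For n < 0 the bound |z|^n >= (3 rho)^n on that square produces 3^n; for n >= 0 the factor 1
   suffices. *)
set kp := Num.min 1 (3 `^ n).
have kp0 : 0 < kp by rewrite lt_min ltr01 powR_gt0.
set A := alpha * 3 `^ (2 * m).
exists (c2pi * kp), A; split.
- by rewrite mulr_gt0.
- by rewrite mulr_ge0 ?powR_ge0 // ltW.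
move=> k rho r1; have r0 : 0 < rho := lt_le_trans ltr01 r1.
pose B : set (mR * mR) := `[rho, 2 * rho]%classic `*` `[0, rho]%classic.
have mB : measurable B by exact: measurableX.
have aB : (area R B = (rho ^+ 2)%:E)%E.
  rewrite product_measure1E //= !lebesgue_measure_itv /= !lte_fin r0.
  have -> : rho < 2 * rho by lra.
  by rewrite -!EFinD -EFinM; congr EFin; ring.
pose v z : R := \1_B (complex.Re z, complex.Im z).
have vE p : v (planeC p) = \1_B p by rewrite /v; case: p.
have iv : intR v.
  apply: intR_fin => //.
    by rewrite /measR; under eq_fun do rewrite vE; exact: measurable_indic.
  under eq_integral do rewrite vE.
  by rewrite integral_indic // setIT [X in (X < _)%E]aB ltry.
have RIv : RI v = rho ^+ 2.
  rewrite /RI /Rintegral; under eq_integral do rewrite vE.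
  by rewrite integral_indic // setIT [X in fine X]aB.
set C := rho ^+ (2 * k) * (c2pi * (kp * rho `^ n * expR (- (A * rho `^ (2 * m))))).
apply: (@le_trans _ _ (RI (fun z => C * v z))); last first.
  apply: RI_le; [exact: intRZ|exact: mom_intR|move=> z].
  have [zB|zB] := pselect (B (complex.Re z, complex.Im z)); last first.
    by rewrite /v indicE memNset // mulr0 mulr_ge0 ?W_ge0 // exprn_ge0 // absC_ge0.
  rewrite /v indicE mem_set // mulr1.
  case: zB => /=; rewrite !in_itv /= => /andP[x1 x2] /andP[y1 y2].
  have z1 : rho <= absC z.
    by apply: le_trans x1 _; apply: le_trans (absC_Re z); exact: ler_norm.
  have z0 : 0 < absC z := lt_le_trans r0 z1.
  have z3 : absC z <= 3 * rho.
    apply: (le_trans (absC_le_ReIm z)).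
    by rewrite !ger0_norm // ?(le_trans (ltW r0)) //; lra.
  have rr0 := ltW r0; have zz0 := ltW z0.
  apply: ler_pM; rewrite ?exprn_ge0 ?mulr_ge0 ?expR_ge0 ?powR_ge0 ?(ltW c2pi_gt0) ?(ltW kp0) //.
    by rewrite lerXn2r ?nnegrE.
  rewrite W_radial ler_pM2l // /radial.
  apply: ler_pM; rewrite ?mulr_ge0 ?expR_ge0 ?powR_ge0 ?(ltW kp0) //; last first.
    rewrite ler_expR lerN2 /A -mulrA ler_pM2l // -powRM //.
    by rewrite ge0_ler_powR ?nnegrE ?mulr_ge0 // ltW.
  have [n0|n0] := leP 0 n.
    apply: (@le_trans _ _ (1 * rho `^ n)).
      by rewrite ler_wpM2r ?powR_ge0 // ge_min lexx.
    by rewrite mul1r ge0_ler_powR ?nnegrE.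
  apply: (@le_trans _ _ (3 `^ n * rho `^ n)).
    by rewrite ler_wpM2r ?powR_ge0 // ge_min lexx orbT.
  rewrite -powRM // -[n]opprK !(powRN _ (- n)) lef_pV2 ?posrE ?powR_gt0 ?mulr_gt0 //.
  by rewrite ge0_ler_powR ?nnegrE ?mulr_ge0 ?oppr_ge0 // ltW.
rewrite RIZ // RIv /C.
(* The area rho^2 of the square makes up for rho^n, because n > -2 and rho >= 1. *)
have rn : 1 <= rho `^ n * rho ^+ 2.
  rewrite -[rho ^+ 2]powR_mulrn ?(ltW r0) // -powRD ?(gt_eqF r0) ?implybT //.
  by rewrite -[leLHS](powRr0 rho) ler_powR //; move: hn; lra.
have -> : rho ^+ (2 * k) * (c2pi * (kp * rho `^ n * expR (- (A * rho `^ (2 * m))))) *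
   rho ^+ 2 = (rho `^ n * rho ^+ 2) *
   (c2pi * kp * rho ^+ (2 * k) * expR (- (A * rho `^ (2 * m)))) by ring.
by rewrite ler_peMl // !mulr_ge0 ?expR_ge0 ?exprn_ge0 ?(ltW c2pi_gt0) ?(ltW kp0) // ltW.
Qed.

(** Raising x <= exp x, for x = y^(2 m) / (K k), to the power k / m gives y^(2 k) <= (K k)^(k / m)
    exp(alpha y^(2 m) / 2); the value K = 2 / (alpha m) is what produces alpha / 2. The other half
    of the decay stays integrable. *)
Lemma mom_upper : exists D K : R, [/\ 0 < D, 0 < K & forall k, (0 < k)%N ->
  D * (K * k%:R) `^ (- (k%:R / m)) <= (mom Wt k)^-1].
Proof.
have a2 : 0 < alpha / 2 by rewrite divr_gt0.
set D1 := c2pi * RI (@radial R n (alpha / 2) m) + 1.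
have D10 : 0 < D1.
  rewrite ltr_wpDl // mulr_ge0 ?(ltW c2pi_gt0) //; apply: RI_ge0 => z.
  exact: radial_ge0.
set K := 2 / (alpha * m).
have K0 : 0 < K by rewrite divr_gt0 // mulr_gt0.
exists D1^-1, K; split=> //; first by rewrite invr_gt0.
move=> k k0; have kR : 0 < k%:R :> R by rewrite ltr0n.
have Kk : 0 < K * k%:R by rewrite mulr_gt0.
have km : 0 <= k%:R / m by rewrite divr_ge0 // ltW.
have mk0 : 0 < mom Wt k by exact: (mom_gt0 mom_lower).
rewrite powRN -invfM lef_pV2 ?posrE ?mulr_gt0 ?powR_gt0 //.
set Q := (K * k%:R) `^ (k%:R / m).
have Q0 : 0 < Q by exact: powR_gt0.
apply: (@le_trans _ _ (RI (fun z => (Q * c2pi) * radial n (alpha / 2) m z))); last first.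
  rewrite RIZ; last exact: intR_radial.
  by rewrite -mulrA mulrC ler_pM2r // /D1 lerDl.
apply: RI_le; [exact: mom_intR|by apply: intRZ; exact: intR_radial|move=> z].
set y := absC z; have y0 : 0 <= y := absC_ge0 z.
have yk : y ^+ (2 * k) <= Q * expR (alpha / 2 * y `^ (2 * m)).
  set x := (K * k%:R)^-1 * y `^ (2 * m).
  have x0 : 0 <= x by rewrite mulr_ge0 ?powR_ge0 // invr_ge0 ltW.
  have xe : x <= expR x by apply: le_trans (expR_ge1Dx x); rewrite lerDr.
  have yE : y ^+ (2 * k) = Q * x `^ (k%:R / m).
    rewrite /Q /x -powRM ?(ltW Kk) // mulrA mulfV ?gt_eqF // mul1r -powRrM.
    rewrite -powR_mulrn // natrM; congr (_ `^ _); field.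
    by rewrite gt_eqF.
  rewrite yE ler_pM2l //; apply: (le_trans (ge0_ler_powR km _ _ xe)).
  - by rewrite nnegrE.
  - by rewrite nnegrE expR_ge0.
  rewrite -expRM ler_expR /x le_eqVlt; apply/orP; left; apply/eqP.
  by rewrite /K; field; rewrite !gt_eqF.
rewrite W_radial -/y /radial.
apply: (le_trans (ler_wpM2r _ yk)).
  by rewrite mulr_ge0 ?mulr_ge0 ?powR_ge0 ?expR_ge0 // ltW.
rewrite -/y le_eqVlt; apply/orP; left; apply/eqP.
have -> : expR (- (alpha * y `^ (2 * m))) =
   expR (- (alpha / 2 * y `^ (2 * m))) * expR (- (alpha / 2 * y `^ (2 * m))).
  by rewrite -expRD; congr expR; field.
set e := expR (- _); have -> : expR (alpha / 2 * y `^ (2 * m)) = e^-1.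
  by rewrite /e expRN invrK.
by field; rewrite gt_eqF // expR_gt0.
Qed.

End RadialWeight.

Theorem theorem3 (R : realType) (n alpha m : R)
    (hn : -2 < n) (halpha : 0 < alpha) (hm : 0 < m)
    (hmZ : m \isn't a Num.int) :
  [/\ (area R).-integrable setT (fun p => (W n alpha m (planeC p))%:E),
      admissible (W n alpha m)
    & forall w : R[i], w != 0 ->
        infinite_set [set z : R[i] | bergman_kernel (W n alpha m) z w = 0]].
Proof.
set Wt := W n alpha m.
have mW : measR Wt := measR_W n alpha m.
have W0 : forall z, 0 <= Wt z := W_ge0 n alpha m.
have Wr : forall w z, absC w = 1 -> Wt (w * z) = Wt z by move=> w z; exact: W_rot.
have We A : intR (fun z => expR (A * absC z `^ m) * Wt z) by exact: intR_exp_W.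
have Wp : {ae area R, forall p, 0 < Wt (planeC p)} := W_ae_pos n alpha m.
have lower := mom_lower hn halpha hm.
split.
- exact: (intR_mu We).
- split; first by split.
    by move=> z; exact: (eval_cont hm mW W0 Wr We lower).
  exact: (closed_L2H hm mW W0 Wr We lower Wp).
move=> w w0 fin.
have [C [A [_ _ grow _]]] := PS_kseq_growth lower.
have [D [K [D0 K0 up]]] := mom_upper hn halpha hm.
have low k : (0 < k)%N -> D * (K * k%:R) `^ (- (k%:R / m)) <= absC (kseq Wt k).
  by move=> /up; rewrite (absC_kseq lower).
apply: (infinite_zeros (ESeq_kseq lower) hm hmZ grow D0 K0 low).
(* As w != 0, every zero u of [PS (kseq Wt)] is the image under z -> conj z w of the zero conj (u /
   w) of the kernel, so finiteness of the latter zero set would pass to the former. *)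
apply: sub_finite_set (finite_image (fun z => conjc z * w) fin) => u /= uz.
exists (conjc (u / w)).
  by rewrite /= (kernel_value hm mW W0 Wr We lower) conjcK divfK.
by rewrite conjcK divfK.
Qed.
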